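(* Consider the split-plot model and the asymptotic frameworks described in the context, and suppose $H_0:\boldsymbol T\boldsymbol\mu=\mathbf 0$ holds. Let $\lambda_1\ge\lambda_2\ge\dots\ge\lambda_{ad}$ be the eigenvalues of $\boldsymbol T\boldsymbol V_N\boldsymbol T$ and $\beta_s=\lambda_s/\sqrt{\sum_{\ell=1}^{ad}\lambda_\ell^2}$, $s=1,\dots,ad$. Let $$\widetilde W_N=\frac{Q_N-\operatorname{tr}(\boldsymbol T\boldsymbol V_N)}{\sqrt{2\operatorname{tr}((\boldsymbol T\boldsymbol V_N)^2)}}.$$ Then, as $N\to\infty$ under any one of the frameworks (F1), (F2), (F3): (a) if $\beta_1=\max_{s\le ad}\beta_s\to0$, then $\widetilde W_N$ converges in distribution to $\mathcal N(0,1)$; (b) if $\beta_1\to1$, then $\widetilde W_N$ converges in distribution to $(C-1)/\sqrt2$ with $C\sim\chi^2_1$; (c) if for every $s\in\mathbb N$ we have $\beta_s\to b_s$ for a non-increasing sequence $(b_s)_{s\ge1}$ in $[0,1]$ with $\sum_{s=1}^\infty b_s^2=1$, then $\widetilde W_N$ converges in distribution to $\sum_{s=1}^\infty b_s(C_s-1)/\sqrt2$, where $C_1,C_2,\dots$ are i.i.d. $\chi^2_1$ random variables.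
   Context: Let $a,d\in\mathbb N$, $n_1,\dots,n_a\in\mathbb N$ and $N=\sum_{i=1}^a n_i$. Observations $\boldsymbol X_{i,j}\sim\mathcal N_d(\boldsymbol\mu_i,\boldsymbol\Sigma_i)$, $j=1,\dots,n_i$, $i=1,\dots,a$, are mutually independent, with $\boldsymbol\Sigma_i$ symmetric positive definite; $\boldsymbol\mu=(\boldsymbol\mu_1^\top,\dots,\boldsymbol\mu_a^\top)^\top\in\mathbb R^{ad}$. Let $\boldsymbol T=\boldsymbol T_W\otimes\boldsymbol T_S$ with $\boldsymbol T_W\in\mathbb R^{a\times a}$ and $\boldsymbol T_S\in\mathbb R^{d\times d}$ symmetric idempotent matrices. Let $\boldsymbol V_N=\bigoplus_{i=1}^a\frac{N}{n_i}\boldsymbol\Sigma_i$ (block-diagonal), $\overline{\boldsymbol X}_i=n_i^{-1}\sum_{j=1}^{n_i}\boldsymbol X_{i,j}$, $\overline{\boldsymbol X}=(\overline{\boldsymbol X}_1^\top,\dots,\overline{\boldsymbol X}_a^\top)^\top$ and $Q_N=N\,\overline{\boldsymbol X}^\top\boldsymbol T\overline{\boldsymbol X}$. Asymptotics: $N\to\infty$, where $a,d,n_i$ may depend on $N$, $n_i/N\to\rho_i\in(0,1)$ for each $i$, and one of the following holds: (F1) $a$ fixed and $\min(d,n_1,\dots,n_a)\to\infty$; (F2) $d$ fixed and $\min(a,n_1,\dots,n_a)\to\infty$; (F3) $\min(a,d,n_1,\dots,n_a)\to\infty$. No relation between the rates of $a$, $d$ and the sample sizes is assumed. *)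

(* Defs.v *)
From HB Require Import structures.
From mathcomp Require Import all_boot all_order all_algebra.
From mathcomp Require Import all_classical all_reals all_analysis.
Unset Printing Implicit Defensive.
Import Order.TTheory GRing.Theory Num.Theory.
Import numFieldNormedType.Exports.
Local Open Scope classical_set_scope.
Local Open Scope ring_scope.

Section LinAlg.
Context {R : realType}.

(* Index p : 'I_(m*n) <-> pair (i, j) : 'I_m * 'I_n, row-major (p = i*n + j);
   this is the inverse of mathcomp's [mxvec_index]. *)
Definition unidx {m n : nat} (p : 'I_(m * n)) : 'I_m * 'I_n :=
  enum_val (cast_ord (esym (mxvec_cast m n)) p).

Definition kron {m1 n1 m2 n2} (A : 'M[R]_(m1, n1)) (B : 'M[R]_(m2, n2))
  : 'M[R]_(m1 * m2, n1 * n2) :=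
  \matrix_(p, q) (A (unidx p).1 (unidx q).1 * B (unidx p).2 (unidx q).2).

Definition stack (a d : nat) (v : nat -> 'cV[R]_d) : 'cV[R]_(a * d) :=
  \col_p v (unidx p).1 (unidx p).2 0.

Definition blockdiag (a d : nat) (M : nat -> 'M[R]_d) : 'M[R]_(a * d) :=
  \matrix_(p, q) (if (unidx p).1 == (unidx q).1
                  then M (unidx p).1 (unidx p).2 (unidx q).2 else 0).

Definition sym_idempotent {n} (A : 'M[R]_n) : Prop := A^T = A /\ A *m A = A.

Definition sym_posdef {n} (A : 'M[R]_n) : Prop :=
  A^T = A /\ forall u : 'cV[R]_n, u != 0 -> 0 < (u^T *m A *m u) 0 0.

Definition eigenvalues_desc {n} (A : 'M[R]_n) (s : seq R) : Prop :=
  size s = n /\ sorted (fun x y => y <= x) s /\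
  char_poly A = \prod_(x <- s) ('X - x%:P).

(* beta_{s+1} = lambda_{s+1} / sqrt(sum_l lambda_l^2)  (0-based index s;
   equal to 0 for s >= size lam) *)
Definition beta (lam : seq R) (s : nat) : R :=
  nth 0 lam s / Num.sqrt (\sum_(x <- lam) x ^+ 2).

End LinAlg.

Section Model.
Context {R : realType} {dT : measure_display} {Omega : measurableType dT}.

Definition Ntot (a : nat) (n : nat -> nat) : nat := \sum_(i < a) n i.

Definition Vmat (a d : nat) (n : nat -> nat) (Sigma : nat -> 'M[R]_d)
  : 'M[R]_(a * d) :=
  blockdiag a d (fun i => ((Ntot a n)%:R / (n i)%:R) *: Sigma i).

Definition sample_mean (d ni : nat) (Xi : nat -> Omega -> 'cV[R]_d)
  (w : Omega) : 'cV[R]_d :=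
  (ni%:R)^-1 *: \sum_(j < ni) Xi j w.

Definition Xbar (a d : nat) (n : nat -> nat)
  (X : nat -> nat -> Omega -> 'cV[R]_d) (w : Omega) : 'cV[R]_(a * d) :=
  stack a d (fun i => sample_mean d (n i) (X i) w).

Definition Qstat (a d : nat) (n : nat -> nat) (T : 'M[R]_(a * d))
  (X : nat -> nat -> Omega -> 'cV[R]_d) (w : Omega) : R :=
  (Ntot a n)%:R * (((Xbar a d n X w)^T *m T *m Xbar a d n X w) 0 0).

Definition Wtilde (a d : nat) (n : nat -> nat) (Sigma : nat -> 'M[R]_d)
  (T : 'M[R]_(a * d)) (X : nat -> nat -> Omega -> 'cV[R]_d) (w : Omega) : R :=
  (Qstat a d n T X w - \tr (T *m Vmat a d n Sigma)) /
  Num.sqrt (2 * \tr ((T *m Vmat a d n Sigma) *m (T *m Vmat a d n Sigma))).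

Definition normal_rv (P : probability Omega R) (Y : Omega -> R) (m v : R)
  : Prop :=
  measurable_fun setT Y /\
  forall A : set R, measurable A ->
    P (Y @^-1` A) = normal_prob m (Num.sqrt v) A.

(* X ~ N_d(mu, Sigma) (Sigma positive definite): every nontrivial linear
   combination u^T X is N(u^T mu, u^T Sigma u). *)
Definition mvnormal (P : probability Omega R) {d : nat}
  (X : Omega -> 'cV[R]_d) (mu : 'cV[R]_d) (Sigma : 'M[R]_d) : Prop :=
  forall u : 'cV[R]_d, u != 0 ->
    normal_rv P (fun w => (u^T *m X w) 0 0) ((u^T *m mu) 0 0)
                ((u^T *m Sigma *m u) 0 0).

(* generators of sigma(X) for a random vector / a real random variable *)
Definition vec_gen {d : nat} (X : Omega -> 'cV[R]_d) : set (set Omega) :=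
  [set E | exists (c : 'I_d) (t : R), E = [set w | X w c 0 <= t]].

Definition rv_gen (Y : Omega -> R) : set (set Omega) :=
  [set E | exists t : R, E = [set w | Y w <= t]].

Definition mutual_indep (P : probability Omega R) {I : eqType} (J : set I)
  (G : I -> set (set Omega)) : Prop :=
  forall F : seq I, uniq F -> (forall l, l \in F -> J l) ->
  forall E : I -> set Omega, (forall l, l \in F -> <<s G l >> (E l)) ->
    P (\bigcap_(l in [set` F]) E l) = \big[*%E/1%E]_(l <- F) P (E l).

Definition chi2_1 (P : probability Omega R) (C : Omega -> R) : Prop :=
  measurable_fun setT C /\
  forall A : set R, measurable A ->
    P (C @^-1` A) = normal_prob 0 1 ((fun z : R => z ^+ 2) @^-1` A).

Definition iid_chi2_1 (P : probability Omega R) (C : nat -> Omega -> R)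
  : Prop :=
  mutual_indep P setT (fun s : nat => rv_gen (C s)) /\ forall s, chi2_1 P (C s).

End Model.

(* convergence in distribution of W_k (on P) to a law mu on R:
   convergence of the cdfs at every continuity point of the limit cdf *)
Definition cvg_dist_law {R : realType} {dT : measure_display}
  {Omega : measurableType dT} (P : probability Omega R)
  (W : nat -> Omega -> R) (mu : set R -> \bar R) : Prop :=
  forall x : R, mu [set x] = 0%E ->
    (fun k => fine (P [set w | W k w <= x])) @ \oo --> fine (mu [set` `]-oo, x]]).

Definition cvg_dist {R : realType} {dT : measure_display}
  {Omega : measurableType dT} (P : probability Omega R)
  (W : nat -> Omega -> R) {dT' : measure_display}
  {Omega' : measurableType dT'} (P' : probability Omega' R)
  (Y : Omega' -> R) : Prop :=
  cvg_dist_law P W (fun A => P' (Y @^-1` A)).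

Definition nat_to_inf (u : nat -> nat) : Prop :=
  forall M : nat, \forall k \near \oo, (M <= u k)%N.

Definition framework (a d : nat -> nat) (n : nat -> nat -> nat) : Prop :=
  let minn_inf := forall M : nat, \forall k \near \oo,
      forall i, (i < a k)%N -> (M <= n k i)%N in
  ((exists a0, forall k, a k = a0) /\ nat_to_inf d /\ minn_inf) \/
  ((exists d0, forall k, d k = d0) /\ nat_to_inf a /\ minn_inf) \/
  (nat_to_inf a /\ nat_to_inf d /\ minn_inf).

(* Main.v *)
Require Import Defs.
From HB Require Import structures.
From mathcomp Require Import all_boot all_order all_algebra.
From mathcomp Require Import all_classical all_reals all_analysis.
From mathcomp Require Import measurable_realfun ring lra.
Set Implicit Arguments.
Unset Strict Implicit.
Unset Printing Implicit Defensive.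
Import Order.TTheory GRing.Theory Num.Theory.
Import numFieldNormedType.Exports.
Local Open Scope classical_set_scope.
Local Open Scope ring_scope.

(* Proof idea.  Write [T V_N T = O^T diag(lambda) O] with [O] orthogonal.  The vector
   [G = sqrt N * O T Xbar] satisfies [Q_N = |G|^2], and independence of the samples gives
   [E cos (u . G + th) = cos th * exp (- sum_s lambda_s u_s^2 / 2)].  Writing
   [exp (- t x^2 / 2)] as the Gaussian average of [cos (sqrt t z x)] and applying Fubini one
   coordinate at a time turns this into the Laplace transform of [Q_N],
     [E exp (- t Q_N / 2) = prod_s (1 + t lambda_s)^(-1/2)],
   so no multivariate uniqueness theorem is needed.  The test functions
   [x |-> 1 / (1 + exp (m (x - a)))] are, on half-lines, uniform limits of polynomials in
   [exp (- m x)] (a geometric series); hence [E f (W_N)] is the iterated integral [chi_mix] of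
   [f] over independent [beta_s (Z_s^2 - 1) / sqrt 2].
   (a) is Lindeberg's replacement of each [(Z^2 - 1) / sqrt 2] by a normal variable, with error
   [O (sum_s beta_s^3) = O (beta_1)].  For (b) and (c) a second-order expansion discards all but
   finitely many terms, at a cost [O (sum_(s >= M) beta_s^2)], and the remaining finite sum
   depends continuously on its coefficients.  The logistic functions determine convergence of
   distribution functions at continuity points. *)

(** The number of eigenvalues may grow with [k], so there is no fixed space on which to take limits,
    and every error bound must be uniform in the dimension. Hence the law of the statistic is
    carried by a list of weights of arbitrary length, and errors are measured by power sums of the
    weights: their squares sum to 1, so the sum of cubes is at most the largest weight.
    Characteristic functions appear in real form. A cosine with a free phase [th] also encodes the
    sine, by a shift of [pi / 2], and this is enough to multiply over independent observations. The
    logistic functions serve three purposes at once. They are bounded with bounded derivatives, as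
    the replacement argument requires. On a half-line they are limits of exponential sums, and both
    [W_N] and the mixture are bounded below by the same [- sum_s beta_s / sqrt 2]. When steep, they
    approximate the indicator of a left half-line. In (c) truncation is harmless because
    [sum_s b_s^2 = 1]: no variance escapes to the far weights. *)

(** * Normal densities and affine changes of variables *)

Section normal_integral.
Context {R : realType}.
Local Notation leb := (@lebesgue_measure R).
Implicit Types (m s : R) (f : R -> R).

(** Change of variables holds with the abstract Radon-Nikodym derivative. That derivative agrees
    almost everywhere with [normal_pdf], since both have the same integral over every measurable
    set. *)
Lemma ge0_integral_normal_prob m s (f : R -> \bar R) : measurable_fun setT f ->
  (forall x, 0 <= f x)%E ->
  (\int[normal_prob m s]_x f x = \int[leb]_x (f x * (normal_pdf m s x)%:E))%E.
Proof.
move=> mf f0.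
have dom := normal_prob_dominates m s.
rewrite -(Radon_Nikodym_SigmaFinite.change_of_variables dom (f := f))//=.
have mpdf : measurable_fun setT (fun x => (normal_pdf m s x)%:E).
  by apply/measurable_EFinP; exact: measurable_normal_pdf.
apply: ae_eq_integral => //.
- apply: emeasurable_funM => //.
  exact: (measurable_int leb (Radon_Nikodym_SigmaFinite.f_integrable dom)).
- exact: emeasurable_funM.
- apply: ae_eqe_mul2l => /=.
  apply: integral_ae_eq => //=.
  + exact: (Radon_Nikodym_SigmaFinite.f_integrable dom).
  + by move=> E _ mE; rewrite -(Radon_Nikodym_SigmaFinite.f_integral dom).
Qed.

Lemma ge0_integral_affine m s f : 0 < s -> continuous f -> (forall x, 0 <= f x) ->
  (\int[leb]_x (f x)%:E = \int[leb]_x (f (s * x + m) * s)%:E)%E.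
Proof.
move=> s0 cf f0.
pose F (x : R) : R := s * x + m.
have dF (x : R) : is_derive x (1 : R) F s.
  have sF : is_derive x (1 : R) (fun x : R => s * x) s.
    have := @is_deriveZ _ R R id s x 1 1.
    by rewrite /GRing.scale/= mulr1; apply.
  have := @is_deriveD _ R R _ (cst m) x 1 s 0 sF.
  by rewrite addr0; apply.
have F'E : F^`()%classic = cst s.
  by apply/funext => x; rewrite derive1E derive_val.
rewrite (@increasing_ge0_integration_by_substitutionT R F f)//.
- by apply: eq_integral => x _; rewrite F'E.
- by move=> x y xy; rewrite /F ltrD2r ltr_pM2l.
- by rewrite F'E => ?; exact: cvg_cst.
- by rewrite F'E; exact: is_cvg_cst.
- by rewrite F'E; exact: is_cvg_cst.
- apply: (cvg_comp (fun x => s * x) (fun x => x + m)); last exact: cvg_addrr_Ny.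
  exact: gt0_cvgMrNy.
- apply: (cvg_comp (fun x => s * x) (fun x => x + m)); last exact: cvg_addrr.
  exact: gt0_cvgMry.
Qed.

Lemma normal_peakE s : 0 < s ->
  normal_peak s = s^-1 * (Num.sqrt (pi *+ 2))^-1.
Proof.
move=> s0; rewrite /normal_peak -mulrnAr sqrtrM ?sqr_ge0//.
by rewrite sqrtr_sqr gtr0_norm// invfM.
Qed.

Lemma normal_pdf_affine m s (x : R) : 0 < s ->
  normal_pdf m s (s * x + m) * s = normal_pdf 0 1 x.
Proof.
move=> s0; rewrite !normal_pdfE ?oner_neq0 ?gt_eqF// !normal_peakE// /normal_fun.
rewrite expr1n invr1 mul1r subr0 addrK mulrAC [s^-1 * _]mulrC mulfVK ?gt_eqF//.
congr (_ * expR _); field; exact/lt0r_neq0.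
Qed.

Lemma ge0_integral_normal_std m s f : 0 < s -> continuous f -> (forall x, 0 <= f x) ->
  (\int[normal_prob m s]_x (f x)%:E = \int[normal_prob 0 1]_x (f (s * x + m))%:E)%E.
Proof.
move=> s0 cf f0.
have cl : continuous (fun x : R => s * x + m).
  by move=> x; apply: cvgD; [apply: cvgM; [exact: cvg_cst|exact: cvg_id]|exact: cvg_cst].
have cfl : continuous (fun x => f (s * x + m)).
  by move=> x; apply: continuous_comp; [exact: cl|exact: cf].
have mf := continuous_measurable_fun cf.
have mfl := continuous_measurable_fun cfl.
rewrite !ge0_integral_normal_prob//; last 3 first.
- exact/measurable_EFinP.
- by move=> x; rewrite lee_fin.
- exact/measurable_EFinP.
under eq_integral do rewrite -EFinM.
rewrite (@ge0_integral_affine m s)//.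
- by apply: eq_integral => x _; rewrite -mulrA normal_pdf_affine// EFinM.
- move=> x; apply: cvgM; [exact: cf|apply: continuous_normal_pdf].
  by rewrite gt_eqF.
- by move=> x; rewrite mulr_ge0// normal_pdf_ge0.
Qed.

(** The joint density of [(Z, b Z + c W)] is disintegrated in both orders: [Z] first on the left; on
    the right the marginal of the sum, then the conditional law of [Z]. Completing the square proves
    it. *)
Lemma normal_pdf_conv (b c y z : R) : 0 < b -> 0 < c ->
  normal_pdf 0 1 z * normal_pdf (b * z) c y =
  normal_pdf 0 (Num.sqrt (b ^+ 2 + c ^+ 2)) y *
  normal_pdf (b * y / (b ^+ 2 + c ^+ 2)) (c / Num.sqrt (b ^+ 2 + c ^+ 2)) z.
Proof.
move=> b0 c0; set t2 := b ^+ 2 + c ^+ 2; set t := Num.sqrt t2.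
have t20 : 0 < t2 by rewrite addr_gt0// exprn_gt0.
have t0 : 0 < t by rewrite sqrtr_gt0.
have tE : t ^+ 2 = t2 by rewrite sqr_sqrtr// ltW.
have ct0 : 0 < c / t by rewrite divr_gt0.
have [bn cn tn] : [/\ b != 0, c != 0 & t != 0] by rewrite !lt0r_neq0.
rewrite !normal_pdfE ?lt0r_neq0// /normal_fun.
rewrite mulrACA [RHS]mulrACA -!expRD; congr (_ * expR _).
  rewrite !normal_peakE//; field.
  by rewrite tn cn gt_eqF// sqrtr_gt0 mulrn_wgt0// pi_gt0.
rewrite !subr0 tE expr_div_n tE /t2; field.
by rewrite cn -/t2 gt_eqF.
Qed.

End normal_integral.

(** * Convolution and symmetry of centred normal laws *)

Section normal_convolution.
Context {R : realType}.
Local Notation leb := (@lebesgue_measure R).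
Local Notation nu := (@normal_prob R 0 1).
Implicit Types (b c m s : R) (f : R -> R).

Lemma ge0_integral_normal_conv b c f : 0 < b -> 0 < c ->
  continuous f -> (forall x, 0 <= f x) ->
  (\int[nu]_z \int[nu]_w (f (b * z + c * w))%:E =
   \int[nu]_z (f (Num.sqrt (b ^+ 2 + c ^+ 2) * z))%:E)%E.
Proof.
move=> b0 c0 cf f0; set t2 := b ^+ 2 + c ^+ 2; set t := Num.sqrt t2.
have t20 : 0 < t2 by rewrite addr_gt0// exprn_gt0.
have t0 : 0 < t by rewrite sqrtr_gt0.
have ct0 : 0 < c / t by rewrite divr_gt0.
have mf : measurable_fun setT f by exact: continuous_measurable_fun.
have mp (m s : R) : measurable_fun setT (normal_pdf m s).
  exact: measurable_normal_pdf.
(* The integrand is written with the marginal of [y] outside, so that after Tonelli the inner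
   integral in [z] is that of a conditional density and equals 1. *)
pose h (zy : R * R) : R := f zy.2 * (normal_pdf 0 t zy.2 *
    normal_pdf (b * zy.2 / t2) (c / t) zy.1).
have hE z y : h (z, y) = f y * normal_pdf (b * z) c y * normal_pdf 0 1 z.
  rewrite /h/= -[RHS]mulrA; congr (_ * _).
  by rewrite [RHS]mulrC normal_pdf_conv.
have h0 zy : 0 <= h zy by rewrite !mulr_ge0// normal_pdf_ge0.
have mpdf (k s : R) (u v : R * R -> R) : s != 0 -> measurable_fun setT u ->
    measurable_fun setT v -> measurable_fun setT (fun zy => normal_pdf (k * u zy) s (v zy)).
  move=> s0 mu mv.
  rewrite (_ : (fun _ => _) = (fun zy : R * R => normal_peak s *
    expR (- (v zy - k * u zy) ^+ 2 / (s ^+ 2 *+ 2)))); last first.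
    by apply/funext => zy; rewrite normal_pdfE.
  apply: measurable_funM => //; apply: measurableT_comp => //.
  apply: measurable_funM => //; apply: measurableT_comp => //.
  by apply: measurable_funX; apply: measurable_funB => //; exact: measurable_funM.
have mh : measurable_fun setT h.
  rewrite /h; apply: measurable_funM; first exact: measurableT_comp.
  apply: measurable_funM; first exact: measurableT_comp.
  have -> : (fun zy : R * R => normal_pdf (b * zy.2 / t2) (c / t) zy.1) =
      (fun zy => normal_pdf (b / t2 * zy.2) (c / t) zy.1).
    by apply/funext => zy; rewrite mulrAC.
  by apply: mpdf => //; rewrite gt_eqF.
transitivity (\int[nu]_z \int[leb]_y (f y * normal_pdf (b * z) c y)%:E)%E.
  apply: eq_integral => z _.
  under eq_integral do rewrite addrC.
  rewrite -(ge0_integral_normal_std (b * z) c0 cf f0).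
  by rewrite ge0_integral_normal_prob//; exact/measurable_EFinP.
have mh' : measurable_fun setT (fun zy : R * R => (h zy)%:E).
  exact/measurable_EFinP.
have Iz z : (\int[leb]_y (f y * normal_pdf (b * z) c y)%:E * (normal_pdf 0 1 z)%:E =
   \int[leb]_y (h (z, y))%:E)%E.
  rewrite -ge0_integralZr//.
  - by apply: eq_integral => y _; rewrite hE EFinM.
  - by apply/measurable_EFinP; apply: measurable_funM => //; exact: mp.
  - by move=> y _; rewrite lee_fin mulr_ge0// normal_pdf_ge0.
  - by rewrite lee_fin normal_pdf_ge0.
rewrite ge0_integral_normal_prob; last 2 first.
- apply: (measurable_fun_fubini_tonelli_F (m2 := leb)
    (fun zy : R * R => (f zy.2 * normal_pdf (b * zy.1) c zy.2)%:E)).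
    apply/measurable_EFinP; apply: measurable_funM; first exact: measurableT_comp.
    by apply: mpdf => //; rewrite gt_eqF.
  by move=> zy; rewrite lee_fin mulr_ge0// normal_pdf_ge0.
- by move=> z; apply: integral_ge0 => y _; rewrite lee_fin mulr_ge0// normal_pdf_ge0.
under eq_integral do rewrite Iz.
transitivity (\int[leb]_y \int[leb]_z (h (z, y))%:E)%E.
  by apply: (@fubini_tonelli _ _ _ _ R leb leb (fun zy => (h zy)%:E)) => // x; rewrite lee_fin.
have -> : (\int[nu]_z (f (t * z))%:E = \int[normal_prob 0 t]_z (f z)%:E)%E.
  rewrite (ge0_integral_normal_std 0 t0 cf f0).
  by under [RHS]eq_integral do rewrite addr0.
rewrite ge0_integral_normal_prob//; last exact/measurable_EFinP.
apply: eq_integral => y _.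
rewrite /h/=; under eq_integral do rewrite mulrA EFinM.
rewrite ge0_integralZl//.
- by rewrite integral_normal_pdf mule1 EFinM.
- by apply/measurable_EFinP; exact: mp.
- by move=> z _; rewrite lee_fin normal_pdf_ge0.
- by rewrite lee_fin mulr_ge0// normal_pdf_ge0.
Qed.

(** The line is cut at 0 and the reflection exchanges the two half-lines. *)
Lemma ge0_integral_lebesgue_opp f : continuous f -> (forall x, 0 <= f x) ->
  (\int[leb]_x (f (- x))%:E = \int[leb]_x (f x)%:E)%E.
Proof.
move=> cf f0.
have split_itv (g : R -> R) : continuous g -> (forall x, 0 <= g x) ->
    (\int[leb]_x (g x)%:E = \int[leb]_(x in `]-oo, 0%R]) (g x)%:E +
                            \int[leb]_(x in `[0%R, +oo[) (g x)%:E)%E.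
  move=> cg g0; have mg := continuous_measurable_fun cg.
  rewrite -[X in integral _ X](_ : `]-oo, 0%R] `|` `]0%R, +oo[ = setT)%classic; last first.
    apply/seteqP; split=> // x _ /=; rewrite !in_itv/= andbT.
    by case: (leP x 0) => ?; [left|right].
  rewrite ge0_integral_setU//=.
  - by rewrite integral_itv_obnd_cbnd//; apply: measurable_funTS; exact/measurable_EFinP.
  - by apply: measurable_funTS; exact/measurable_EFinP.
  - by move=> x _; rewrite lee_fin.
  - rewrite disj_set2E; apply/eqP; rewrite -subset0 => x []/=.
    by rewrite !in_itv/= andbT leNgt => /negP.
have cfN : continuous (fun x => f (- x)).
  by move=> x; apply: continuous_comp; [exact: opp_continuous|exact: cf].
have sub (g : R -> R) : continuous g -> (forall x, 0 <= g x) ->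
    (\int[leb]_(x in `]-oo, 0%R]) (g x)%:E =
     \int[leb]_(x in `[0%R, +oo[) (g (- x))%:E)%E.
  move=> cg g0; have := @ge0_integration_by_substitutionNy R g 0.
  by rewrite oppr0; apply => [|x _]; [exact: continuous_subspaceT|exact: g0].
rewrite split_itv// [RHS]split_itv// sub// [X in _ = (X + _)%E]sub//.
by rewrite addeC; congr (_ + _)%E; apply: eq_integral => x _; rewrite opprK.
Qed.

Lemma ge0_integral_normal_opp f : continuous f -> (forall x, 0 <= f x) ->
  (\int[nu]_z (f (- z))%:E = \int[nu]_z (f z)%:E)%E.
Proof.
move=> cf f0.
have cfN : continuous (fun x => f (- x)).
  by move=> x; apply: continuous_comp; [exact: opp_continuous|exact: cf].
have mf := continuous_measurable_fun cf.
have mfN := continuous_measurable_fun cfN.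
rewrite [LHS]ge0_integral_normal_prob;
  [|exact/measurable_EFinP|by move=> x; rewrite lee_fin].
rewrite [RHS]ge0_integral_normal_prob;
  [|exact/measurable_EFinP|by move=> x; rewrite lee_fin].
under [RHS]eq_integral do rewrite -EFinM.
rewrite -(@ge0_integral_lebesgue_opp (fun x => f x * normal_pdf 0 1 x)).
- apply: eq_integral => x _.
  by rewrite -EFinM !normal_pdfE ?oner_neq0// /normal_fun !subr0 sqrrN.
- move=> x; apply: cvgM; [exact: cf|apply: continuous_normal_pdf].
  by rewrite oner_neq0.
- by move=> x; rewrite mulr_ge0// normal_pdf_ge0.
Qed.

End normal_convolution.

(** * Real-valued integrals against a probability *)

Section Rintegral_probability.
Context d (T : measurableType d) (R : realType) (P : probability T R).
Implicit Types f g h : T -> R.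

Lemma bounded_integrable (M : R) f : measurable_fun setT f ->
  (forall x, `|f x| <= M) -> P.-integrable setT (EFin \o f).
Proof.
move=> mf fM; apply: measurable_bounded_integrable => //.
  by rewrite [ltLHS](_ : _ = 1%E) ?ltry//; exact: probability_setT.
exists M; split; first exact: num_real.
by move=> y My x _ /=; rewrite (le_trans (fM x))// ltW.
Qed.

Lemma integrable_dominated f g : measurable_fun setT f ->
  P.-integrable setT (EFin \o g) -> (forall x, `|f x| <= g x) ->
  P.-integrable setT (EFin \o f).
Proof.
move=> mf ig fg; apply: le_integrable ig => //; first exact/measurable_EFinP.
by move=> x _; rewrite lee_fin (le_trans (fg x))// ler_norm.
Qed.

Lemma Rintegral_prob_cst (c : R) : \int[P]_x c = c.
Proof. by rewrite Rintegral_cst//= probability_setT mulr1. Qed.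

Lemma integrable_prob_cst (c : R) : P.-integrable setT (EFin \o cst c).
Proof. exact: finite_measure_integrable_cst. Qed.

Lemma integrable_EFinD f g : P.-integrable setT (EFin \o f) ->
  P.-integrable setT (EFin \o g) ->
  P.-integrable setT (EFin \o (fun x => f x + g x)).
Proof. by move=> intf intg; exact: (integrableD measurableT intf intg). Qed.

Lemma integrable_EFinB f g : P.-integrable setT (EFin \o f) ->
  P.-integrable setT (EFin \o g) ->
  P.-integrable setT (EFin \o (fun x => f x - g x)).
Proof. by move=> intf intg; exact: (integrableB measurableT intf intg). Qed.

Lemma integrable_EFinZ (k : R) f : P.-integrable setT (EFin \o f) ->
  P.-integrable setT (EFin \o (fun x => k * f x)).
Proof. by move=> intf; exact: (integrableZl measurableT k intf). Qed.

Lemma integrable_EFin_sum (I : Type) (s : seq I) (F : I -> T -> R) :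
  (forall i, P.-integrable setT (EFin \o F i)) ->
  P.-integrable setT (EFin \o (fun x => \sum_(i <- s) F i x)).
Proof.
move=> iF.
rewrite [X in _.-integrable _ X](_ : _ = (fun x => \sum_(i <- s) (F i x)%:E)%E).
  by apply: (integrable_sum measurableT s (P := xpredT) (h := fun i x => (F i x)%:E)) => i _; exact: iF.
by apply/funext => x /=; rewrite sumEFin.
Qed.

Lemma ler_norm_Rintegral_le f h : P.-integrable setT (EFin \o f) ->
  P.-integrable setT (EFin \o h) -> (forall x, `|f x| <= h x) ->
  `|\int[P]_x f x| <= \int[P]_x h x.
Proof.
move=> intf inth fh; apply: (le_trans (le_normr_Rintegral _ intf)) => //.
by apply: le_Rintegral => //; exact: integrable_abse intf.
Qed.

Lemma ler_norm_Rintegral_bounded f (M : R) : measurable_fun setT f ->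
  (forall x, `|f x| <= M) -> `|\int[P]_x f x| <= M.
Proof.
move=> mf fM; rewrite -[leRHS]Rintegral_prob_cst.
by apply: ler_norm_Rintegral_le => //; [exact: (bounded_integrable mf fM)|
  exact: integrable_prob_cst].
Qed.

Lemma ler_distB_Rintegral f g h : P.-integrable setT (EFin \o f) ->
  P.-integrable setT (EFin \o g) ->
  P.-integrable setT (EFin \o h) -> (forall x, `|f x - g x| <= h x) ->
  `|\int[P]_x f x - \int[P]_x g x| <= \int[P]_x h x.
Proof.
move=> intf intg inth fgh; rewrite -RintegralB//.
by apply: ler_norm_Rintegral_le => //; exact: integrable_EFinB.
Qed.

Lemma Rintegral_sum (I : Type) (s : seq I) (F : I -> T -> R) :
  (forall i, P.-integrable setT (EFin \o F i)) ->
  \int[P]_x (\sum_(i <- s) F i x) = \sum_(i <- s) \int[P]_x F i x.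
Proof.
move=> iF; elim: s => [|i s ih].
  by rewrite big_nil; under eq_Rintegral do rewrite big_nil; rewrite Rintegral_prob_cst.
rewrite big_cons -ih -RintegralD//.
  by under eq_Rintegral do rewrite big_cons.
exact: integrable_EFin_sum.
Qed.

End Rintegral_probability.

Lemma Rintegral_Fubini d1 d2 (T1 : measurableType d1) (T2 : measurableType d2)
    (R : realType) (P1 : probability T1 R) (P2 : probability T2 R)
    (M : R) (F : T1 * T2 -> R) :
  measurable_fun setT F -> (forall z, `|F z| <= M) ->
  \int[P1]_x (\int[P2]_y F (x, y)) = \int[P2]_y (\int[P1]_x F (x, y)).
Proof.
move=> mF FM.
have m1 x : measurable_fun setT (fun y => F (x, y)) by exact: measurableT_comp.
have m2 y : measurable_fun setT (fun x => F (x, y)) by exact: measurableT_comp.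
have i1 x : P2.-integrable setT (EFin \o (fun y => F (x, y))).
  by apply: (@bounded_integrable _ _ _ _ M).
have i2 y : P1.-integrable setT (EFin \o (fun x => F (x, y))).
  by apply: (@bounded_integrable _ _ _ _ M).
rewrite /Rintegral.
under eq_integral do rewrite fineK ?(integrable_fin_num _ (i1 _))//.
under [in RHS]eq_integral do rewrite fineK ?(integrable_fin_num _ (i2 _))//.
congr fine; apply: (@Fubini _ _ _ _ _ P1 P2 (EFin \o F)).
by apply: (@bounded_integrable _ _ _ (P1 \x P2)%E M).
Qed.

(** * Gaussian identities for bounded functions of any sign *)

Section normal_bounded.
Context {R : realType}.
Local Notation nu := (@normal_prob R 0 1).
Implicit Types (b c m s M t : R) (f : R -> R).

(** Carries identities from nonnegative functions over to bounded ones, through [f + M >= 0]. *)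
Lemma Rintegral_shift d (T : measurableType d) (P : probability T R) (f : T -> R)
    (M : R) : measurable_fun setT f -> (forall x, `|f x| <= M) ->
  \int[P]_x (f x) = \int[P]_x (f x + M) - M.
Proof.
move=> mf fM; rewrite RintegralD//.
- by rewrite Rintegral_prob_cst addrK.
- exact: (@bounded_integrable _ _ _ P M).
- exact: integrable_prob_cst.
Qed.

Lemma Rintegral_normal_std m s M f : 0 < s -> continuous f ->
  (forall x, `|f x| <= M) ->
  \int[normal_prob m s]_x f x = \int[nu]_z f (s * z + m).
Proof.
move=> s0 cf fM.
have cfM : continuous (fun x => f x + M) by move=> x; apply: cvgD; [exact: cf|exact: cvg_cst].
have fM0 x : 0 <= f x + M by have := fM x; rewrite ler_norml => /andP[]; lra.
have cl : continuous (fun x : R => s * x + m).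
  by move=> x; apply: cvgD; [apply: cvgM; [exact: cvg_cst|exact: cvg_id]|exact: cvg_cst].
have mf := continuous_measurable_fun cf.
have mfl : measurable_fun setT (fun z : R => f (s * z + m)).
  by apply: continuous_measurable_fun => x; apply: continuous_comp; [exact: cl|exact: cf].
rewrite (Rintegral_shift (normal_prob m s) mf fM).
rewrite [RHS](Rintegral_shift nu mfl (fun z => fM (s * z + m))).
by rewrite /Rintegral (ge0_integral_normal_std _ s0 cfM fM0).
Qed.

Lemma Rintegral_normal_opp M f : continuous f -> (forall x, `|f x| <= M) ->
  \int[nu]_z f (- z) = \int[nu]_z f z.
Proof.
move=> cf fM.
have cfM : continuous (fun x => f x + M) by move=> x; apply: cvgD; [exact: cf|exact: cvg_cst].
have fM0 x : 0 <= f x + M by have := fM x; rewrite ler_norml => /andP[]; lra.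
have mf := continuous_measurable_fun cf.
have mfN : measurable_fun setT (fun z : R => f (- z)).
  by apply: continuous_measurable_fun => x; apply: continuous_comp;
    [exact: opp_continuous|exact: cf].
rewrite (Rintegral_shift nu mfN (fun z => fM (- z))).
rewrite [RHS](Rintegral_shift nu mf fM).
by rewrite /Rintegral (ge0_integral_normal_opp cfM fM0).
Qed.

Lemma continuous_affine b c : continuous (fun z : R => b * z + c).
Proof.
by move=> x; apply: cvgD; [apply: cvgM; [exact: cvg_cst|exact: cvg_id]|exact: cvg_cst].
Qed.

Lemma Rintegral_normal_conv b c M f : 0 <= b -> 0 <= c -> continuous f ->
  (forall x, `|f x| <= M) ->
  \int[nu]_z (\int[nu]_w f (b * z + c * w)) =
  \int[nu]_z f (Num.sqrt (b ^+ 2 + c ^+ 2) * z).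
Proof.
move=> b0 c0 cf fM.
(* The density argument needs both scales positive; when [b] or [c] is 0, one of the two integrals
   is that of a constant. *)
move: b0; rewrite le_eqVlt => /predU1P[<-|b0].
  rewrite expr0n add0r sqrtr_sqr ger0_norm//.
  under eq_Rintegral => z _.
    under eq_Rintegral do rewrite mul0r add0r.
    over.
  by rewrite Rintegral_prob_cst.
move: c0; rewrite le_eqVlt => /predU1P[<-|c0].
  rewrite expr0n addr0 sqrtr_sqr gtr0_norm//.
  apply: eq_Rintegral => z _.
  under eq_Rintegral do rewrite mul0r addr0.
  by rewrite Rintegral_prob_cst.
have cfM : continuous (fun x => f x + M) by move=> x; apply: cvgD; [exact: cf|exact: cvg_cst].
have fM0 x : 0 <= f x + M by have := fM x; rewrite ler_norml => /andP[]; lra.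
have mf : measurable_fun setT f by exact: continuous_measurable_fun.
have ml (k l : R) : measurable_fun setT (fun x => f (k * x + l)).
  apply: continuous_measurable_fun => x.
  by apply: continuous_comp; [exact: continuous_affine|exact: cf].
have mw z : measurable_fun setT (fun w => f (b * z + c * w)).
  by under eq_fun do rewrite addrC; exact: ml.
have mF : measurable_fun setT (fun zw : R * R => f (b * zw.1 + c * zw.2)).
  apply: (measurableT_comp mf) => //=.
  by apply: measurable_funD; exact: measurable_funM.
set t := Num.sqrt _.
have mt : measurable_fun setT (fun z : R => f (t * z)).
  by have := ml t 0; under eq_fun do rewrite addr0.
rewrite [RHS](Rintegral_shift nu mt (fun z => fM (t * z))).
have iw z : nu.-integrable setT (EFin \o (fun w => f (b * z + c * w))).
  by apply: (@bounded_integrable _ _ _ nu M) => //; exact: mw.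
have mI : measurable_fun setT (fun z : R => \int[nu]_w f (b * z + c * w)).
  have h : measurable_fun setT (fun z : R => \int[nu]_w (f (b * z + c * w))%:E)%E.
    apply: (measurable_fubini_F (m1 := nu) (m2 := nu)
      (f := EFin \o (fun zw : R * R => f (b * zw.1 + c * zw.2)))).
    by apply: (@bounded_integrable _ _ _ (nu \x nu)%E M).
  by apply: (measurableT_comp _ h).
have bI z : `|\int[nu]_w f (b * z + c * w)| <= M.
  by apply: ler_norm_Rintegral_bounded => //; exact: mw.
rewrite (Rintegral_shift nu mI bI).
congr (_ - _); rewrite /Rintegral -(ge0_integral_normal_conv b0 c0 cfM fM0).
congr fine; apply: eq_integral => z _.
rewrite EFinD fineK; last exact: (integrable_fin_num measurableT (iw z)).
have -> : M%:E = (\int[nu]_w (M%:E))%E by rewrite integral_cst//= probability_setT mule1.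
exact: (esym (integralD measurableT (iw z) (integrable_prob_cst nu M))).
Qed.

Lemma continuous_quad b c : continuous (fun z : R => b * z ^+ 2 + c).
Proof.
move=> x; apply: cvgD; last exact: cvg_cst.
by apply: cvgM; [exact: cvg_cst|exact: exprn_continuous].
Qed.

Lemma continuous_expR_quad t : continuous (fun z : R => expR (- (t * z ^+ 2 / 2))).
Proof.
have -> : (fun z : R => expR (- (t * z ^+ 2 / 2))) =
    (fun z => expR ((- t / 2) * z ^+ 2 + 0)).
  by apply/funext => z; congr expR; field.
move=> x; apply: (@continuous_comp _ _ _ (fun z : R => (- t / 2) * z ^+ 2 + 0) expR); last exact: continuous_expR.
exact: continuous_quad.
Qed.

(** The integrand times the standard density is [s] times the density of [N(0, s^2)]. Negative [t]
    is allowed because [t = - 1/2] gives the exponential that dominates the moments. *)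
Lemma integral_normal_expR t : -1 < t ->
  (\int[nu]_z (expR (- (t * z ^+ 2 / 2)))%:E = ((Num.sqrt (1 + t))^-1)%:E)%E.
Proof.
move=> t1.
have t0 : 0 < 1 + t by lra.
have st0 : 0 < Num.sqrt (1 + t) by rewrite sqrtr_gt0.
set s := (Num.sqrt (1 + t))^-1; have s0 : 0 < s by rewrite invr_gt0.
have mE := continuous_measurable_fun (@continuous_expR_quad t).
rewrite ge0_integral_normal_prob; last 2 first.
- exact/measurable_EFinP.
- by move=> x; rewrite lee_fin expR_ge0.
transitivity (\int[lebesgue_measure]_x (s%:E * (normal_pdf 0 s x)%:E))%E.
  apply: eq_integral => x _; rewrite -!EFinM; congr EFin.
  rewrite !normal_pdfE ?oner_neq0 ?gt_eqF// !normal_peakE// /normal_fun.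
  rewrite mulrCA -expRD [RHS]mulrA; congr (_ * expR _).
    by rewrite mulrA divff ?gt_eqF// invr1.
  by rewrite /s exprVn sqr_sqrtr ?ltW// !subr0; field; rewrite gt_eqF.
rewrite ge0_integralZl//.
- by rewrite integral_normal_pdf mule1.
- by apply/measurable_EFinP; exact: measurable_normal_pdf.
- by move=> x _; rewrite lee_fin normal_pdf_ge0.
- by rewrite lee_fin ltW.
Qed.

End normal_bounded.

(** * Taylor remainders by the mean value theorem *)

Section taylor_bounds.
Context {R : realType}.
Implicit Types (C h : R) (p q f : R -> R).

(** By the mean value theorem, a bound of order [n] on the derivative becomes one of order [n + 1]
    on the function. The factor [1 / (n + 1)] that integration would give is dropped, as later
    estimates only need some constant. *)
Lemma derive_growth_pos p q n C : (forall h, is_derive h (1 : R) p (q h)) -> p 0 = 0 ->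
  (forall h, 0 <= h -> `|q h| <= C * h ^+ n) ->
  forall h, 0 <= h -> `|p h| <= C * h ^+ n.+1.
Proof.
move=> pq p0 qC h; rewrite le_eqVlt => /predU1P[<-|h0].
  by rewrite p0 normr0 expr0n mulr0.
have cp : {within `[0, h], continuous p}.
  apply: continuous_subspaceT => x.
  by apply/differentiable_continuous/derivable1_diffP; case: (pq x).
have [c] := MVT h0 (fun x _ => pq x) cp.
rewrite in_itv/= p0 !subr0 => /andP[c0 ch] ->.
rewrite normrM (gtr0_norm h0) exprSr mulrA ler_pM2r//.
apply: (le_trans (qC _ (ltW c0))).
have C0 : 0 <= C.
  have := qC _ (ltW h0) => /(le_trans (normr_ge0 _)).
  by rewrite pmulr_lge0// exprn_gt0.
by rewrite ler_wpM2l// lerXn2r ?nnegrE// ltW.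
Qed.

Lemma is_derive_compN p (x dp : R) : is_derive (- x) (1 : R) p dp ->
  is_derive x (1 : R) (fun h => p (- h)) (- dp).
Proof.
move=> pq.
have dN : is_derive x (1 : R) (fun h : R => - h) (- 1) by exact: (is_deriveN (is_derive_id x 1)).
rewrite -mulrN1; exact: (is_derive1_comp (f := p) pq dN).
Qed.

Lemma derive_growth p q n C : (forall h, is_derive h (1 : R) p (q h)) -> p 0 = 0 ->
  (forall h, `|q h| <= C * `|h| ^+ n) ->
  forall h, `|p h| <= C * `|h| ^+ n.+1.
Proof.
move=> pq p0 qC h; have [h0|h0] := leP 0 h.
  rewrite (ger0_norm h0); apply: (derive_growth_pos pq) => // x x0.
  by have := qC x; rewrite (ger0_norm x0).
rewrite (ltr0_norm h0) -[in p h](opprK h).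
apply: (@derive_growth_pos (fun h => p (- h)) (fun h => - q (- h))) => //.
- by move=> x; exact: is_derive_compN.
- by rewrite oppr0.
- by move=> x x0; rewrite normrN; have := qC (- x); rewrite (normrN x) (ger0_norm x0).
- by rewrite oppr_ge0 ltW.
Qed.

End taylor_bounds.

(** * Moments of the standard normal law *)

Section normal_moments.
Context {R : realType}.
Local Notation nu := (@normal_prob R 0 1).

(** The inequality [y <= expR y] at [y = x / 3], cubed; 27 is the cube of 3. *)
Lemma cube_le_expR (x : R) : 0 <= x -> x ^+ 3 <= 27 * expR x.
Proof.
move=> x0.
have -> : expR x = expR (x / 3) ^+ 3 by rewrite -expRM_natl; congr expR; field.
have h : x / 3 <= expR (x / 3).
  by apply: le_trans (expR_ge1Dx _); rewrite lerDr.
have : (x / 3) ^+ 3 <= expR (x / 3) ^+ 3.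
  by rewrite lerXn2r// ?nnegrE ?expR_ge0// divr_ge0.
rewrite exprMn; have -> : (3^-1 : R) ^+ 3 = 27^-1 by field.
by rewrite ler_pdivrMr// mulrC.
Qed.

Lemma integrable_normal_expR (t : R) : -1 < t ->
  nu.-integrable setT (EFin \o (fun z => expR (- (t * z ^+ 2 / 2)))).
Proof.
move=> t1; have mE := continuous_measurable_fun (@continuous_expR_quad R t).
apply/integrableP; split; first exact/measurable_EFinP.
under eq_integral do rewrite /= ger0_norm ?expR_ge0//.
by rewrite integral_normal_expR// ltry.
Qed.

Lemma Rintegral_normal_expR (t : R) : -1 < t ->
  \int[nu]_z (expR (- (t * z ^+ 2 / 2))) = (Num.sqrt (1 + t))^-1.
Proof. by move=> t1; rewrite /Rintegral integral_normal_expR. Qed.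

Lemma measurable_exprn n : measurable_fun setT (fun z : R => z ^+ n).
Proof. exact: measurable_funX. Qed.

Lemma integrable_normal_pow6 : nu.-integrable setT (EFin \o (fun z : R => z ^+ 6)).
Proof.
have t1 : -1 < - 2^-1 :> R by lra.
(* At [t = - 1/2] the exponential is [expR (z ^+ 2 / 4)]; the cubic bound at [z ^+ 2 / 4] brings 27,
   and [4 ^ 3 = 64]. *)
have i := integrable_EFinZ (27 * 64) (integrable_normal_expR t1).
apply: (integrable_dominated _ i); first exact: measurable_exprn.
move=> z; rewrite ger0_norm ?exprn_even_ge0//.
have z20 : 0 <= z ^+ 2 / 4 by rewrite divr_ge0 ?sqr_ge0.
have := cube_le_expR z20.
have -> : - (- 2^-1 * z ^+ 2 / 2) = z ^+ 2 / 4 :> R by field.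
have -> : (z ^+ 2 / 4) ^+ 3 = z ^+ 6 / 64 :> R by field.
set e := expR _; lra.
Qed.

Lemma norm_pow_le6 (z : R) n : (n <= 6)%N -> `|z ^+ n| <= 1 + z ^+ 6.
Proof.
move=> n6; have z60 : 0 <= z ^+ 6 by rewrite exprn_even_ge0.
rewrite normrX; have [z1|z1] := leP `|z| 1.
  by apply: (@le_trans _ _ 1); [exact: exprn_ile1|rewrite lerDl].
apply: (@le_trans _ _ (z ^+ 6)); last by rewrite lerDr.
by rewrite -[leRHS]ger0_norm// normrX ler_weXn2l// ltW.
Qed.

Lemma integrable_normal_pow n : (n <= 6)%N ->
  nu.-integrable setT (EFin \o (fun z : R => z ^+ n)).
Proof.
move=> n6.
have i := integrable_EFinD (integrable_prob_cst nu 1) integrable_normal_pow6.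
apply: (integrable_dominated _ i); first exact: measurable_exprn.
move=> z; exact: norm_pow_le6.
Qed.

Lemma expR_taylor2 (x : R) : 0 <= x ->
  `|expR (- x) - 1 + x - x ^+ 2 / 2| <= x ^+ 3.
Proof.
move=> x0; rewrite -[leRHS]mul1r.
have dE (h : R) : is_derive h (1 : R) (fun h : R => expR (- h)) (- expR (- h)).
  by apply: is_derive_compN; exact: is_derive_expR.
have dcst (c h : R) : is_derive h (1 : R) (fun=> c) 0 by exact: is_derive_cst.
have did (h : R) : is_derive h (1 : R) (fun h => h) 1 by exact: is_derive_id.
have dsq (h : R) : is_derive h (1 : R) (fun h => h ^+ 2 / 2) h.
  have := is_deriveZ (2^-1) (is_deriveX 2 (did h)).
  rewrite /GRing.scale/= !mulr1 expr1 mulrA mulVf// mul1r.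
  by congr (is_derive _ _ _ _); apply/funext => k; rewrite mulrC.
have d2 (h : R) : is_derive h (1 : R) (fun h => expR (- h) - 1) (- expR (- h)).
  by have := is_deriveB (dE h) (dcst 1 h); rewrite subr0.
have d1 (h : R) : is_derive h (1 : R) (fun h => 1 - h - expR (- h)) (expR (- h) - 1).
  by apply: (is_derive_eq (is_deriveB (is_deriveB (dcst 1 h) (did h)) (dE h))); ring.
have d0 (h : R) : is_derive h (1 : R) (fun h => expR (- h) - 1 + h - h ^+ 2 / 2)
    (1 - h - expR (- h)).
  by apply: (is_derive_eq (is_deriveB (is_deriveD (d2 h) (did h)) (dsq h))); ring.
apply: (derive_growth_pos d0) => //; first by rewrite oppr0 expR0 expr0n/=; ring.
move=> h h0.
apply: (derive_growth_pos d1) => //; first by rewrite oppr0 expR0; ring.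
move=> {h h0} h h0.
apply: (derive_growth_pos d2) => //; first by rewrite oppr0 expR0; ring.
move=> {h h0} h h0; rewrite expr0 mulr1 normrN ger0_norm ?expR_ge0//.
by rewrite -expR0 ler_expR oppr_le0.
Qed.

Lemma eq0_le_small (a K : R) :
  (forall t, 0 < t -> t <= 1 -> `|a| <= K * t) -> a = 0.
Proof.
move=> h; apply/normr0_eq0/eqP; rewrite eq_le normr_ge0 andbT.
have K0 : 0 <= K by have := h 1 ltr01 (lexx _); rewrite mulr1; exact: le_trans.
apply/ler_addgt0Pr => e e0; rewrite add0r.
have Ke : 0 < e + K by rewrite ltr_pwDl.
have t1 : e / (e + K) <= 1 by rewrite ler_pdivrMr// mul1r lerDl.
apply: (le_trans (h _ (divr_gt0 e0 Ke) t1)).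
have K1 : K / (e + K) <= 1 by rewrite ler_pdivrMr// mul1r lerDr ltW.
by rewrite mulrCA ler_piMr// ltW.
Qed.

(* Both moments are read off the second-order expansion at [t = 0] of
   [E exp (- t Z^2 / 2) = (1 + t)^(-1/2)], used in the form [L t ^+ 2 * (1 + t) = 1]. *)
Lemma normal_moments24 :
  \int[nu]_z (z ^+ 2) = 1 /\ \int[nu]_z (z ^+ 4) = 3.
Proof.
set M2 := (X in X = 1 /\ _); set M4 := (X in _ /\ X = 3).
pose M6 := \int[nu]_z (z ^+ 6).
pose u := M2 / 2; pose v := M4 / 8.
pose L t := (Num.sqrt (1 + t))^-1 : R.
have L2 t : 0 < t -> L t ^+ 2 * (1 + t) = 1.
  by move=> t0; rewrite exprVn sqr_sqrtr ?mulVf//; lra.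
have i2 := integrable_normal_pow (isT : (2 <= 6)%N).
have i4 := integrable_normal_pow (isT : (4 <= 6)%N).
have i6 := integrable_normal_pow (isT : (6 <= 6)%N).
have Lt t : 0 < t -> t <= 1 -> `|L t - (1 - u * t + v * t ^+ 2)| <= M6 / 8 * t ^+ 3.
  move=> t0 t1.
  have t1' : -1 < t by lra.
  have i2' := integrable_EFinZ (- (t / 2)) i2.
  have i4' := integrable_EFinZ (t ^+ 2 / 8) i4.
  have i24 := integrable_EFinD i2' i4'.
  have i24' := integrable_EFinD (integrable_prob_cst nu 1) i24.
  have -> : L t - (1 - u * t + v * t ^+ 2) = \int[nu]_z expR (- (t * z ^+ 2 / 2))
     - \int[nu]_z (1 + (- (t / 2) * z ^+ 2 + t ^+ 2 / 8 * z ^+ 4)).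
    rewrite Rintegral_normal_expR// RintegralD//; last exact: integrable_prob_cst.
    rewrite RintegralD// !RintegralZl// Rintegral_prob_cst -/M2 -/M4 /u /v /L.
    by congr (_ - _); field.
  have -> : M6 / 8 * t ^+ 3 = \int[nu]_z (t ^+ 3 / 8 * z ^+ 6).
    by rewrite RintegralZl// -/M6; ring.
  apply: ler_distB_Rintegral => //.
  - exact: integrable_normal_expR.
  - exact: integrable_EFinZ.
  - move=> z.
    have x0 : 0 <= t * z ^+ 2 / 2 by rewrite divr_ge0// mulr_ge0 ?sqr_ge0 ?ltW.
    have := expR_taylor2 x0; set E := expR _.
    by congr (`|_| <= _); field.
pose K := M6 / 8.
have K0 : 0 <= K by have := le_trans (normr_ge0 _) (Lt 1 ltr01 (lexx _)); rewrite expr1n mulr1.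
pose Q := 1 + `|u| + `|v|.
pose G := `|u ^+ 2 + 2 * v - 2 * u * v| + `|v ^+ 2 - 2 * u * v| + v ^+ 2.
pose c := (2 * Q * K + K ^+ 2) * 2 + G.
(* Substitute [L t = q + r] into [L t ^+ 2 * (1 + t) = 1] and divide by [t]. The coefficients of [t]
   and [t ^+ 2] in [q ^+ 2 * (1 + t)] stay on the left, [G] bounds the higher ones, and the rest of
   [c] bounds the terms containing [r]. *)
have main t : 0 < t -> t <= 1 ->
    `|(1 - 2 * u) + (u ^+ 2 + 2 * v - 2 * u) * t| <= c * t ^+ 2.
  move=> t0 t1; have := Lt _ t0 t1; rewrite -/K.
  set q := 1 - u * t + v * t ^+ 2; set r := L t - q => rK.
  have rE : L t = q + r by rewrite /r; ring.
  have e := L2 _ t0; rewrite rE in e.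
  have qQ : `|q| <= Q.
    rewrite /q /Q (le_trans (ler_normD _ _))// lerD//.
      rewrite (le_trans (ler_normB _ _))// normr1 lerD2l normrM (gtr0_norm t0).
      by rewrite ler_piMr.
    by rewrite normrM ler_piMr// ger0_norm ?sqr_ge0// exprn_ile1// ltW.
  have h : `|(2 * q * r + r ^+ 2) * (1 + t)| <= (2 * Q * K + K ^+ 2) * 2 * t ^+ 3.
    have t3 : 0 <= t ^+ 3 <= 1 by rewrite exprn_ge0 ?exprn_ile1// ltW.
    have rK' : `|r| <= K.
      by apply: (le_trans rK); rewrite ler_piMr//; case/andP: t3.
    have r2 : `|r ^+ 2| <= K ^+ 2 * t ^+ 3.
      rewrite expr2 normrM [leRHS](_ : _ = K * (K * t ^+ 3)); last by ring.
      by rewrite ler_pM.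
    have qr : `|2 * q * r| <= 2 * Q * (K * t ^+ 3).
      rewrite -!(mulrA 2) normrM ger0_norm// ler_wpM2l// normrM.
      by apply: ler_pM.
    have s1 : `|1 + t| <= 2 by rewrite ger0_norm; lra.
    rewrite normrM [leRHS](_ : _ = (2 * Q * (K * t ^+ 3) + K ^+ 2 * t ^+ 3) * 2); last by ring.
    by rewrite ler_pM// (le_trans (ler_normD _ _))// lerD.
  have g : `|(u ^+ 2 + 2 * v - 2 * u * v) + (v ^+ 2 - 2 * u * v) * t + v ^+ 2 * t ^+ 2| <= G.
    have t2 : 0 <= t ^+ 2 <= 1 by rewrite exprn_ge0 ?exprn_ile1// ltW.
    case/andP: t2 => t20 t21.
    rewrite /G (le_trans (ler_normD _ _))// lerD//; last first.
      by rewrite (ger0_norm (mulr_ge0 (sqr_ge0 v) t20)) ler_piMr// sqr_ge0.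
    rewrite (le_trans (ler_normD _ _))// lerD// normrM (gtr0_norm t0).
    by rewrite ler_piMr.
  rewrite -(ler_pM2r t0) -[X in _ * X <= _](gtr0_norm t0) -normrM.
  have -> : (1 - 2 * u + (u ^+ 2 + 2 * v - 2 * u) * t) * t =
     - ((2 * q * r + r ^+ 2) * (1 + t)) -
     ((u ^+ 2 + 2 * v - 2 * u * v) + (v ^+ 2 - 2 * u * v) * t + v ^+ 2 * t ^+ 2) * t ^+ 3.
    have -> : (2 * q * r + r ^+ 2) * (1 + t) = 1 - q ^+ 2 * (1 + t).
      have -> : (2 * q * r + r ^+ 2) * (1 + t) =
          (q + r) ^+ 2 * (1 + t) - q ^+ 2 * (1 + t) by ring.
      by rewrite e.
    by rewrite /q; ring.
  have -> : c * t ^+ 2 * t = c * t ^+ 3 by ring.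
  rewrite /c [X in _ <= X]mulrDl; apply: (le_trans (ler_normB _ _)).
  rewrite normrN; apply: lerD => //.
  by rewrite normrM (ger0_norm (exprn_ge0 3 (ltW t0))) ler_wpM2r// exprn_ge0// ltW.
have c0 : 0 <= c.
  by have := le_trans (normr_ge0 _) (main 1 ltr01 (lexx _)); rewrite expr1n !mulr1.
(* As [t] tends to 0 the constant term must vanish, then the linear one: [u = 1/2] and [v = 3/8]. *)
have u1 : 1 - 2 * u = 0.
  apply: (@eq0_le_small _ (c + `|u ^+ 2 + 2 * v - 2 * u|)) => t t0 t1.
  have := main _ t0 t1; set a2 := u ^+ 2 + _ - _ => mt.
  have -> : 1 - 2 * u = (1 - 2 * u + a2 * t) - a2 * t by ring.
  apply: (le_trans (ler_normB _ _)); rewrite [X in _ <= X]mulrDl; apply: lerD; last first.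
    by rewrite normrM (gtr0_norm t0).
  apply: (le_trans mt); rewrite ler_wpM2l//.
  by rewrite expr2 ler_piMl// ltW.
have v1 : u ^+ 2 + 2 * v - 2 * u = 0.
  apply: (@eq0_le_small _ c) => t t0 t1.
  have := main _ t0 t1; rewrite u1 add0r normrM (gtr0_norm t0) [t ^+ 2]expr2 [c * _]mulrA.
  by rewrite ler_pM2r.
have uE : u = 2^-1 by lra.
split; first by move: uE; rewrite /u; lra.
by move: v1; rewrite uE /v => /eqP; rewrite expr2; lra.
Qed.

End normal_moments.

(** * The characteristic function of the standard normal law *)

Section normal_characteristic.
Context {R : realType}.
Local Notation nu := (@normal_prob R 0 1).
Implicit Types (t th x : R).

Lemma cos_taylor2 x : `|cos x - 1 + x ^+ 2 / 2| <= `|x| ^+ 3.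
Proof.
rewrite -[leRHS]mul1r.
have dcst (c h : R) : is_derive h (1 : R) (fun=> c) 0 by exact: is_derive_cst.
have did (h : R) : is_derive h (1 : R) (fun h => h) 1 by exact: is_derive_id.
have dsq (h : R) : is_derive h (1 : R) (fun h => h ^+ 2 / 2) h.
  have := is_deriveZ (2^-1) (is_deriveX 2 (did h)).
  rewrite /GRing.scale/= !mulr1 expr1 mulrA mulVf// mul1r.
  by congr (is_derive _ _ _ _); apply/funext => k; rewrite mulrC.
have dcos (h : R) : is_derive h (1 : R) cos (- sin h) by exact: is_derive_cos.
have dsin (h : R) : is_derive h (1 : R) sin (cos h) by exact: is_derive_sin.
have d2 (h : R) : is_derive h (1 : R) (fun h => 1 - cos h) (sin h).
  by apply: (is_derive_eq (is_deriveB (dcst 1 h) (dcos h))); ring.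
have d1 (h : R) : is_derive h (1 : R) (fun h => h - sin h) (1 - cos h).
  exact: (is_deriveB (did h) (dsin h)).
have d0 (h : R) : is_derive h (1 : R) (fun h => cos h - 1 + h ^+ 2 / 2) (h - sin h).
  by apply: (is_derive_eq (is_deriveD (is_deriveB (dcos h) (dcst 1 h)) (dsq h))); ring.
apply: (derive_growth d0) => //; first by rewrite cos0 expr0n/=; ring.
apply: (derive_growth d1) => //; first by rewrite sin0; ring.
apply: (derive_growth d2) => //; first by rewrite cos0; ring.
by move=> h; rewrite expr0 mulr1 sin_max.
Qed.

Lemma continuous_cos_linear t th : continuous (fun z : R => cos (t * z + th)).
Proof.
move=> x; apply: (@continuous_comp _ _ _ (fun z : R => t * z + th) cos).
  exact: continuous_affine.
exact: continuous_cos.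
Qed.

Lemma continuous_sin_linear t th : continuous (fun z : R => sin (t * z + th)).
Proof.
move=> x; apply: (@continuous_comp _ _ _ (fun z : R => t * z + th) sin).
  exact: continuous_affine.
exact: continuous_sin.
Qed.

Lemma integrable_normal_cos t th :
  nu.-integrable setT (EFin \o (fun z => cos (t * z + th))).
Proof.
apply: (@bounded_integrable _ _ _ nu 1); last by move=> z; exact: cos_max.
exact: (continuous_measurable_fun (@continuous_cos_linear t th)).
Qed.

Lemma integrable_normal_sin t th :
  nu.-integrable setT (EFin \o (fun z => sin (t * z + th))).
Proof.
apply: (@bounded_integrable _ _ _ nu 1); last by move=> z; exact: sin_max.
exact: (continuous_measurable_fun (@continuous_sin_linear t th)).
Qed.

Lemma Rintegral_normal_sin t : \int[nu]_z sin (t * z) = 0.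
Proof.
have c : continuous (fun z : R => sin (t * z)).
  by have := @continuous_sin_linear t 0; under eq_fun do rewrite addr0.
have := Rintegral_normal_opp c (fun x => sin_max (t * x)).
under eq_Rintegral do rewrite mulrN sinN -mulN1r.
have i : nu.-integrable setT (EFin \o (fun z => sin (t * z))).
  by have := @integrable_normal_sin t 0; under eq_fun do rewrite addr0.
rewrite RintegralZl//; lra.
Qed.

Lemma expr_dist_le (a b : R) n : `|a| <= 1 -> `|b| <= 1 ->
  `|a ^+ n - b ^+ n| <= n%:R * `|a - b|.
Proof.
move=> a1 b1; elim: n => [|n ih]; first by rewrite !expr0 subrr normr0 mul0r.
have -> : a ^+ n.+1 - b ^+ n.+1 = (a - b) * a ^+ n + b * (a ^+ n - b ^+ n).
  by rewrite !exprS; ring.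
have -> : n.+1%:R * `|a - b| = `|a - b| + n%:R * `|a - b| by rewrite -natr1; ring.
apply: (le_trans (ler_normD _ _)); apply: lerD.
  by rewrite normrM ler_piMr// normrX exprn_ile1.
by rewrite normrM (le_trans _ ih)// ler_piMl.
Qed.

(* [F t = F (t / sqrt 2) ^+ 2] by the convolution formula, so [F t] is the [2 ^ n]-th power of
   [F (t / sqrt 2 ^+ n)], where [F h = 1 - h ^+ 2 / 2 + O(h ^+ 3)]. *)
Lemma Rintegral_normal_cos t : \int[nu]_z cos (t * z) = expR (- (t ^+ 2 / 2)).
Proof.
pose F t := \int[nu]_z cos (t * z).
pose E t := expR (- (t ^+ 2 / 2)) : R.
have ic u : nu.-integrable setT (EFin \o (fun z => cos (u * z))).
  by have := @integrable_normal_cos u 0; under eq_fun do rewrite addr0.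
have si u : nu.-integrable setT (EFin \o (fun z => sin (u * z))).
  by have := @integrable_normal_sin u 0; under eq_fun do rewrite addr0.
have cc u : continuous (fun z : R => cos (u * z)).
  by have := @continuous_cos_linear u 0; under eq_fun do rewrite addr0.
pose b := (Num.sqrt 2)^-1 : R.
have b0 : 0 < b by rewrite invr_gt0 sqrtr_gt0.
have b2 : b ^+ 2 = 2^-1 by rewrite exprVn sqr_sqrtr.
have b1 : b < 1 by rewrite invf_lt1 ?sqrtr_gt0// -[ltLHS]sqrtr1 ltr_sqrt//; lra.
have F2 s : F s = F (s * b) ^+ 2.
  have := Rintegral_normal_conv (ltW b0) (ltW b0) (cc s) (fun x => cos_max (s * x)).
  rewrite b2 (_ : 2^-1 + 2^-1 = 1 :> R); last by field.
  rewrite sqrtr1; under [X in _ = X]eq_Rintegral do rewrite mul1r.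
  rewrite -/(F s) => <-.
  (* In the addition formula the sine products integrate to 0 by oddness, so only the square of the
     cosine integral is left. *)
  under eq_Rintegral => z _.
    under eq_Rintegral => w _ do rewrite mulrDr !mulrA cosD.
    rewrite RintegralB//; [|exact: integrable_EFinZ..].
    rewrite !RintegralZl// Rintegral_normal_sin mulr0 subr0.
    over.
  by rewrite RintegralZr// expr2.
have Fn s n : F s = F (s * b ^+ n) ^+ (2 ^ n).
  elim: n s => [|n ih] s; first by rewrite expr0 mulr1 expr1.
  by rewrite ih F2 -exprM -mulrA -exprSr expnS.
have En s n : E s = E (s * b ^+ n) ^+ (2 ^ n).
  rewrite /E -expRM_natl; congr expR.
  rewrite natrX exprMn -exprM mulnC exprM b2 exprVn; field.
  by rewrite expf_neq0.
(* [1 + z ^+ 6] dominates [|z| ^+ 3], which comes from the cosine remainder at [h * z]. *)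
pose C := \int[nu]_z (1 + z ^+ 6).
have i6 := @integrable_EFinD _ _ _ nu _ _ (integrable_prob_cst nu 1) (@integrable_normal_pow6 R).
have FC h : `|F h - (1 - h ^+ 2 / 2)| <= C * `|h| ^+ 3.
  have i2 := @integrable_normal_pow R 2 isT.
  have -> : 1 - h ^+ 2 / 2 = \int[nu]_z (1 + - (h ^+ 2 / 2) * z ^+ 2).
    rewrite RintegralD//; [|exact: integrable_prob_cst|exact: integrable_EFinZ].
    by rewrite RintegralZl// Rintegral_prob_cst (@normal_moments24 R).1 mulr1.
  have -> : C * `|h| ^+ 3 = \int[nu]_z (`|h| ^+ 3 * (1 + z ^+ 6)).
    by rewrite RintegralZl// mulrC.
  apply: ler_distB_Rintegral => //.
  - apply: integrable_EFinD; [exact: integrable_prob_cst|exact: integrable_EFinZ].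
  - exact: integrable_EFinZ.
  - move=> z; have := cos_taylor2 (h * z).
    have -> : cos (h * z) - 1 + (h * z) ^+ 2 / 2 =
              cos (h * z) - (1 + - (h ^+ 2 / 2) * z ^+ 2) by field.
    move=> /le_trans; apply; rewrite normrM exprMn ler_wpM2l// -normrX.
    exact: norm_pow_le6.
(* For [|h| <= 1], the fourth and sixth powers left by expanding the exponential at [h ^+ 2 / 2] are
   absorbed by [|h| ^+ 3]. *)
have EC h : `|h| <= 1 -> `|E h - (1 - h ^+ 2 / 2)| <= `|h| ^+ 3.
  move=> h1.
  have x0 : 0 <= h ^+ 2 / 2 by rewrite divr_ge0 ?sqr_ge0.
  have := expR_taylor2 x0; rewrite -/(E h) => e.
  have -> : E h - (1 - h ^+ 2 / 2) =
    (E h - 1 + h ^+ 2 / 2 - (h ^+ 2 / 2) ^+ 2 / 2) + (h ^+ 2 / 2) ^+ 2 / 2 by ring.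
  apply: (le_trans (ler_normD _ _)).
  rewrite -(real_normK (num_real h)) in e *.
  move: e h1; have : 0 <= `|h| by []. set k := `|h|; set D := E h - 1 + _ - _.
  move=> k0 e k1.
  rewrite [X in _ + X]ger0_norm; last by rewrite divr_ge0// sqr_ge0.
  have k3 : 0 <= k ^+ 3 by rewrite exprn_ge0.
  have h4 : k ^+ 4 <= k ^+ 3 by rewrite exprS ler_piMl.
  have h6 : k ^+ 6 <= k ^+ 3 by rewrite (exprD k 3 3) ler_piMl// exprn_ile1.
  have e' : (k ^+ 2 / 2) ^+ 3 = k ^+ 6 / 8 by field.
  have e'' : (k ^+ 2 / 2) ^+ 2 / 2 = k ^+ 4 / 8 by field.
  rewrite e' in e; rewrite e''; lra.
have F1 h : `|F h| <= 1.
  by apply: ler_norm_Rintegral_bounded => [|z]; [exact: (continuous_measurable_fun (cc h))|exact: cos_max].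
have E1 h : `|E h| <= 1.
  by rewrite ger0_norm ?expR_ge0// -expR0 ler_expR oppr_le0 divr_ge0 ?sqr_ge0.
(* Each factor is off by at most [(C + 1) |t|^3 b^(3n)]. There are [2^n = b^(-2n)] factors, all
   bounded by 1, so the total error is [K b^n]. *)
pose K := (C + 1) * `|t| ^+ 3.
have dn n : `|t * b ^+ n| <= 1 -> `|F t - E t| <= K * b ^+ n.
  move=> h1; rewrite (Fn t n) (En t n).
  apply: (le_trans (expr_dist_le _ (F1 _) (E1 _))).
  have : `|F (t * b ^+ n) - E (t * b ^+ n)| <= (C + 1) * `|t * b ^+ n| ^+ 3.
    have -> : F (t * b ^+ n) - E (t * b ^+ n) = (F (t * b ^+ n) - (1 - (t * b ^+ n) ^+ 2 / 2))
      - (E (t * b ^+ n) - (1 - (t * b ^+ n) ^+ 2 / 2)) by ring.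
    by rewrite (le_trans (ler_normB _ _))// mulrDl mul1r lerD// EC.
  rewrite normrM exprMn (ger0_norm (exprn_ge0 n (ltW b0))) natrX => h.
  have -> : K * b ^+ n = 2 ^+ n * ((C + 1) * (`|t| ^+ 3 * (b ^+ n) ^+ 3)).
    rewrite /K; have -> : (b ^+ n) ^+ 3 = b ^+ n * (b ^+ 2) ^+ n by rewrite -!exprM mulnC -exprD; congr (_ ^+ _); rewrite mulSn.
    rewrite b2; set B := b ^+ n; rewrite exprVn; clearbody B; field.
    by rewrite expf_neq0.
  by rewrite ler_wpM2l// exprn_ge0.
have bn0 : (fun n => b ^+ n) @ \oo --> (0 : R).
  by apply: cvg_expr; rewrite ger0_norm// ltW.
apply/eqP; rewrite -subr_eq0 -normr_le0; apply/ler_addgt0Pr => e e0; rewrite add0r.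
have : \forall n \near \oo, `|t * b ^+ n| <= 1 /\ K * b ^+ n <= e.
  near=> n; split; last first.
    near: n; apply: (cvgr_le (0 : R)) => //.
    by rewrite -[X in _ --> X](mulr0 K); exact: cvgMr.
  near: n; apply: (cvgr_le (0 : R)) => //.
  have : (fun n => `|t * b ^+ n|) @ \oo --> `|t * 0|.
    by apply: cvg_norm; exact: cvgMr.
  by rewrite mulr0 normr0.
by case=> n _ /(_ n (leqnn _))[/dn h1 h2]; exact: le_trans h1 h2.
Unshelve. all: by end_near. Qed.

End normal_characteristic.

(** * Laws, independence and products of expectations *)

Section law_and_independence.
Context {R : realType}.
Local Notation nu := (@normal_prob R 0 1).

Lemma Rintegral_eq_law d1 d2 (T1 : measurableType d1) (T2 : measurableType d2)
    (P1 : probability T1 R) (P2 : probability T2 R) (Y : T1 -> R) (Z : T2 -> R)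
    (M : R) (f : R -> R) :
  measurable_fun setT Y -> measurable_fun setT Z ->
  (forall A, measurable A -> P1 (Y @^-1` A) = P2 (Z @^-1` A)) ->
  measurable_fun setT f -> (forall x, `|f x| <= M) ->
  \int[P1]_w f (Y w) = \int[P2]_w f (Z w).
Proof.
move=> mY mZ YZ mf fM.
have mfY : measurable_fun setT (fun w => f (Y w)) by exact: measurableT_comp.
have mfZ : measurable_fun setT (fun w => f (Z w)) by exact: measurableT_comp.
rewrite (Rintegral_shift P1 mfY (fun w => fM (Y w))).
rewrite (Rintegral_shift P2 mfZ (fun w => fM (Z w))).
congr (_ - _); rewrite /Rintegral; congr fine.
pose g (x : R) := (f x + M)%:E.
have mg : measurable_fun setT g by apply/measurable_EFinP; exact: measurable_funD.
have g0 x : (0 <= g x)%E.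
  by rewrite lee_fin; have := fM x; rewrite ler_norml => /andP[]; lra.
have := @ge0_integral_pushforward _ _ _ _ R Y mY P1 setT g measurableT mg (fun x _ => g0 x).
have := @ge0_integral_pushforward _ _ _ _ R Z mZ P2 setT g measurableT mg (fun x _ => g0 x).
rewrite !preimage_setT /= => <- <-.
by apply: eq_measure_integral => A mA _; exact: YZ.
Qed.

Lemma Rintegral_normal_cosD (t th : R) :
  \int[nu]_z cos (t * z + th) = cos th * expR (- (t ^+ 2 / 2)).
Proof.
have ic : nu.-integrable setT (EFin \o (fun z => cos (t * z))).
  by have := @integrable_normal_cos R t 0; under eq_fun do rewrite addr0.
have is' : nu.-integrable setT (EFin \o (fun z => sin (t * z))).
  by have := @integrable_normal_sin R t 0; under eq_fun do rewrite addr0.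
under eq_Rintegral do rewrite cosD.
rewrite RintegralB//; last 2 first.
- by under eq_fun do rewrite mulrC; exact: integrable_EFinZ.
- by under eq_fun do rewrite mulrC; exact: integrable_EFinZ.
rewrite !RintegralZr// Rintegral_normal_sin mul0r subr0.
by rewrite Rintegral_normal_cos mulrC.
Qed.

Lemma normal_rv_cos d (T : measurableType d) (P : probability T R) (Y : T -> R)
    (m v th : R) : 0 < v -> normal_rv P Y m v ->
  \int[P]_w cos (Y w + th) = cos (m + th) * expR (- (v / 2)).
Proof.
move=> v0 [mY lY].
have c1 : continuous (fun x : R => cos (x + th)).
  by have := @continuous_cos_linear R 1 th; under eq_fun do rewrite mul1r.
have mc := continuous_measurable_fun c1.
have s0 : 0 < Num.sqrt v by rewrite sqrtr_gt0.
transitivity (\int[normal_prob m (Num.sqrt v)]_x cos (x + th)).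
  apply: (@Rintegral_eq_law _ _ _ _ P (normal_prob m (Num.sqrt v)) Y id 1
    (fun x => cos (x + th))) => // x; exact: cos_max.
rewrite (Rintegral_normal_std m s0 c1 (fun x => cos_max (x + th))).
under eq_Rintegral do rewrite -addrA.
by rewrite Rintegral_normal_cosD sqr_sqrtr// ltW.
Qed.

(** The sum counts the integers from 1 to [n] that do not exceed [x], so it is the integer part of
    [x]. *)
Lemma sum_le_indic (x : R) n : 0 <= x <= n%:R ->
  `|x - \sum_(j < n) (j.+1%:R <= x)%R%:R| <= 1.
Proof.
move=> /andP[x0 xn].
have lt1 (k : nat) : k%:R <= x -> \sum_(j < k) (j.+1%:R <= x)%R%:R = k%:R :> R.
  move=> kx; rewrite (eq_bigr (fun=> 1)) ?sumr_const ?card_ord// => j _.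
  by rewrite (le_trans _ kx)// ler_nat.
suff : x - 1 <= \sum_(j < n) (j.+1%:R <= x)%R%:R <= x.
  by rewrite ler_norml => /andP[? ?]; apply/andP; split; lra.
elim: n xn => [|n ih] xn.
  by rewrite big_ord0; move: xn; rewrite mulr0n => ?; apply/andP; split; lra.
rewrite big_ord_recr/=.
have [nx|xn'] := leP n%:R x; last first.
  have -> : (n.+1%:R <= x) = false.
    by apply/negbTE; rewrite -ltNge (lt_le_trans xn')// ler_nat.
  by rewrite addr0 ih// ltW.
rewrite lt1//; case: (leP n.+1%:R x) => nx' /=; rewrite ?mulr1n ?mulr0n; move: xn nx nx'; rewrite -natr1 => ? ? ?.
  by apply/andP; split; lra.
by apply/andP; split; lra.
Qed.

Lemma eq0_le_natr (a K : R) : (forall n, `|a| <= K / n.+1%:R) -> a = 0.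
Proof.
move=> h; apply/eqP; rewrite -normr_le0; apply/ler_addgt0Pr => e e0; rewrite add0r.
have K0 : 0 <= K by have := le_trans (normr_ge0 _) (h 0); rewrite divr1.
have := archi_boundP (divr_ge0 K0 (ltW e0)).
set n := Num.bound _ => Kn; apply: (le_trans (h n)).
rewrite ler_pdivrMr// mulrC -ler_pdivrMr// (le_trans (ltW Kn))// ler_nat.
exact: leqnSn.
Qed.

Lemma bigcap_eq_seq (I : eqType) (U : Type) (s : seq I) (f : I -> set U) :
  \bigcap_(t in [set` s]) f t = \big[setI/setT]_(t <- s) f t.
Proof.
elim: s => [|i s ih].
  by rewrite big_nil; apply/seteqP; split.
rewrite big_cons -ih; apply/seteqP; split=> x /= h.
  split; first by apply: h; rewrite /= inE eqxx.
  by move=> j /= js; apply: h; rewrite /= inE js orbT.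
by move=> j /=; rewrite inE => /predU1P[->|js]; [exact: h.1|exact: h.2].
Qed.

Section indep_product.
Context d (T : measurableType d) (P : probability T R).

Lemma measurable_indic_comp (B : set R) (Y : T -> R) : measurable B ->
  measurable_fun setT Y -> measurable_fun setT (fun w => \1_B (Y w) : R).
Proof. by move=> mB mY; apply: measurableT_comp. Qed.

Lemma norm_indic_le1 (U : Type) (B : set U) (x : U) : `|\1_B x : R| <= 1.
Proof. by rewrite indicE; case: (_ \in _); rewrite ?normr1 ?normr0. Qed.

Lemma norm_prod_le1 (I : Type) (s : seq I) (F : I -> R) :
  (forall i, `|F i| <= 1) -> `|\prod_(i <- s) F i| <= 1.
Proof.
move=> F1; rewrite normr_prod; elim: s => [|i s ih]; first by rewrite big_nil.
by rewrite big_cons mulr_ile1// prodr_ge0.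
Qed.

(* [h] is approximated within [1 / N] by the step functions [floor (N h) / N]. *)
Lemma Rintegral_mul_approx (A Y : T -> R) (c : R) (h : R -> R) :
  measurable_fun setT A -> (forall w, `|A w| <= 1) -> measurable_fun setT Y ->
  (forall B, measurable B ->
     \int[P]_w (A w * \1_B (Y w)) = c * \int[P]_w (\1_B (Y w) : R)) ->
  measurable_fun setT h -> (forall x, `|h x| <= 1) ->
  \int[P]_w (A w * h (Y w)) = c * \int[P]_w h (Y w).
Proof.
move=> mA A1 mY AY mh h1.
have iA : P.-integrable setT (EFin \o A) by exact: (@bounded_integrable _ _ _ P 1).
have mI B : measurable B -> measurable_fun setT (fun w => \1_B (Y w) : R).
  by move=> mB; exact: measurable_indic_comp.
have iI B : measurable B -> P.-integrable setT (EFin \o (fun w => \1_B (Y w) : R)).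
  move=> mB; apply: (@bounded_integrable _ _ _ P 1); first exact: mI.
  by move=> w; exact: norm_indic_le1.
have iAI B : measurable B -> P.-integrable setT (EFin \o (fun w => A w * \1_B (Y w))).
  move=> mB; apply: (@bounded_integrable _ _ _ P 1).
    by apply: measurable_funM => //; exact: mI.
  by move=> w; rewrite normrM mulr_ile1// norm_indic_le1.
have cA : c = \int[P]_w A w.
  have := AY setT measurableT; rewrite (_ : (fun w => \1_setT (Y w) : R) = cst 1); last first.
    by apply/funext => w; rewrite indicT.
  by rewrite Rintegral_prob_cst mulr1 => <-; apply: eq_Rintegral => w _; rewrite indicT mulr1.
have c1 : `|c| <= 1 by rewrite cA; exact: ler_norm_Rintegral_bounded.
(* An affine rescaling of [h] into [[0, 1]], where the staircase approximation applies; linearity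
   returns to [h]. *)
pose g x := (h x + 1) / 2.
have mg : measurable_fun setT g.
  by apply: measurable_funM => //; exact: measurable_funD.
have g01 x : 0 <= g x <= 1.
  have := h1 x; rewrite ler_norml /g => /andP[? ?].
  by rewrite divr_ge0/= ?ler_pdivrMr//; lra.
suff key : \int[P]_w (A w * g (Y w)) = c * \int[P]_w g (Y w).
  have hE x : h x = 2 * g x - 1 by rewrite /g; field.
  have igY : P.-integrable setT (EFin \o (fun w => g (Y w))).
    apply: (@bounded_integrable _ _ _ P 1); first exact: measurableT_comp.
    by move=> w; case/andP: (g01 (Y w)) => g0 g1; rewrite ger0_norm.
  have iAg : P.-integrable setT (EFin \o (fun w => A w * g (Y w))).
    apply: (@bounded_integrable _ _ _ P 1).
      by apply: measurable_funM => //; exact: measurableT_comp.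
    by move=> w; case/andP: (g01 (Y w)) => g0 g1; rewrite normrM mulr_ile1// ger0_norm.
  transitivity (\int[P]_w (2 * (A w * g (Y w)) - A w)).
    by apply: eq_Rintegral => w _; rewrite hE; ring.
  rewrite RintegralB//; last exact: integrable_EFinZ.
  rewrite RintegralZl// key -cA.
  under [in RHS]eq_Rintegral do rewrite hE.
  rewrite RintegralB//; [|exact: integrable_EFinZ|exact: integrable_prob_cst].
  by rewrite RintegralZl// Rintegral_prob_cst; ring.
(* The constant 2 counts two approximation errors, one on each side; [|c| <= 1] keeps the second
   from growing. *)
apply/eqP; rewrite -subr_eq0; apply/eqP; apply: (@eq0_le_natr _ 2) => n.
pose N := n.+1.
pose B (j : 'I_N) := [set x | j.+1%:R <= N%:R * g x].
have mB j : measurable (B j).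
  rewrite /B -[X in measurable X]setTI.
  apply: (measurable_fun_ler (f := cst _)) => //.
  exact: measurable_funM.
pose gn x := N%:R^-1 * \sum_(j < N) (\1_(B j) x : R).
have gg x : `|g x - gn x| <= N%:R^-1.
  have N0 : 0 < N%:R :> R by [].
  have -> : g x - gn x = N%:R^-1 * (N%:R * g x - \sum_(j < N) (j.+1%:R <= N%:R * g x)%R%:R).
    rewrite mulrBr mulKf ?gt_eqF//; congr (_ - _ * _); apply: eq_bigr => j _.
    rewrite indicE; congr (_%:R); congr nat_of_bool.
    by apply/idP/idP => [/set_mem//|?]; exact/mem_set.
  rewrite normrM gtr0_norm ?invr_gt0// ler_piMr ?invr_ge0//; apply: sum_le_indic.
  by case/andP: (g01 x) => g0 g1; rewrite mulr_ge0//= ler_piMr.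
have ign : P.-integrable setT (EFin \o (fun w => gn (Y w))).
  apply: integrable_EFinZ; apply: integrable_EFin_sum => j; exact: iI.
have iAgn : P.-integrable setT (EFin \o (fun w => A w * gn (Y w))).
  have -> : (fun w => A w * gn (Y w)) = (fun w => N%:R^-1 * \sum_(j < N) (A w * \1_(B j) (Y w))).
    by apply/funext => w; rewrite /gn mulrCA mulr_sumr.
  by apply: integrable_EFinZ; apply: integrable_EFin_sum => j; exact: iAI.
have keyn : \int[P]_w (A w * gn (Y w)) = c * \int[P]_w gn (Y w).
  under eq_Rintegral do rewrite /gn mulrCA mulr_sumr.
  rewrite RintegralZl//; last by apply: integrable_EFin_sum => j; exact: iAI.
  rewrite [in RHS]RintegralZl//; last by apply: integrable_EFin_sum => j; exact: iI.
  rewrite !Rintegral_sum//; [|by move=> j; exact: iI|by move=> j; exact: iAI].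
  by rewrite [RHS]mulrCA; congr (_ * _); rewrite mulr_sumr; apply: eq_bigr => j _; exact: AY.
have iAg : P.-integrable setT (EFin \o (fun w => A w * g (Y w))).
  apply: (@bounded_integrable _ _ _ P 1).
    by apply: measurable_funM => //; exact: measurableT_comp.
  by move=> w; case/andP: (g01 (Y w)) => g0 g1; rewrite normrM mulr_ile1// ger0_norm.
have igY : P.-integrable setT (EFin \o (fun w => g (Y w))).
  apply: (@bounded_integrable _ _ _ P 1); first exact: measurableT_comp.
  by move=> w; case/andP: (g01 (Y w)) => g0 g1; rewrite ger0_norm.
have e1 : `|\int[P]_w (A w * g (Y w)) - \int[P]_w (A w * gn (Y w))| <= N%:R^-1.
  rewrite -[leRHS](Rintegral_prob_cst P); apply: ler_distB_Rintegral => //.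
    exact: integrable_prob_cst.
  by move=> w; rewrite -mulrBr normrM (le_trans _ (gg (Y w)))// ler_piMl.
have e2 : `|\int[P]_w g (Y w) - \int[P]_w gn (Y w)| <= N%:R^-1.
  rewrite -[leRHS](Rintegral_prob_cst P); apply: ler_distB_Rintegral => //.
  exact: integrable_prob_cst.
have -> : \int[P]_w (A w * g (Y w)) - c * \int[P]_w g (Y w) =
  (\int[P]_w (A w * g (Y w)) - \int[P]_w (A w * gn (Y w))) -
  c * (\int[P]_w g (Y w) - \int[P]_w gn (Y w)) by rewrite keyn; ring.
apply: (le_trans (ler_normB _ _)); rewrite [leRHS](_ : _ = N%:R^-1 + N%:R^-1); last first.
  by rewrite mulrDl mul1r.
by apply: lerD => //; rewrite normrM (le_trans _ e2)// ler_piMl.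
Qed.

Lemma mutual_indep_prod (I : eqType) (J : set I) (G : I -> set (set T))
    (Y : I -> T -> R) (F : seq I) :
  mutual_indep P J G -> uniq F -> (forall l, l \in F -> J l) ->
  (forall l, measurable_fun setT (Y l)) ->
  (forall l B, l \in F -> measurable B -> <<s G l >> (Y l @^-1` B)) ->
  forall h : I -> R -> R, (forall l, measurable_fun setT (h l)) ->
  (forall l x, `|h l x| <= 1) ->
  \int[P]_w (\prod_(l <- F) h l (Y l w)) = \prod_(l <- F) \int[P]_w h l (Y l w).
Proof.
move=> indP uF FJ mY GY.
(* [F1] lists the indices already allowed an arbitrary bounded function; at the others [h l] is an
   indicator. The empty list is the definition of independence, and each induction step frees one
   index. *)
suff claim (F1 : seq I) (h : I -> R -> R) : (forall l, measurable_fun setT (h l)) ->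
    (forall l x, `|h l x| <= 1) ->
    (forall l, l \in F -> l \notin F1 -> exists2 B, measurable B & h l = \1_B) ->
    \int[P]_w (\prod_(l <- F) h l (Y l w)) = \prod_(l <- F) \int[P]_w h l (Y l w).
  by move=> h mh h1; apply: (claim F) => // l ->.
elim: F1 h => [|l0 F1 ih] h mh h1 hB.
  (* The event is read off from the indicator [h l] itself, which avoids choosing the sets [B]. *)
  pose E l := Y l @^-1` [set x | h l x = 1].
  have hE l w : l \in F -> h l (Y l w) = \1_(E l) w.
    move=> /hB/(_ isT)[B mB hl]; rewrite /E hl !indicE; congr (_%:R); congr nat_of_bool.
    apply/idP/idP => [/set_mem BY|/set_mem/=]; last first.
      by rewrite indicE; case: (_ \in _) => // /eqP; rewrite eq_sym oner_eq0.
    by apply/mem_set => /=; rewrite indicE mem_set.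
  have GE l : l \in F -> <<s G l >> (E l).
    move=> lF; apply: GY => //; have [B mB hl] := hB _ lF isT.
    rewrite (_ : [set x | _] = B)//; apply/seteqP; split=> x /=; rewrite hl indicE.
      by case: (boolP (x \in B)) => [/set_mem//|_ /eqP]; rewrite eq_sym oner_eq0.
    by move=> Bx; rewrite mem_set.
  have mE l : l \in F -> measurable (E l).
    move=> lF; rewrite -[E l]setTI; apply: mY => //.
    have [B mB hl] := hB _ lF isT.
    rewrite (_ : [set x | _] = B)//; apply/seteqP; split=> x /=; rewrite hl indicE.
      by case: (boolP (x \in B)) => [/set_mem//|_ /eqP]; rewrite eq_sym oner_eq0.
    by move=> Bx; rewrite mem_set.
  have PE := indP F uF FJ E GE.
  transitivity (fine (P (\bigcap_(l in [set` F]) E l))).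
    have mC : measurable (\bigcap_(l in [set` F]) E l).
      rewrite bigcap_eq_seq big_seq; apply: (big_ind measurable) => //.
      exact: measurableI.
    rewrite -[in RHS](setIT (\bigcap_(l in _) _)) -integral_indic//.
    rewrite /Rintegral; congr fine; apply: eq_integral => w _; congr EFin.
    rewrite (eq_big_seq (fun l => \1_(E l) w)); last by move=> l; exact: hE.
    rewrite bigcap_eq_seq; elim: (F) => [|l s ihs]; first by rewrite !big_nil indicT.
    by rewrite !big_cons indicI ihs.
  have PEf l : l \in F -> P (E l) = (\int[P]_w h l (Y l w))%:E.
    move=> lF; rewrite -[E l]setIT -integral_indic//; last exact: mE.
    rewrite /Rintegral -[X in (fine X)%:E](_ : \int[P]_w (\1_(E l) w)%:E = _)%E; last first.
      by apply: eq_integral => w _; rewrite hE.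
    by rewrite fineK// integral_indic ?setIT ?fin_num_measure//; exact: mE.
  rewrite PE (eq_big_seq _ PEf) -[RHS]/(fine (_%:E)); congr fine.
  by apply/esym; apply: (big_morph EFin).
have [l0F|l0F] := boolP (l0 \in F); last first.
  apply: ih => // l lF lF1; apply: hB => //.
  by rewrite inE negb_or lF1 andbT; apply: contraNneq l0F => <-.
pose F' := rem l0 F.
have F'l0 l : l \in F' -> l != l0.
  by rewrite mem_rem_uniq// inE => /andP[].
pose A w := \prod_(l <- F') h l (Y l w).
pose c := \prod_(l <- F') \int[P]_w h l (Y l w).
transitivity (\int[P]_w (A w * h l0 (Y l0 w))).
  by apply: eq_Rintegral => w _; rewrite (big_rem l0)//= mulrC.
transitivity (c * \int[P]_w h l0 (Y l0 w)); last by rewrite [RHS](big_rem l0)//= mulrC.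
apply: Rintegral_mul_approx => //.
- rewrite /A; elim: (F') => [|l s ihs].
    by under eq_fun do rewrite big_nil; exact: measurable_cst.
  by under eq_fun do rewrite big_cons; apply: measurable_funM => //; apply: measurableT_comp.
- by move=> w; exact: norm_prod_le1.
move=> B mB.
(* With an indicator put at [l0], the induction hypothesis becomes exactly the premise of
   [Rintegral_mul_approx]. *)
pose h' l := if l == l0 then \1_B else h l.
have h'E l : l \in F' -> h' l = h l by move=> /F'l0 ll0; rewrite /h' (negbTE ll0).
have h'l0 : h' l0 = \1_B by rewrite /h' eqxx.
have := ih h'; rewrite (big_rem l0)//= h'l0.
under eq_Rintegral do rewrite (big_rem l0)//= h'l0.
rewrite /A /c.
under eq_Rintegral do rewrite mulrC -/F' (eq_big_seq _ (fun l lF' => congr1 (@^~ _) (h'E l lF'))).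
rewrite -/F' mulrC (eq_big_seq (fun l => \int[P]_w h l (Y l w))); last first.
  by move=> l lF'; rewrite h'E.
apply.
- by move=> l; rewrite /h'; case: ifP => // _; exact: measurable_indic.
- by move=> l x; rewrite /h'; case: ifP => // _; exact: norm_indic_le1.
- move=> l lF lF1; rewrite /h'; case: eqP => [_|/eqP ll0]; first by exists B.
  by apply: hB => //; rewrite inE negb_or ll0.
Qed.

(** Real form of the multiplicativity of characteristic functions: [m l] is the phase and [e l] the
    modulus attached to [Y l]. Phases add and moduli multiply. *)
Lemma mutual_indep_cos (I : eqType) (J : set I) (G : I -> set (set T))
    (Y : I -> T -> R) (F : seq I) (m e : I -> R) :
  mutual_indep P J G -> uniq F -> (forall l, l \in F -> J l) ->
  (forall l, measurable_fun setT (Y l)) ->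
  (forall l B, l \in F -> measurable B -> <<s G l >> (Y l @^-1` B)) ->
  (forall l th, l \in F -> \int[P]_w cos (Y l w + th) = cos (m l + th) * e l) ->
  forall th, \int[P]_w cos (\sum_(l <- F) Y l w + th) =
    cos (\sum_(l <- F) m l + th) * \prod_(l <- F) e l.
Proof.
move=> indP uF FJ mY GY Ycos.
(* Variables indexed by [F1] are still inside the cosine; those indexed by [F2] have been extracted
   into separate factors. The addition formula moves one index from [F1] to [F2]. *)
suff claim (F1 F2 : seq I) (h : I -> R -> R) th : {subset F1 ++ F2 <= F} -> uniq (F1 ++ F2) ->
    (forall l, measurable_fun setT (h l)) -> (forall l x, `|h l x| <= 1) ->
    \int[P]_w (cos (\sum_(l <- F1) Y l w + th) * \prod_(l <- F2) h l (Y l w)) =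
    cos (\sum_(l <- F1) m l + th) * \prod_(l <- F1) e l *
      \prod_(l <- F2) \int[P]_w h l (Y l w).
  move=> th; have := claim F [::] (fun=> cst 0) th; rewrite cats0 big_nil mulr1 => <-//.
  - by apply: eq_Rintegral => w _; rewrite big_nil mulr1.
  - by move=> l x; rewrite normr0.
elim: F1 F2 h th => [|l0 F1 ih] F2 h th sF uF12 mh h1.
  rewrite !big_nil mulr1 add0r; under eq_Rintegral do rewrite big_nil add0r.
  have mp : measurable_fun setT (fun w => \prod_(l <- F2) h l (Y l w)).
    elim: (F2) => [|l s ihs]; first by under eq_fun do rewrite big_nil; exact: measurable_cst.
    by under eq_fun do rewrite big_cons; apply: measurable_funM => //; apply: measurableT_comp.
  rewrite RintegralZl//; last first.
    by apply: (@bounded_integrable _ _ _ P 1) => // w; exact: norm_prod_le1.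
  congr (_ * _); apply: (mutual_indep_prod indP) => //.
  - by move=> l lF2; apply/FJ/sF.
  - by move=> l B lF2 mB; apply: GY => //; exact: sF.
have l0F : l0 \in F by apply: sF; rewrite inE eqxx.
move: (uF12) => /= /andP[l0n uF12'].
have uF' : uniq (F1 ++ l0 :: F2).
  rewrite (perm_uniq (_ : perm_eq _ (l0 :: F1 ++ F2)))//.
  by rewrite -[l0 :: F2]cat1s -[l0 :: F1 ++ F2]cat1s perm_catCA.
have sF' : {subset F1 ++ l0 :: F2 <= F}.
  move=> l; rewrite mem_cat inE => h'; apply: sF; rewrite /= inE mem_cat.
  by move: h' => /or3P[]->; rewrite ?orbT.
pose hh (f : R -> R) l := if l == l0 then f else h l.
have hhE (f : R -> R) l : l \in F2 -> hh f l = h l.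
  move=> lF2; rewrite /hh; case: eqP => // ll0.
  by move: l0n; rewrite mem_cat -ll0 lF2 orbT.
have hh0 f : hh f l0 = f by rewrite /hh eqxx.
have IH (f : R -> R) th' : measurable_fun setT f -> (forall x, `|f x| <= 1) ->
    \int[P]_w (cos (\sum_(l <- F1) Y l w + th') * (f (Y l0 w) * \prod_(l <- F2) h l (Y l w))) =
    cos (\sum_(l <- F1) m l + th') * \prod_(l <- F1) e l *
    (\int[P]_w f (Y l0 w) * \prod_(l <- F2) \int[P]_w h l (Y l w)).
  move=> mf f1; have := ih (l0 :: F2) (hh f) th' sF' uF'.
  have eqI : \prod_(l <- F2) \int[P]_w hh f l (Y l w) = \prod_(l <- F2) \int[P]_w h l (Y l w).
    by apply: eq_big_seq => l lF2; rewrite hhE.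
  rewrite big_cons hh0 eqI => <-.
  - apply: eq_Rintegral => w _; rewrite big_cons hh0; congr (_ * (_ * _)).
    by apply: eq_big_seq => l lF2; rewrite hhE.
  - by move=> l; rewrite /hh; case: ifP.
  - by move=> l x; rewrite /hh; case: ifP.
have sinE (x : R) : sin x = cos (x - pi / 2) by rewrite cosBpihalf.
have cosS (S : R) : cos (S + (th - pi / 2)) = sin (S + th) by rewrite sinE addrA.
have mcos : measurable_fun setT (@cos R) by apply: continuous_measurable_fun => x; exact: continuous_cos.
have msin : measurable_fun setT (@sin R) by apply: continuous_measurable_fun => x; exact: continuous_sin.
have Ic := IH cos th mcos (@cos_max R).
have Is := IH sin (th - pi / 2) msin (@sin_max R).
have mS (th' : R) (f : R -> R) : measurable_fun setT f -> measurable_fun setT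
    (fun w => cos (\sum_(l <- F1) Y l w + th') * (f (Y l0 w) * \prod_(l <- F2) h l (Y l w))).
  move=> mf; apply: measurable_funM.
    apply: measurableT_comp => //; apply: measurable_funD => //.
    elim: (F1) => [|l s ihs]; first by under eq_fun do rewrite big_nil; exact: measurable_cst.
    by under eq_fun do rewrite big_cons; apply: measurable_funD.
  apply: measurable_funM; first exact: measurableT_comp.
  elim: (F2) => [|l s ihs]; first by under eq_fun do rewrite big_nil; exact: measurable_cst.
  by under eq_fun do rewrite big_cons; apply: measurable_funM => //; apply: measurableT_comp.
have iS (th' : R) (f : R -> R) : measurable_fun setT f -> (forall x, `|f x| <= 1) -> P.-integrable setT (EFin \o
    (fun w => cos (\sum_(l <- F1) Y l w + th') * (f (Y l0 w) * \prod_(l <- F2) h l (Y l w)))).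
  move=> mf f1; apply: (@bounded_integrable _ _ _ P 1); first exact: mS.
  move=> w; rewrite normrM mulr_ile1 ?cos_max// normrM mulr_ile1//.
  exact: norm_prod_le1.
(* The sine of the remaining sum is a cosine with phase [th - pi / 2], so the induction hypothesis
   covers both products. *)
transitivity (\int[P]_w (cos (\sum_(l <- F1) Y l w + th) * (cos (Y l0 w) * \prod_(l <- F2) h l (Y l w))
   - cos (\sum_(l <- F1) Y l w + (th - pi / 2)) * (sin (Y l0 w) * \prod_(l <- F2) h l (Y l w)))).
  apply: eq_Rintegral => w _; rewrite big_cons.
  rewrite cosS; set S := \sum_(l <- F1) _.
  have -> : Y l0 w + S + th = S + th + Y l0 w by ring.
  by rewrite cosD; ring.
rewrite RintegralB//; [|exact: iS mcos (@cos_max R)|exact: iS msin (@sin_max R)].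
rewrite Ic Is.
have := Ycos l0 0 l0F; under eq_Rintegral do rewrite addr0; rewrite addr0 => ->.
have := Ycos l0 (- (pi / 2)) l0F; under eq_Rintegral do rewrite -sinE; rewrite -sinE => ->.
rewrite !big_cons cosS; set S := \sum_(l <- F1) _.
have -> : m l0 + S + th = S + th + m l0 by ring.
by rewrite (cosD (S + th)); ring.
Qed.

End indep_product.
End law_and_independence.

(** * From cosine transforms to the Laplace transform of a sum of squares *)

Section hubbard_stratonovich.
Context {R : realType} d (T : measurableType d) (P : probability T R).
Local Notation nu := (@normal_prob R 0 1).

Lemma sum_delta (D r : nat) (F : nat -> R) : (r < D)%N ->
  \sum_(s < D) (s == r :> nat)%:R * F s = F r.
Proof.
move=> rD; rewrite (bigD1 (Ordinal rD))//= eqxx mul1r big1 ?addr0// => s.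
by rewrite -val_eqE/= => /negbTE ->; rewrite mul0r.
Qed.

Lemma measurable_sum_ord (D : nat) (F : nat -> T -> R) :
  (forall s, measurable_fun setT (F s)) ->
  measurable_fun setT (fun w => \sum_(s < D) F s w).
Proof.
move=> mF; elim: D => [|D ih]; first by under eq_fun do rewrite big_ord0; exact: measurable_cst.
by under eq_fun do rewrite big_ord_recr/=; exact: measurable_funD.
Qed.

Lemma measurable_prod_ord (D : nat) (F : nat -> T -> R) :
  (forall s, measurable_fun setT (F s)) ->
  measurable_fun setT (fun w => \prod_(s < D) F s w).
Proof.
move=> mF; elim: D => [|D ih]; first by under eq_fun do rewrite big_ord0; exact: measurable_cst.
by under eq_fun do rewrite big_ord_recr/=; exact: measurable_funM.
Qed.

Lemma laplace_of_cos (D : nat) (G : nat -> T -> R) (lam : nat -> R) :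
  (forall s, measurable_fun setT (G s)) -> (forall s, (s < D)%N -> 0 <= lam s) ->
  (forall (u : nat -> R) th, \int[P]_w cos (\sum_(s < D) u s * G s w + th) =
     cos th * expR (- (\sum_(s < D) lam s * u s ^+ 2 / 2))) ->
  forall t, 0 <= t ->
  \int[P]_w expR (- (t * (\sum_(s < D) G s w ^+ 2) / 2)) =
  \prod_(s < D) (Num.sqrt (1 + t * lam s))^-1.
Proof.
move=> mG lam0 Gcos t t0.
pose e s w := expR (- (t * G s w ^+ 2 / 2)).
have me s : measurable_fun setT (e s).
  apply: (measurableT_comp (continuous_measurable_fun (@continuous_expR_quad R t))).
  exact: mG.
have e1 s w : `|e s w| <= 1.
  rewrite ger0_norm ?expR_ge0// -expR0 ler_expR oppr_le0.
  by rewrite divr_ge0// mulr_ge0// sqr_ge0.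
(* The first [r] coordinates carry their exponential factor and have frequency 0; the others are
   still only in the cosine. To pass to [r + 1], the zero frequency at [r] is replaced by
   [sqrt t * z] with [z] Gaussian; averaging over [z] produces the factor [e r] on one side and
   [(1 + t lam_r)^(-1/2)] on the other. *)
suff claim r : (r <= D)%N -> forall u th, (forall s, (s < r)%N -> u s = 0) ->
    \int[P]_w (cos (\sum_(s < D) u s * G s w + th) * \prod_(s < r) e s w) =
    cos th * expR (- (\sum_(s < D) lam s * u s ^+ 2 / 2)) *
    \prod_(s < r) (Num.sqrt (1 + t * lam s))^-1.
  have := claim D (leqnn _) (fun=> 0) 0 (fun _ _ => erefl).
  rewrite cos0 mul1r [X in expR (- X)]big1 ?oppr0 ?expR0 ?mul1r; last first.
    by move=> s _; rewrite expr0n/= mulr0 mul0r.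
  move=> <-; apply: eq_Rintegral => w _.
  rewrite addr0 [X in cos X]big1 ?cos0 ?mul1r; last by move=> s _; rewrite mul0r.
  rewrite -expR_sum; congr expR.
  by rewrite sumrN mulr_sumr mulr_suml.
elim: r => [|r ih] rD u th u0.
  rewrite big_ord0 mulr1 -Gcos; apply: eq_Rintegral => w _.
  by rewrite big_ord0 mulr1.
have ur : u r = 0 by exact: u0.
pose u' z s := u s + (s == r)%:R * (Num.sqrt t * z).
have u'0 z s : (s < r)%N -> u' z s = 0.
  move=> sr; rewrite /u' (u0 s (ltnW sr)) add0r.
  by case: eqP => [e'|_]; [rewrite e' ltnn in sr|rewrite mul0r].
have sumu' z w : \sum_(s < D) u' z s * G s w =
    Num.sqrt t * G r w * z + \sum_(s < D) u s * G s w.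
  rewrite /u'; under eq_bigr do rewrite mulrDl -mulrA.
  rewrite big_split/= (sum_delta (fun s => Num.sqrt t * z * G s w) rD).
  by rewrite addrC; congr (_ + _); ring.
have suml z : \sum_(s < D) lam s * u' z s ^+ 2 / 2 =
    \sum_(s < D) lam s * u s ^+ 2 / 2 + t * lam r * z ^+ 2 / 2.
  rewrite (eq_bigr (fun s : 'I_D => lam s * u s ^+ 2 / 2 +
    (s == r :> nat)%:R * (t * lam s * z ^+ 2 / 2))).
    by rewrite big_split/= (sum_delta (fun s => t * lam s * z ^+ 2 / 2) rD).
  move=> s _; rewrite /u'; case: eqP => [sr|_]; last by rewrite !mul0r !addr0.
  rewrite sr ur add0r !mul1r exprMn sqr_sqrtr//; ring.
transitivity (\int[P]_w \int[nu]_z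
    (cos (\sum_(s < D) u' z s * G s w + th) * \prod_(s < r) e s w)).
  apply: eq_Rintegral => w _.
  under eq_Rintegral do rewrite sumu' -addrA.
  rewrite RintegralZr//; last exact: integrable_normal_cos.
  rewrite Rintegral_normal_cosD big_ord_recr/= /e exprMn sqr_sqrtr//; ring.
pose F (wz : T * R) := cos (\sum_(s < D) u' wz.2 s * G s wz.1 + th) * \prod_(s < r) e s wz.1.
transitivity (\int[nu]_z \int[P]_w F (w, z)).
  apply: (@Rintegral_Fubini _ _ _ _ _ P nu 1 F).
    apply: measurable_funM; last first.
      apply: (measurableT_comp (measurable_prod_ord r me)); exact: measurable_fst.
    have mcos : measurable_fun setT (@cos R).
      by apply: continuous_measurable_fun => x; exact: continuous_cos.
    apply: measurableT_comp => //; apply: measurable_funD => //.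
    under eq_fun do rewrite sumu'.
    apply: measurable_funD.
      apply: measurable_funM => //; apply: measurable_funM => //.
      exact: measurableT_comp.
    apply: (measurableT_comp (@measurable_sum_ord D (fun s w => u s * G s w) _)) => //.
    by move=> s; exact: measurable_funM.
  move=> wz; rewrite normrM mulr_ile1 ?cos_max//.
  by apply: norm_prod_le1.
pose c := cos th * expR (- (\sum_(s < D) lam s * u s ^+ 2 / 2)) *
   \prod_(s < r) (Num.sqrt (1 + t * lam s))^-1.
transitivity (\int[nu]_z (c * expR (- (t * lam r * z ^+ 2 / 2)))).
  apply: eq_Rintegral => z _.
  rewrite (ih (ltnW rD) (u' z) th (u'0 z)) suml opprD expRD /c; ring.
have tl : 0 <= t * lam r by rewrite mulr_ge0// lam0.
rewrite RintegralZl//; last by apply: integrable_normal_expR; lra.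
rewrite Rintegral_normal_expR; last by lra.
by rewrite big_ord_recr/= mulrA.
Qed.

End hubbard_stratonovich.

(** * Test functions, one-step averages and their expansions *)

Section gaussian_steps.
Context {R : realType}.
Local Notation nu := (@normal_prob R 0 1).
Implicit Types (f g : R -> R) (x h K : R).

(** A class of bounded measurable functions that [gstep] preserves with the same two constants, so
    iterated integrals remain well defined. *)
Definition bounded_lipschitz f := exists M L : R,
  (forall x, `|f x| <= M) /\ forall x y, `|f x - f y| <= L * `|x - y|.

Lemma lipschitz_continuous f (L : R) :
  (forall x y, `|f x - f y| <= L * `|x - y|) -> continuous f.
Proof.
move=> fL x; apply/cvgrPdist_le => e e0.
have L1 : 0 < `|L| + 1 by rewrite ltr_wpDl.
near=> y.
apply: (le_trans (fL x y)); apply: (@le_trans _ _ ((`|L| + 1) * `|x - y|)).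
  by rewrite ler_wpM2r// (le_trans (ler_norm _))// lerDl.
rewrite mulrC -ler_pdivlMr//.
near: y; apply: cvgr_dist_le; first exact: cvg_id.
exact: divr_gt0.
Unshelve. all: by end_near. Qed.

Lemma bounded_lipschitz_continuous f : bounded_lipschitz f -> continuous f.
Proof. by move=> [M [L [_ fL]]]; exact: lipschitz_continuous fL. Qed.

Lemma bounded_lipschitz_measurable f : bounded_lipschitz f -> measurable_fun setT f.
Proof. by move=> /bounded_lipschitz_continuous cf; exact: continuous_measurable_fun cf. Qed.

(* The law of [x + g Z] with [Z] standard normal, acting on test functions. *)
Definition gstep (g : R -> R) f x := \int[nu]_z f (x + g z).

Lemma integrable_gstep g f x : measurable_fun setT g -> bounded_lipschitz f ->
  nu.-integrable setT (EFin \o (fun z => f (x + g z))).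
Proof.
move=> mg bf; have mf := bounded_lipschitz_measurable bf.
case: bf => M [L [fM _]].
apply: (@bounded_integrable _ _ _ nu M) => //.
by apply: (measurableT_comp mf); exact: measurable_funD.
Qed.

Lemma ler_dist_gstep g f f' x e : measurable_fun setT g ->
  bounded_lipschitz f -> bounded_lipschitz f' ->
  (forall y, `|f y - f' y| <= e) -> `|gstep g f x - gstep g f' x| <= e.
Proof.
move=> mg bf bf' ff'; rewrite -[leRHS](Rintegral_prob_cst nu).
apply: ler_distB_Rintegral => //; [exact: integrable_gstep..|].
exact: integrable_prob_cst.
Qed.

Lemma bounded_lipschitz_gstep g f : measurable_fun setT g ->
  bounded_lipschitz f -> bounded_lipschitz (gstep g f).
Proof.
move=> mg bf; have mf := bounded_lipschitz_measurable bf.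
case: (bf) => M [L [fM fL]]; exists M, L; split => [x|x y].
  apply: ler_norm_Rintegral_bounded => //.
  by apply: (measurableT_comp mf); exact: measurable_funD.
rewrite -[leRHS](Rintegral_prob_cst nu); apply: ler_distB_Rintegral => //.
- exact: integrable_gstep.
- exact: integrable_gstep.
- exact: integrable_prob_cst.
- move=> z; apply: (le_trans (fL _ _)).
  by rewrite (_ : x + g z - (y + g z) = x - y)//; ring.
Qed.

Lemma gstep0 g f x : (forall z, g z = 0) -> gstep g f x = f x.
Proof.
move=> g0; rewrite /gstep; under eq_Rintegral do rewrite g0 addr0.
by rewrite Rintegral_prob_cst.
Qed.

(** Uniform remainder bounds replace derivatives: they survive averaging by integrating the
    inequality, and no differentiation under the integral sign arises. [f1] enters only as a
    coefficient function. *)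
Definition taylor2 K f f1 := forall x h, `|f (x + h) - f x - f1 x * h| <= K * h ^+ 2.

Definition taylor3 K f f1 f2 := forall x h,
  `|f (x + h) - f x - f1 x * h - f2 x * h ^+ 2 / 2| <= K * `|h| ^+ 3.

Lemma taylor2_gstep K f f1 g x : bounded_lipschitz f -> taylor2 K f f1 ->
  measurable_fun setT g ->
  nu.-integrable setT (EFin \o g) -> nu.-integrable setT (EFin \o (fun z => g z ^+ 2)) ->
  \int[nu]_z g z = 0 ->
  `|gstep g f x - f x| <= K * \int[nu]_z (g z ^+ 2).
Proof.
move=> bf tf mg ig ig2 g0.
have -> : f x = \int[nu]_z (f x + f1 x * g z).
  rewrite RintegralD//; [|exact: integrable_prob_cst|exact: integrable_EFinZ].
  by rewrite RintegralZl// g0 mulr0 addr0 Rintegral_prob_cst.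
rewrite -RintegralZl//; apply: ler_distB_Rintegral.
- exact: integrable_gstep.
- apply: integrable_EFinD; [exact: integrable_prob_cst|exact: integrable_EFinZ].
- exact: integrable_EFinZ.
- by move=> z; rewrite opprD addrA; exact: tf.
Qed.

(** The main term depends on [g] only through its variance. Two centred steps of equal variance
    therefore differ by third absolute moments alone. *)
Lemma taylor3_gstep_approx K f f1 f2 g x : bounded_lipschitz f -> taylor3 K f f1 f2 ->
  measurable_fun setT g ->
  nu.-integrable setT (EFin \o g) -> nu.-integrable setT (EFin \o (fun z => g z ^+ 2)) ->
  nu.-integrable setT (EFin \o (fun z => `|g z| ^+ 3)) ->
  \int[nu]_z g z = 0 ->
  `|gstep g f x - (f x + f2 x / 2 * \int[nu]_z (g z ^+ 2))| <= K * \int[nu]_z (`|g z| ^+ 3).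
Proof.
move=> bf tf mg ig ig2 ig3 g0.
have -> : f x + f2 x / 2 * \int[nu]_z (g z ^+ 2) =
    \int[nu]_z (f x + f1 x * g z + f2 x / 2 * g z ^+ 2).
  rewrite RintegralD//; [|apply: integrable_EFinD|exact: integrable_EFinZ]; last 2 first.
  - exact: integrable_prob_cst.
  - exact: integrable_EFinZ.
  rewrite RintegralD//; [|exact: integrable_prob_cst|exact: integrable_EFinZ].
  by rewrite !RintegralZl// g0 mulr0 addr0 Rintegral_prob_cst.
rewrite -RintegralZl//; apply: ler_distB_Rintegral.
- exact: integrable_gstep.
- apply: integrable_EFinD; last exact: integrable_EFinZ.
  by apply: integrable_EFinD; [exact: integrable_prob_cst|exact: integrable_EFinZ].
- exact: integrable_EFinZ.
- move=> z; have := tf x (g z); congr (`|_| <= _); ring.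
Qed.

Lemma taylor3_gstep K f f1 f2 g : bounded_lipschitz f -> bounded_lipschitz f1 ->
  bounded_lipschitz f2 -> measurable_fun setT g -> taylor3 K f f1 f2 ->
  taylor3 K (gstep g f) (gstep g f1) (gstep g f2).
Proof.
move=> bf bf1 bf2 mg tf x h.
have i k (y : R) (bk : bounded_lipschitz k) := integrable_gstep y mg bk.
have -> : gstep g f (x + h) - gstep g f x - gstep g f1 x * h - gstep g f2 x * h ^+ 2 / 2 =
  gstep g f (x + h) - (gstep g f x + h * gstep g f1 x + h ^+ 2 / 2 * gstep g f2 x) by field.
have -> : gstep g f x + h * gstep g f1 x + h ^+ 2 / 2 * gstep g f2 x =
  \int[nu]_z (f (x + g z) + h * f1 (x + g z) + h ^+ 2 / 2 * f2 (x + g z)).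
  rewrite RintegralD//; [|apply: integrable_EFinD|apply: integrable_EFinZ]; last 3 first.
  - exact: i.
  - by apply: integrable_EFinZ; exact: i.
  - exact: i.
  rewrite RintegralD//; [|exact: i|by apply: integrable_EFinZ; exact: i].
  by rewrite !RintegralZl//; exact: i.
rewrite -[leRHS](Rintegral_prob_cst nu); apply: ler_distB_Rintegral.
- exact: integrable_gstep.
- apply: integrable_EFinD; last by apply: integrable_EFinZ; exact: i.
  by apply: integrable_EFinD; [exact: i|by apply: integrable_EFinZ; exact: i].
- exact: integrable_prob_cst.
- move=> z; have := tf (x + g z) h; rewrite [x + h + _]addrAC.
  by congr (`|_| <= _); field.
Qed.

(** The divisor normalises the variance to 1, so weights whose squares sum to 1 give a mixture of
    variance 1. *)
Definition chi_std (z : R) := (z ^+ 2 - 1) / Num.sqrt 2.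

Local Notation sq2 := (Num.sqrt 2 : R).

Lemma sq2_gt0 : 0 < sq2. Proof. by rewrite sqrtr_gt0. Qed.

Lemma measurable_chi_std : measurable_fun setT chi_std.
Proof.
by apply: measurable_funM => //; apply: measurable_funB.
Qed.

Lemma chi_std_norm_le (z : R) n : (n <= 3)%N -> `|chi_std z| ^+ n <= 4 * (1 + z ^+ 6).
Proof.
move=> n3.
have a0 : 0 <= z ^+ 2 by rewrite sqr_ge0.
have c1 : `|chi_std z| <= 1 + z ^+ 2.
  rewrite /chi_std normrM (@ger0_norm _ (sq2^-1)) ?invr_ge0 ?sqrtr_ge0//.
  rewrite (@le_trans _ _ (`|z ^+ 2 - 1|))//.
    rewrite ler_piMr// invf_le1 ?sq2_gt0// -[leLHS]sqrtr1 ler_sqrt//; lra.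
  by rewrite (le_trans (ler_normB _ _))// normr1 ger0_norm// addrC.
have c3 : (1 + z ^+ 2) ^+ 3 <= 4 * (1 + z ^+ 6).
  have -> : z ^+ 6 = (z ^+ 2) ^+ 3 by rewrite -exprM.
  move: a0; set a := z ^+ 2 => a0.
  have -> : 4 * (1 + a ^+ 3) = (1 + a) ^+ 3 + 3 * ((a - 1) ^+ 2 * (a + 1)) by ring.
  rewrite lerDl; apply: mulr_ge0 => //; apply: mulr_ge0; first exact: sqr_ge0.
  exact: addr_ge0.
apply: (le_trans _ c3); apply: (@le_trans _ _ ((1 + z ^+ 2) ^+ n)).
  by rewrite lerXn2r ?nnegrE// addr_ge0.
by rewrite ler_weXn2l// lerDl.
Qed.

Lemma integrable_chi_std_bound :
  nu.-integrable setT (EFin \o (fun z : R => 4 * (1 + z ^+ 6))).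
Proof.
apply: integrable_EFinZ; apply: integrable_EFinD; first exact: integrable_prob_cst.
exact: integrable_normal_pow6.
Qed.

Lemma integrable_chi_std_norm n : (n <= 3)%N ->
  nu.-integrable setT (EFin \o (fun z => `|chi_std z| ^+ n)).
Proof.
move=> n3; apply: (integrable_dominated _ integrable_chi_std_bound).
  apply: measurable_funX; apply: measurableT_comp => //; exact: measurable_chi_std.
by move=> z; rewrite ger0_norm ?exprn_ge0// chi_std_norm_le.
Qed.

Lemma integrable_chi_std : nu.-integrable setT (EFin \o chi_std).
Proof.
have i1 := integrable_chi_std_norm (isT : (1 <= 3)%N).
apply: (integrable_dominated _ i1); first exact: measurable_chi_std.
by move=> z; rewrite expr1.
Qed.

Lemma integrable_chi_std2 : nu.-integrable setT (EFin \o (fun z => chi_std z ^+ 2)).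
Proof.
have := integrable_chi_std_norm (isT : (2 <= 3)%N).
by under eq_fun do rewrite real_normK ?num_real//.
Qed.

Lemma Rintegral_chi_std : \int[nu]_z chi_std z = 0.
Proof.
have i2 := @integrable_normal_pow R 2 isT.
rewrite RintegralZr//; last by apply: integrable_EFinB => //; exact: integrable_prob_cst.
rewrite RintegralB//; last exact: integrable_prob_cst.
by rewrite (@normal_moments24 R).1 Rintegral_prob_cst subrr mul0r.
Qed.

Lemma Rintegral_chi_std2 : \int[nu]_z (chi_std z ^+ 2) = 1.
Proof.
have i2 := @integrable_normal_pow R 2 isT.
have i4 := @integrable_normal_pow R 4 isT.
have s2 : sq2 ^+ 2 = 2 by rewrite sqr_sqrtr.
transitivity (\int[nu]_z (2^-1 * z ^+ 4 - z ^+ 2 + 2^-1)).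
  by apply: eq_Rintegral => z _; rewrite /chi_std exprMn exprVn s2; field.
rewrite RintegralD//; [|apply: integrable_EFinB => //; exact: integrable_EFinZ|
  exact: integrable_prob_cst].
rewrite RintegralB//; last exact: integrable_EFinZ.
by rewrite RintegralZl// (@normal_moments24 R).1 (@normal_moments24 R).2 Rintegral_prob_cst; field.
Qed.

End gaussian_steps.

(** * Mixtures of centred chi-squares: truncation, perturbation, replacement *)

Section chi_mixture.
Context {R : realType}.
Local Notation nu := (@normal_prob R 0 1).
Implicit Types (f g : R -> R) (x h K b : R) (bs : seq R).

(* [chi_mix bs f x] is the expectation of [f (x + \sum_i b_i (Z_i ^+ 2 - 1) / sqrt 2)]
   for independent standard normal [Z_i], written as an iterated integral. *)
Definition chi_mix bs f : R -> R :=
  foldr (fun b k => gstep (fun z => b * chi_std z) k) f bs.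

Lemma measurable_scaled_chi_std b : measurable_fun setT (fun z => b * chi_std z).
Proof. by apply: measurable_funM => //; exact: measurable_chi_std. Qed.

Lemma integrable_scaled_chi_std b :
  nu.-integrable setT (EFin \o (fun z => b * chi_std z)).
Proof. by apply: integrable_EFinZ; exact: integrable_chi_std. Qed.

Lemma integrable_scaled_chi_std2 b :
  nu.-integrable setT (EFin \o (fun z => (b * chi_std z) ^+ 2)).
Proof.
under eq_fun do rewrite exprMn.
by apply: integrable_EFinZ; exact: integrable_chi_std2.
Qed.

Lemma Rintegral_scaled_chi_std b : \int[nu]_z (b * chi_std z) = 0.
Proof. by rewrite RintegralZl ?Rintegral_chi_std ?mulr0//; exact: integrable_chi_std. Qed.

Lemma Rintegral_scaled_chi_std2 b : \int[nu]_z ((b * chi_std z) ^+ 2) = b ^+ 2.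
Proof.
under eq_Rintegral do rewrite exprMn.
by rewrite RintegralZl ?Rintegral_chi_std2 ?mulr1//; exact: integrable_chi_std2.
Qed.

Lemma bounded_lipschitz_chi_mix bs f : bounded_lipschitz f ->
  bounded_lipschitz (chi_mix bs f).
Proof.
move=> bf; elim: bs => //= b bs ih.
by apply: bounded_lipschitz_gstep => //; exact: measurable_scaled_chi_std.
Qed.

Lemma chi_mix_cat bs1 bs2 f : chi_mix (bs1 ++ bs2) f = chi_mix bs1 (chi_mix bs2 f).
Proof. by rewrite /chi_mix foldr_cat. Qed.

Lemma ler_dist_chi_mix bs f f' x e : bounded_lipschitz f -> bounded_lipschitz f' ->
  (forall y, `|f y - f' y| <= e) -> `|chi_mix bs f x - chi_mix bs f' x| <= e.
Proof.
move=> bf bf' ff'; elim: bs x => //= b bs ih x.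
apply: ler_dist_gstep => //; first exact: measurable_scaled_chi_std.
all: exact: bounded_lipschitz_chi_mix.
Qed.

(** Each step is centred, so it costs only its variance. The costs add because averaging does not
    enlarge a uniform distance. This bounds the price of discarding a tail of weights. *)
Lemma chi_mix_taylor2 bs K f f1 x : bounded_lipschitz f -> taylor2 K f f1 ->
  `|chi_mix bs f x - f x| <= K * \sum_(b <- bs) b ^+ 2.
Proof.
move=> bf tf; elim: bs x => [|b bs ih] x /=.
  by rewrite big_nil subrr normr0 mulr0.
have mb := measurable_scaled_chi_std b.
rewrite big_cons mulrDr.
set A := gstep _ _ _; set B := gstep (fun z => b * chi_std z) f x.
have -> : A - f x = (B - f x) + (A - B) by ring.
apply: (le_trans (ler_normD _ _)); apply: lerD.
  rewrite -(Rintegral_scaled_chi_std2 b); apply: taylor2_gstep (tf) _ _ _ _ => //.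
  - exact: integrable_scaled_chi_std.
  - exact: integrable_scaled_chi_std2.
  - exact: Rintegral_scaled_chi_std.
by apply: ler_dist_gstep => //; exact: bounded_lipschitz_chi_mix.
Qed.

Lemma gstep_lipschitz g f L : measurable_fun setT g -> bounded_lipschitz f ->
  (forall x y, `|f x - f y| <= L * `|x - y|) ->
  forall x y, `|gstep g f x - gstep g f y| <= L * `|x - y|.
Proof.
move=> mg bf fL x y.
rewrite -[leRHS](Rintegral_prob_cst nu); apply: ler_distB_Rintegral => //.
- exact: integrable_gstep.
- exact: integrable_gstep.
- exact: integrable_prob_cst.
- move=> z; apply: (le_trans (fL _ _)).
  by rewrite (_ : x + g z - (y + g z) = x - y)//; ring.
Qed.

Lemma chi_mix_lipschitz bs f L : bounded_lipschitz f ->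
  (forall x y, `|f x - f y| <= L * `|x - y|) ->
  forall x y, `|chi_mix bs f x - chi_mix bs f y| <= L * `|x - y|.
Proof.
move=> bf fL; elim: bs => //= b bs ih.
apply: gstep_lipschitz => //; first exact: measurable_scaled_chi_std.
exact: bounded_lipschitz_chi_mix.
Qed.

(** The weights are changed one at a time; the Lipschitz constant of the remaining mixture is still
    [L], whatever its length. *)
Lemma chi_mix_coef_dist (I : Type) (r : seq I) (b c : I -> R) f L x :
  bounded_lipschitz f -> (forall x y, `|f x - f y| <= L * `|x - y|) ->
  `|chi_mix [seq b i | i <- r] f x - chi_mix [seq c i | i <- r] f x| <=
  L * \int[nu]_z `|chi_std z| * \sum_(i <- r) `|b i - c i|.
Proof.
move=> bf fL; elim: r x => [|i r ih] x /=.
  by rewrite big_nil subrr normr0 mulr0.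
have bk e := bounded_lipschitz_chi_mix [seq e i | i <- r] bf.
set A := gstep _ _ _; set B := gstep _ _ _.
pose C := gstep (fun z => b i * chi_std z) (chi_mix [seq c i | i <- r] f) x.
have -> : A - B = (C - B) + (A - C) by ring.
rewrite big_cons mulrDr; apply: (le_trans (ler_normD _ _)); apply: lerD; last first.
  by apply: ler_dist_gstep => //; exact: measurable_scaled_chi_std.
have i1 : nu.-integrable setT (EFin \o (fun z : R => `|chi_std z|)).
  by have := @integrable_chi_std_norm R 1 isT; under eq_fun do rewrite expr1.
have -> : L * \int[nu]_z `|chi_std z| * `|b i - c i| =
    \int[nu]_z (L * `|b i - c i| * `|chi_std z|) by rewrite RintegralZl//; ring.
apply: ler_distB_Rintegral.
- by apply: integrable_gstep => //; exact: measurable_scaled_chi_std.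
- by apply: integrable_gstep => //; exact: measurable_scaled_chi_std.
- exact: integrable_EFinZ.
- move=> z; apply: (le_trans (chi_mix_lipschitz _ bf fL _ _)).
  rewrite (_ : x + _ - _ = (b i - c i) * chi_std z); last by ring.
  by rewrite normrM mulrA.
Qed.

Definition nstep (t : R) f := gstep (fun z => t * z) f.

Lemma measurable_scale (t : R) : measurable_fun setT (fun z : R => t * z).
Proof. exact: measurable_funM. Qed.

Lemma nstep_nstep b c f x : 0 <= b -> 0 <= c -> bounded_lipschitz f ->
  nstep b (nstep c f) x = nstep (Num.sqrt (b ^+ 2 + c ^+ 2)) f x.
Proof.
move=> b0 c0 bf.
have cf : continuous (fun y => f (x + y)).
  move=> y; apply: (@continuous_comp _ _ _ (fun y : R => x + y) f).
    by apply: cvgD; [exact: cvg_cst|exact: cvg_id].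
  exact: bounded_lipschitz_continuous.
case: bf => M [L [fM _]].
rewrite /nstep /gstep -(Rintegral_normal_conv b0 c0 cf (fun y => fM (x + y))).
by apply: eq_Rintegral => z _; apply: eq_Rintegral => w _; rewrite addrA.
Qed.

Lemma integrable_scaled_pow (t : R) n : (n <= 6)%N ->
  nu.-integrable setT (EFin \o (fun z : R => (t * z) ^+ n)).
Proof.
move=> n6; under eq_fun do rewrite exprMn.
by apply: integrable_EFinZ; exact: integrable_normal_pow.
Qed.

Lemma integrable_normal_norm3 : nu.-integrable setT (EFin \o (fun z : R => `|z| ^+ 3)).
Proof.
have i := integrable_EFinD (integrable_prob_cst nu 1) (@integrable_normal_pow6 R).
apply: (integrable_dominated _ i) => [|z].
  by apply: measurable_funX; exact: normr_measurable.
by rewrite ger0_norm ?exprn_ge0// -normrX; exact: norm_pow_le6.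
Qed.

Lemma Rintegral_normal_id : \int[nu]_z z = 0 :> R.
Proof.
have i := @integrable_normal_pow R 1 isT.
have i' : nu.-integrable setT (EFin \o (fun z : R => z)).
  by move: i; under eq_fun do rewrite expr1.
have ia : nu.-integrable setT (EFin \o (fun z : R => `|z|)).
  apply: (integrable_dominated _ (integrable_EFinD (integrable_prob_cst nu 1)
    (@integrable_normal_pow6 R))); first exact: normr_measurable.
  by move=> z; rewrite normr_id -(expr1 z); exact: norm_pow_le6.
(* The available symmetry is for nonnegative functions, hence the detour through [|z| + z]. *)
have cf : continuous (fun z : R => `|z| + z).
  by move=> z; apply: cvgD; [exact: norm_continuous|exact: cvg_id].
have f0 z : 0 <= `|z| + z :> R by have := ler_norm (- z); rewrite normrN; lra.
have : \int[nu]_z (`|z| - z) = \int[nu]_z (`|z| + z).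
  rewrite [RHS]/Rintegral -(ge0_integral_normal_opp cf f0).
  by congr fine; apply: eq_integral => z _; rewrite normrN.
by rewrite RintegralB// RintegralD//; lra.
Qed.

(** The tail is replaced first. Its normal steps merge into a single one, of standard deviation [u],
    by the convolution formula, and [nstep u f] satisfies the same expansion as [f] with the same
    [K]. The error per weight is thus uniform in the length of the list. *)
Lemma lindeberg_chi_mix bs K f f1 f2 : 0 <= K -> all (fun b => 0 <= b) bs ->
  bounded_lipschitz f -> bounded_lipschitz f1 -> bounded_lipschitz f2 ->
  taylor3 K f f1 f2 -> forall t x, 0 <= t ->
  `|chi_mix bs (nstep t f) x - nstep (Num.sqrt (\sum_(b <- bs) b ^+ 2 + t ^+ 2)) f x| <=
  K * (\int[nu]_z (`|chi_std z| ^+ 3) + \int[nu]_z (`|z| ^+ 3)) * \sum_(b <- bs) b ^+ 3.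
Proof.
move=> K0 + bf bf1 bf2 tf t + t0.
set C := (_ + \int[nu]_z _); elim: bs => [|b bs ih] /=.
  by move=> _ x; rewrite !big_nil add0r sqrtr_sqr (ger0_norm t0) subrr normr0 mulr0.
move=> /andP[b0 bs0] x; rewrite !big_cons.
set S := \sum_(j <- bs) j ^+ 2.
have S0 : 0 <= S by apply: sumr_ge0 => i _; exact: sqr_ge0.
pose u := Num.sqrt (S + t ^+ 2).
have u0 : 0 <= u by exact: sqrtr_ge0.
have mb := measurable_scaled_chi_std b.
have mn s := measurable_scale s.
have bn s k (bk : bounded_lipschitz k) := bounded_lipschitz_gstep (mn s) bk.
have uE : Num.sqrt (b ^+ 2 + S + t ^+ 2) = Num.sqrt (b ^+ 2 + u ^+ 2).
  by rewrite sqr_sqrtr ?addr_ge0 ?sqr_ge0// addrA.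
rewrite uE -(nstep_nstep _ b0 u0 bf).
set A := gstep _ _ _; set B := nstep b _ _.
(* The hybrid in which the tail is already Gaussian and the head is still a centred chi-square. *)
pose D := gstep (fun z => b * chi_std z) (nstep u f) x.
have -> : A - B = (D - B) + (A - D) by ring.
rewrite mulrDr; apply: (le_trans (ler_normD _ _)); apply: lerD; last first.
  apply: ler_dist_gstep => //; last by move=> y; exact: ih.
    by apply: bounded_lipschitz_chi_mix; exact: bn.
  exact: bn.
have tu : taylor3 K (nstep u f) (nstep u f1) (nstep u f2) by exact: taylor3_gstep.
have i3 := @integrable_chi_std_norm R 3 isT.
have eA := taylor3_gstep_approx x (bn u f bf) tu mb (integrable_scaled_chi_std b)
  (integrable_scaled_chi_std2 b) _ (Rintegral_scaled_chi_std b).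
have ib : nu.-integrable setT (EFin \o (fun z : R => b * z)).
  by have := integrable_scaled_pow b (isT : (1 <= 6)%N); under eq_fun do rewrite expr1.
have b3 z : `|b * z| ^+ 3 = b ^+ 3 * `|z| ^+ 3 by rewrite normrM exprMn (ger0_norm b0).
have eB := taylor3_gstep_approx x (bn u f bf) tu (mn b) ib
  (integrable_scaled_pow b (isT : (2 <= 6)%N)) _ _.
rewrite Rintegral_scaled_chi_std2 in eA.
have sq : \int[nu]_z ((b * z) ^+ 2) = b ^+ 2.
  under eq_Rintegral do rewrite exprMn.
  rewrite RintegralZl// ?(@normal_moments24 R).1 ?mulr1//.
  exact: integrable_normal_pow.
rewrite sq in eB.
have eA3 : \int[nu]_z (`|b * chi_std z| ^+ 3) = b ^+ 3 * \int[nu]_z (`|chi_std z| ^+ 3).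
  under eq_Rintegral do rewrite b3.
  by rewrite RintegralZl.
have eB3 : \int[nu]_z (`|b * z| ^+ 3) = b ^+ 3 * \int[nu]_z (`|z| ^+ 3).
  under eq_Rintegral do rewrite b3.
  by rewrite RintegralZl//; exact: integrable_normal_norm3.
rewrite eA3 in eA; rewrite eB3 in eB.
(* The second-order expansion shared by both kinds of step, which have mean 0 and variance
   [b ^+ 2]. *)
set W := nstep u f x + nstep u f2 x / 2 * b ^+ 2 in eA eB.
have -> : D - B = (D - W) - (B - W) by ring.
apply: (le_trans (ler_normB _ _)).
have -> : K * C * b ^+ 3 = K * (b ^+ 3 * \int[nu]_z (`|chi_std z| ^+ 3)) +
   K * (b ^+ 3 * \int[nu]_z (`|z| ^+ 3)) by rewrite /C; ring.
apply: lerD.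
  apply: eA; under eq_fun do rewrite b3; exact: integrable_EFinZ.
apply: eB.
  by under eq_fun do rewrite b3; apply: integrable_EFinZ; exact: integrable_normal_norm3.
rewrite RintegralZl ?Rintegral_normal_id ?mulr0//.
by have := @integrable_normal_pow R 1 isT; under eq_fun do rewrite expr1.
Qed.

End chi_mixture.

(** * Logistic test functions *)

Section logistic.
Context {R : realType}.
Implicit Types (p q : R -> R) (x h m a : R).

Lemma is_derive_shift p x h dp : is_derive (x + h) (1 : R) p dp ->
  is_derive h (1 : R) (fun h => p (x + h)) dp.
Proof.
move=> pd.
have dS : is_derive h (1 : R) (fun h : R => x + h) 1.
  have dc : is_derive h (1 : R) (fun=> x) 0 by exact: is_derive_cst.
  by have := is_deriveD dc (is_derive_id h 1); rewrite add0r.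
by have := is_derive1_comp (f := p) pd dS; rewrite mulr1.
Qed.

Lemma lipschitz_of_derive p q C : (forall h, is_derive h (1 : R) p (q h)) ->
  (forall h, `|q h| <= C) -> forall x y, `|p x - p y| <= C * `|x - y|.
Proof.
move=> pq qC x y.
have h0 h : is_derive h (1 : R) (fun h => p (y + h) - p y) (q (y + h)).
  have dc : is_derive h (1 : R) (fun=> p y) 0 by exact: is_derive_cst.
  by have := is_deriveB (is_derive_shift (pq (y + h))) dc; rewrite subr0.
have := derive_growth h0 _ (n := 0) (C := C) _ (x - y); rewrite subrKC expr1; apply.
  by rewrite addr0 subrr.
by move=> h; rewrite expr0 mulr1.
Qed.

(** Decreasing, so that steep copies approximate indicators of left half-lines. Its derivatives are
    polynomials in the function itself, which bounds them all since its values lie in [(0, 1)]. *)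
Definition logistic x := (1 + expR x)^-1.
Local Notation g := logistic.
Let g1 x := g x ^+ 2 - g x.
Let g2 x := (2 * g x - 1) * g1 x.
Let g3 x := 2 * g1 x ^+ 2 + (2 * g x - 1) * g2 x.

Lemma logistic_gt0 x : 0 < g x.
Proof. by rewrite invr_gt0 ltr_pwDl// expR_ge0. Qed.

Lemma logistic_lt1 x : g x < 1.
Proof. by rewrite invf_lt1 ?ltrDl ?expR_gt0// ltr_pwDl// expR_ge0. Qed.

Let dg x : is_derive x (1 : R) g (g1 x).
Proof.
have e0 : 1 + expR x != 0 by rewrite gt_eqF// ltr_pwDl// expR_ge0.
have dc : is_derive x (1 : R) (fun=> 1 : R) 0 by exact: is_derive_cst.
have dE : is_derive x (1 : R) (fun x => 1 + expR x) (expR x).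
  by have := is_deriveD dc (is_derive_expR x); rewrite add0r.
apply: (is_derive_eq (is_deriveV (f := fun x => 1 + expR x) e0 dE)).
rewrite /g1 /logistic /GRing.scale/=; field.
exact: e0.
Qed.

Let dg1 x : is_derive x (1 : R) g1 (g2 x).
Proof.
apply: (is_derive_eq (is_deriveB (is_deriveX 2 (dg x)) (dg x))).
by rewrite /g2 /GRing.scale/= expr1; ring.
Qed.

Let dg2 x : is_derive x (1 : R) g2 (g3 x).
Proof.
have dc : is_derive x (1 : R) (fun=> 1 : R) 0 by exact: is_derive_cst.
have d2g : is_derive x (1 : R) (fun x => 2 * g x - 1) (2 * g1 x).
  by have := is_deriveB (is_deriveZ 2 (dg x)) dc; rewrite subr0.
apply: (is_derive_eq (is_deriveM d2g (dg1 x))).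
by rewrite /g3 /g2 /GRing.scale/=; ring.
Qed.

Let g_bound x : `|g x| <= 1.
Proof. by rewrite ger0_norm ?ltW ?logistic_gt0 ?logistic_lt1. Qed.

Let g1_bound x : `|g1 x| <= 1.
Proof.
have := logistic_gt0 x; have := logistic_lt1 x; rewrite /g1 => g1' g0.
by rewrite ler_norml; apply/andP; split; nra.
Qed.

Let g21_bound x : `|2 * g x - 1| <= 1.
Proof.
have := logistic_gt0 x; have := logistic_lt1 x => g1' g0.
by rewrite ler_norml; apply/andP; split; lra.
Qed.

Let g2_bound x : `|g2 x| <= 1.
Proof. by rewrite /g2 normrM mulr_ile1// ?g21_bound ?g1_bound. Qed.

Let g3_bound x : `|g3 x| <= 3.
Proof.
rewrite /g3 (_ : 3 = 2 + 1 :> R); last by ring.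
apply: (le_trans (ler_normD _ _)); apply: lerD.
  by rewrite normrM normrX ger0_norm// ler_piMr// exprn_ile1// g1_bound.
by rewrite normrM mulr_ile1// ?g21_bound ?g2_bound.
Qed.

Definition logit_test m a x := g (m * (x - a)).

Let scaled_bl (p : R -> R) (C D k m a : R) : (forall x, `|p x| <= C) ->
  (forall x y, `|p x - p y| <= D * `|x - y|) ->
  bounded_lipschitz (fun x => k * p (m * (x - a))).
Proof.
move=> pC pD; exists (`|k| * C), (`|k| * (D * `|m|)); split => [x|x y].
  by rewrite normrM ler_wpM2l.
rewrite -mulrBr normrM -!mulrA ler_wpM2l// (le_trans (pD _ _))//.
rewrite -normrM (_ : m * (x - a) - m * (y - a) = m * (x - y)); last by ring.
by [].
Qed.

Lemma logit_test_lipschitz m a : 0 <= m -> forall x y,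
  `|logit_test m a x - logit_test m a y| <= m * `|x - y|.
Proof.
move=> m0 x y; rewrite /logit_test.
apply: (le_trans (lipschitz_of_derive dg g1_bound _ _)).
rewrite (_ : m * (x - a) - m * (y - a) = m * (x - y)); last by ring.
by rewrite mul1r normrM (ger0_norm m0).
Qed.

Lemma logit_test_bounded_lipschitz m a : bounded_lipschitz (logit_test m a).
Proof.
have := scaled_bl 1 m a g_bound (lipschitz_of_derive dg g1_bound).
by under eq_fun do rewrite mul1r.
Qed.

Lemma logit_test_taylor2 m a : exists f1, taylor2 (m ^+ 2) (logit_test m a) f1.
Proof.
exists (fun x => m * g1 (m * (x - a))) => x h.
set y := m * (x - a).
have d0 k : is_derive k (1 : R) (fun k => g (y + k) - g y - g1 y * k) (g1 (y + k) - g1 y).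
  have dc : is_derive k (1 : R) (fun=> g y) 0 by exact: is_derive_cst.
  have dl : is_derive k (1 : R) (fun k => g1 y * k) (g1 y).
    by have := is_deriveZ (g1 y) (is_derive_id k 1); rewrite /GRing.scale/= mulr1.
  by have := is_deriveB (is_deriveB (is_derive_shift (dg (y + k))) dc) dl; rewrite subr0.
have := derive_growth d0 _ (n := 1) (C := 1) _ (m * h).
rewrite /logit_test (_ : m * (x + h - a) = y + m * h); last by rewrite /y; ring.
rewrite -/y (_ : g1 y * (m * h) = m * g1 y * h); last by ring.
rewrite mul1r real_normK ?num_real// exprMn; apply.
  by rewrite addr0 mulr0 subrr subr0.
move=> k; rewrite expr1; have := lipschitz_of_derive dg1 g2_bound (y + k) y.
by rewrite [y + k - y]addrAC subrr add0r.
Qed.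

(** The constant is the bound 3 on the third derivative of [logistic] times the factor [|m| ^+ 3] of
    the chain rule. *)
Lemma logit_test_taylor3 m a : exists f1 f2, [/\ bounded_lipschitz f1,
  bounded_lipschitz f2 & taylor3 (3 * `|m| ^+ 3) (logit_test m a) f1 f2].
Proof.
exists (fun x => m * g1 (m * (x - a))), (fun x => m ^+ 2 * g2 (m * (x - a))); split.
- exact: scaled_bl g1_bound (lipschitz_of_derive dg1 g2_bound).
- exact: scaled_bl g2_bound (lipschitz_of_derive dg2 g3_bound).
move=> x h; set y := m * (x - a).
have did (k : R) : is_derive k (1 : R) (fun k => k) 1 by exact: is_derive_id.
have dc (c k : R) : is_derive k (1 : R) (fun=> c) 0 by exact: is_derive_cst.
have dl c (k : R) : is_derive k (1 : R) (fun k => c * k) c.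
  by have := is_deriveZ c (did k); rewrite /GRing.scale/= mulr1.
have dsq c (k : R) : is_derive k (1 : R) (fun k => c * k ^+ 2 / 2) (c * k).
  have := is_deriveZ (c / 2) (is_deriveX 2 (did k)).
  have -> : (c / 2) \*: ((fun k : R => k) ^+ 2) = (fun k => c * k ^+ 2 / 2).
    by apply/funext => j; rewrite -[LHS]/(c / 2 * j ^+ 2); ring.
  by move=> e; apply: (is_derive_eq e); rewrite /GRing.scale/= expr1; field.
have d1 k : is_derive k (1 : R) (fun k => g1 (y + k) - g1 y - g2 y * k) (g2 (y + k) - g2 y).
  by have := is_deriveB (is_deriveB (is_derive_shift (dg1 (y + k))) (dc (g1 y) k)) (dl (g2 y) k); rewrite subr0.
have d0 k : is_derive k (1 : R) (fun k => g (y + k) - g y - g1 y * k - g2 y * k ^+ 2 / 2)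
   (g1 (y + k) - g1 y - g2 y * k).
  by have := is_deriveB (is_deriveB (is_deriveB (is_derive_shift (dg (y + k)))
    (dc (g y) k)) (dl (g1 y) k)) (dsq (g2 y) k); rewrite subr0.
have := derive_growth d0 _ (n := 2) (C := 3) _ (m * h).
rewrite /logit_test (_ : m * (x + h - a) = y + m * h); last by rewrite /y; ring.
rewrite -/y (_ : g1 y * (m * h) = m * g1 y * h); last by ring.
rewrite (_ : g2 y * (m * h) ^+ 2 / 2 = m ^+ 2 * g2 y * h ^+ 2 / 2); last by ring.
rewrite normrM exprMn -[X in _ -> _ <= X]mulrA; apply.
  by rewrite addr0 expr0n/= !mulr0 mul0r !subr0 subrr.
apply: derive_growth d1 _ _; first by rewrite addr0 mulr0 subr0 subrr.
move=> k; rewrite expr1; have := lipschitz_of_derive dg2 g3_bound (y + k) y.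
by rewrite [y + k - y]addrAC subrr add0r.
Qed.

End logistic.

(** * Logistic expectations recovered from a Laplace transform *)

Section laplace_determines.
Context {R : realType}.
Local Notation nu := (@normal_prob R 0 1).
Local Notation sq2 := (Num.sqrt 2 : R).
Implicit Types (m a x u : R) (c : nat -> R) (bs : seq R) (n : nat).

Lemma expR_chi_stdE u (z : R) :
  expR (- (u * chi_std z)) = expR (u / sq2) * expR (- (sq2 * u * z ^+ 2 / 2)).
Proof.
have s0 : sq2 != 0 by rewrite gt_eqF// sq2_gt0.
have s2 : sq2 ^+ 2 = 2 by rewrite sqr_sqrtr.
rewrite -expRD /chi_std; congr expR.
have -> : sq2 * u * z ^+ 2 / 2 = u * z ^+ 2 / sq2 by rewrite -[X in _ / X = _]s2; field.
by field.
Qed.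

Lemma sq2_mul_gtN1 u : 0 <= u -> -1 < sq2 * u.
Proof. by move=> u0; apply: lt_le_trans (mulr_ge0 (ltW (@sq2_gt0 R)) u0); lra. Qed.

Lemma integrable_expR_chi_std u : 0 <= u ->
  nu.-integrable setT (EFin \o (fun z => expR (- (u * chi_std z)))).
Proof.
move=> u0; under eq_fun do rewrite expR_chi_stdE.
by apply: integrable_EFinZ; apply: integrable_normal_expR; exact: sq2_mul_gtN1.
Qed.

Lemma Rintegral_expR_chi_std u : 0 <= u ->
  \int[nu]_z expR (- (u * chi_std z)) = expR (u / sq2) * (Num.sqrt (1 + sq2 * u))^-1.
Proof.
move=> u0; under eq_Rintegral do rewrite expR_chi_stdE.
have u1 := sq2_mul_gtN1 u0.
by rewrite RintegralZl ?Rintegral_normal_expR//; exact: integrable_normal_expR.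
Qed.

(** The Laplace transform at [u] of the sum of independent [b * chi_std Z], with [b] running over
    [bs]. *)
Definition chi_laplace bs u :=
  \prod_(b <- bs) (expR (u * b / sq2) * (Num.sqrt (1 + sq2 * (u * b)))^-1).

(** A polynomial in [expR (- (m * x))]: its expectation involves only Laplace transforms at
    multiples of [m]. *)
Definition exp_sum m n c x := \sum_(j < n) c j * expR (- (m * j%:R * x)).

Lemma integrable_exp_sum_chi_std m n c x b : 0 <= m -> 0 <= b ->
  nu.-integrable setT (EFin \o (fun z => exp_sum m n c (x + b * chi_std z))).
Proof.
move=> m0 b0; apply: integrable_EFin_sum => j; apply: integrable_EFinZ.
have -> : (fun z => expR (- (m * j%:R * (x + b * chi_std z)))) =
    (fun z => expR (- (m * j%:R * x)) * expR (- (m * j%:R * b * chi_std z))).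
  by apply/funext => z; rewrite -expRD; congr expR; ring.
by apply: integrable_EFinZ; apply: integrable_expR_chi_std; rewrite !mulr_ge0.
Qed.

Lemma gstep_exp_sum m n c x b : 0 <= m -> 0 <= b ->
  gstep (fun z => b * chi_std z) (exp_sum m n c) x =
  exp_sum m n (fun j => c j * (expR (m * j%:R * b / sq2) *
    (Num.sqrt (1 + sq2 * (m * j%:R * b)))^-1)) x.
Proof.
move=> m0 b0; have mjb (j : nat) : 0 <= m * j%:R * b by rewrite !mulr_ge0.
have fE j : (fun z => c j * expR (- (m * j%:R * (x + b * chi_std z)))) =
    (fun z => c j * expR (- (m * j%:R * x)) * expR (- (m * j%:R * b * chi_std z))).
  by apply/funext => z; rewrite -[RHS]mulrA -expRD; congr (_ * expR _); ring.
have i (j : nat) : nu.-integrable setT (EFin \o (fun z => c j * expR (- (m * j%:R * (x + b * chi_std z))))).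
  by rewrite fE; apply: integrable_EFinZ; exact: integrable_expR_chi_std.
rewrite /gstep /exp_sum Rintegral_sum; last by move=> j; exact: i.
apply: eq_bigr => j _; rewrite fE RintegralZl//; last exact: integrable_expR_chi_std.
by rewrite Rintegral_expR_chi_std//; ring.
Qed.

Lemma chi_mix_exp_sum m n c bs x : 0 <= m -> all (fun b => 0 <= b) bs ->
  chi_mix bs (exp_sum m n c) x =
  exp_sum m n (fun j => c j * chi_laplace bs (m * j%:R)) x.
Proof.
move=> m0; elim: bs x => [|b bs ih] x /=.
  by move=> _; apply: eq_bigr => j _; rewrite /chi_laplace big_nil mulr1.
move=> /andP[b0 bs0].
rewrite (_ : chi_mix bs _ = exp_sum m n (fun j => c j * chi_laplace bs (m * j%:R))).
  rewrite gstep_exp_sum//; apply: eq_bigr => j _; rewrite /chi_laplace big_cons.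
  by congr (_ * _); ring.
by apply/funext => y; exact: ih.
Qed.

(** Since [chi_std] is at least [- 1 / sqrt 2], a mixture started at [x] never goes below
    [x - sum b / sqrt 2]. Exponential sums may be unbounded to the left, and closeness is required
    only on this half-line. *)
Lemma chi_mix_exp_sum_dist m n c bs x f e : 0 <= m -> all (fun b => 0 <= b) bs ->
  bounded_lipschitz f ->
  (forall y, x - \sum_(b <- bs) b / sq2 <= y -> `|f y - exp_sum m n c y| <= e) ->
  `|chi_mix bs f x - chi_mix bs (exp_sum m n c) x| <= e.
Proof.
move=> m0 + bf; elim: bs x => [|b bs ih] x /=.
  by move=> _; apply; rewrite big_nil subr0.
move=> /andP[b0 bs0] fe.
rewrite -[leRHS](Rintegral_prob_cst nu); apply: ler_distB_Rintegral.
- apply: integrable_gstep; first exact: measurable_scaled_chi_std.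
  exact: bounded_lipschitz_chi_mix.
- rewrite (_ : chi_mix bs (exp_sum m n c) =
    exp_sum m n (fun j => c j * chi_laplace bs (m * j%:R))).
    exact: integrable_exp_sum_chi_std.
  by apply/funext => y; exact: chi_mix_exp_sum.
- exact: integrable_prob_cst.
move=> z; apply: ih => // y xy; apply: fe; apply: le_trans xy.
rewrite big_cons opprD addrA lerD2r lerD2l -mulrN ler_wpM2l//.
by rewrite /chi_std mulrBl mul1r lerBrDr addNr divr_ge0 ?sqr_ge0// ltW// sq2_gt0.
Qed.

(* With [v = exp (- m y)], [v0 = exp (- m x)], [k = exp (- m a)] the test function is
   [v / (v + k)]; expand [1 / (v + k) = 1 / ((v0 + k) - (v0 - v))] as a geometric series. *)
Lemma exp_sum_approx m a x e : 0 < m -> 0 < e -> exists n c, forall y, x <= y ->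
  `|logit_test m a y - exp_sum m n c y| <= e.
Proof.
move=> m0 e0.
pose v0 := expR (- (m * x)); pose k := expR (- (m * a)).
have v00 : 0 < v0 by exact: expR_gt0.
have k0 : 0 < k by exact: expR_gt0.
have vk0 : 0 < v0 + k by rewrite addr_gt0.
(* A bound on the ratio [(v0 - v) / (v0 + k)] valid for all [0 < v <= v0], that is, for all
   [y >= x]. *)
pose r := v0 / (v0 + k).
have r1 : `|r| < 1 by rewrite gtr0_norm ?divr_gt0// ltr_pdivrMr// mul1r ltrDl.
have [J Je] : exists J, r ^+ J <= e.
  have : (fun n => r ^+ n) @ \oo --> (0 : R) by exact: cvg_expr.
  move=> /(cvgr_le (0 : R))/(_ _ e0)[J _ /(_ J (leqnn _))].
  by exists J.
pose p : {poly R} := \sum_(i < J) ((v0 + k) ^- i.+1) *: ('X * (v0%:P - 'X) ^+ i).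
exists (size p), (fun j => p`_j) => y xy.
pose v := expR (- (m * y)).
have v_gt0 : 0 < v by exact: expR_gt0.
have vv0 : v <= v0 by rewrite ler_expR lerN2 ler_pM2l.
have vkn : v + k != 0 by rewrite gt_eqF// addr_gt0.
have -> : exp_sum m (size p) (fun j => p`_j) y = p.[v].
  rewrite horner_coef; apply: eq_bigr => j _; congr (_ * _).
  by rewrite /v -expRM_natl; congr expR; ring.
have -> : logit_test m a y = v / (v + k).
  rewrite /logit_test /logistic.
  have -> : expR (m * (y - a)) = k / v.
    by rewrite /k /v -expRN -expRD; congr expR; ring.
  by field; rewrite !gt_eqF ?addr_gt0.
pose w := (v0 - v) / (v0 + k).
have w01 : 0 <= w <= r.
  rewrite /w divr_ge0 ?subr_ge0// ?(ltW vk0)//=.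
  by rewrite ler_pM2r ?invr_gt0// gerBl ltW.
(* The exact remainder of the geometric series after [J] terms. *)
have key : v / (v + k) - p.[v] = v / (v + k) * w ^+ J.
  rewrite /p; elim: J {p Je} => [|J ih].
    by rewrite big_ord0 horner0 subr0 expr0 mulr1.
  rewrite big_ord_recr/= hornerD opprD addrA ih.
  rewrite hornerZ hornerM hornerX horner_exp hornerD hornerN hornerX hornerC.
  have -> : (v0 - v) ^+ J = w ^+ J * (v0 + k) ^+ J.
    by rewrite /w -exprMn divfK// gt_eqF.
  have vkn0 : v0 + k != 0 by rewrite gt_eqF.
  rewrite [w ^+ J.+1]exprS; set W := w ^+ J; clearbody W.
  have -> : (v0 + k) ^- J.+1 * (v * (W * (v0 + k) ^+ J)) = v * W / (v0 + k).
    by rewrite exprS; field; rewrite vkn0 expf_neq0.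
  by rewrite /w; field; rewrite vkn vkn0.
rewrite key normrM (@le_trans _ _ (r ^+ J))//.
have [w0 wr] := andP w01.
rewrite (ger0_norm (exprn_ge0 J w0)) (@le_trans _ _ (w ^+ J))//.
  rewrite ler_piMl ?exprn_ge0// ger0_norm ?divr_ge0 ?ltW ?addr_gt0//.
  by rewrite ltr_pdivrMr ?addr_gt0// mul1r ltrDl.
by rewrite lerXn2r// nnegrE// (le_trans w0).
Qed.

(** Both [V - c0] and the mixture live on the half-line from [- c0]. One exponential sum
    approximates the test function there, and its two expectations coincide by the Laplace
    identity. *)
Lemma chi_mix_of_laplace d (T : measurableType d) (P : probability T R) (V : T -> R)
    bs m a : 0 < m -> all (fun b => 0 <= b) bs ->
  measurable_fun setT V -> (forall w, 0 <= V w) ->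
  (forall t, 0 <= t -> \int[P]_w expR (- (t * V w)) =
     \prod_(b <- bs) (Num.sqrt (1 + sq2 * (t * b)))^-1) ->
  \int[P]_w logit_test m a (V w - \sum_(b <- bs) b / sq2) =
  chi_mix bs (logit_test m a) 0.
Proof.
move=> m0 bs0 mV V0 lapV.
set c0 := \sum_(b <- bs) b / sq2; set f := logit_test m a.
have bf : bounded_lipschitz f by exact: logit_test_bounded_lipschitz.
have mf := bounded_lipschitz_measurable bf.
apply/eqP; rewrite -subr_eq0 -normr_le0; apply/ler_addgt0Pr => e e0; rewrite add0r.
have e20 : 0 < e / 2 by rewrite divr_gt0.
have [n [c fe]] := exp_sum_approx a (- c0) m0 e20.
have iE (j : nat) : P.-integrable setT (EFin \o (fun w => expR (- (m * j%:R * V w)))).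
  apply: (@bounded_integrable _ _ _ P 1).
    apply: measurableT_comp => //; apply: measurableT_comp => //; exact: measurable_funM.
  move=> w; rewrite ger0_norm ?expR_ge0// -expR0 ler_expR oppr_le0.
  by rewrite !mulr_ge0// ltW.
have qE : (fun w => exp_sum m n c (V w - c0)) = (fun w => \sum_(j < n)
    (c j * expR (m * j%:R * c0)) * expR (- (m * j%:R * V w))).
  apply/funext => w; apply: eq_bigr => j _; rewrite -[RHS]mulrA -expRD.
  by congr (_ * expR _); ring.
have iq : P.-integrable setT (EFin \o (fun w => exp_sum m n c (V w - c0))).
  by rewrite qE; apply: integrable_EFin_sum => j; apply: integrable_EFinZ.
have Eq : \int[P]_w exp_sum m n c (V w - c0) = chi_mix bs (exp_sum m n c) 0.
  rewrite qE Rintegral_sum; last by move=> j; apply: integrable_EFinZ.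
  rewrite chi_mix_exp_sum ?ltW//; apply: eq_bigr => j _.
  have mj : 0 <= m * j%:R by rewrite mulr_ge0// ltW.
  rewrite mulr0 oppr0 expR0 mulr1 RintegralZl// (lapV _ mj) -mulrA.
  congr (_ * _); rewrite /chi_laplace big_split/=; congr (_ * _).
  by rewrite -expR_sum mulr_sumr; congr expR; apply: eq_bigr => b _; rewrite mulrA.
have -> : \int[P]_w f (V w - c0) - chi_mix bs f 0 =
   (\int[P]_w f (V w - c0) - \int[P]_w exp_sum m n c (V w - c0)) -
   (chi_mix bs f 0 - chi_mix bs (exp_sum m n c) 0) by rewrite Eq; ring.
apply: (le_trans (ler_normB _ _)); rewrite [leRHS]splitr; apply: lerD.
  rewrite -[leRHS](Rintegral_prob_cst P); apply: ler_distB_Rintegral => //.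
  - case: (bf) => M [L [fM _]]; apply: (@bounded_integrable _ _ _ P M) => //.
    by apply: (measurableT_comp mf); exact: measurable_funB.
  - exact: integrable_prob_cst.
  - by move=> w; apply: fe; rewrite lerBrDr addNr.
apply: chi_mix_exp_sum_dist => //; first exact: ltW.
by move=> y; rewrite sub0r; exact: fe.
Qed.

End laplace_determines.

(** * From logistic expectations to distribution functions *)

Section portmanteau.
Context {R : realType}.

Lemma Rintegral_bounded_cvg d (T : measurableType d) (Q : probability T R)
    (f_ : nat -> T -> R) (f : T -> R) :
  (forall n, measurable_fun setT (f_ n)) -> measurable_fun setT f ->
  (forall n w, `|f_ n w| <= 1) ->
  {ae Q, forall w, f_ ^~ w @ \oo --> f w} ->
  (fun n => \int[Q]_w f_ n w) @ \oo --> \int[Q]_w f w.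
Proof.
move=> mf_ mf f1 f_f.
have [] := @dominated_convergence _ _ _ Q setT measurableT (fun n => EFin \o f_ n)
   (EFin \o f) (EFin \o cst 1).
- by move=> n; exact/measurable_EFinP.
- exact/measurable_EFinP.
- apply: filterS f_f => w h _; apply: cvg_EFin; last exact: h.
  by apply: nearW.
- exact: integrable_prob_cst.
- by apply: aeW => w n _; rewrite /= lee_fin.
move=> intf _ cv.
apply: (fine_cvg (f := fun n => (\int[Q]_x (EFin \o f_ n) x)%E)).
rewrite fineK; last exact: integrable_fin_num.
exact: cv.
Qed.

Lemma cvgn_dist_le (u : nat -> R) (l e : R) : u @ \oo --> l -> 0 < e ->
  \forall k \near \oo, `|l - u k| <= e.
Proof. by move=> /cvgrPdist_le; apply. Qed.

Lemma logistic_le (x y : R) : x <= y -> logistic y <= logistic x.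
Proof.
move=> xy; rewrite /logistic lef_pV2 ?posrE ?ltr_pwDl ?expR_ge0//.
by rewrite lerD2l ler_expR.
Qed.

Lemma logisticN (x : R) : logistic (- x) = 1 - logistic x.
Proof.
have e0 : 0 < expR x by exact: expR_gt0.
rewrite /logistic expRN; field.
by rewrite !gt_eqF ?addr_gt0.
Qed.

Lemma logistic_natS n : logistic n.+1%:R <= n.+1%:R^-1 :> R.
Proof.
rewrite /logistic lef_pV2 ?posrE ?ltr_pwDl ?expR_ge0//.
by have := @expR_ge1Dx R n.+1%:R; lra.
Qed.

Section test.
Variable x : R.
(** The sign [s = 1] gives an upper approximation of the indicator and [s = -1] a lower one. The
    steepness [(j+1)^2] beats the shift [1/(j+1)]: the exponent at [x] is [- s (j+1)], which makes
    the one-sided error at most [1/(j+1)]. *)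
Let tst (s : R) (j : nat) := logit_test (j.+1%:R ^+ 2) (x + s / j.+1%:R).

Let tstE s j y : tst s j y = logistic (j.+1%:R ^+ 2 * (y - x) - s * j.+1%:R).
Proof. by rewrite /tst /logit_test; congr logistic; field; rewrite addrC natr1. Qed.

Let ind (y : R) : R := (y <= x)%R%:R.

Let upper j y : ind y <= tst 1 j y + j.+1%:R^-1.
Proof.
rewrite /ind; case: (leP y x) => yx /=; last first.
  by rewrite ?mulr0n addr_ge0// ?invr_ge0// ltW// logistic_gt0.
rewrite ?mulr1n -lerBlDr tstE (@le_trans _ _ (logistic (- j.+1%:R)))//.
  by rewrite logisticN lerD2l lerN2 logistic_natS.
apply: logistic_le; rewrite mul1r gerDr.
by rewrite mulr_ge0_le0// ?sqr_ge0// subr_le0.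
Qed.

Let lower j y : tst (-1) j y <= ind y + j.+1%:R^-1.
Proof.
rewrite /ind; case: (leP y x) => yx /=.
  by rewrite ?mulr1n (le_trans (ltW (logistic_lt1 _)))// lerDl invr_ge0.
rewrite ?mulr0n add0r tstE (le_trans _ (logistic_natS j))//.
apply: logistic_le; rewrite mulN1r opprK lerDr.
by rewrite mulr_ge0// ?sqr_ge0// subr_ge0 ltW.
Qed.

Let tst_cvg s y : `|s| <= 1 -> y != x -> (tst s) ^~ y @ \oo --> ind y.
Proof.
move=> s1 yx; apply/cvgrPdist_le => e e0.
have d0 : 0 < `|y - x| by rewrite normr_gt0 subr_eq0.
(* Once [(j+1) |y - x| >= 2], the term [(j+1)^2 (y - x)] exceeds the shift by at least [j+1], so the
   exponent has the sign of [y - x] and modulus at least [j+1]. *)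
have big : \forall j \near \oo, 2 <= j.+1%:R * `|y - x| /\ j.+1%:R^-1 <= e.
  near=> j; split.
    rewrite -ler_pdivrMr// (@le_trans _ _ j%:R) ?ler_nat//.
    by near: j; exact: nbhs_infty_ger.
  by apply: ltW; near: j; exact: (near_infty_natSinv_lt (PosNum e0)).
apply: filterS big => j [dj je]; apply: le_trans je.
have n0 : 0 < j.+1%:R :> R by [].
have sn : `|s * j.+1%:R| <= j.+1%:R by rewrite normrM (gtr0_norm n0) ler_piMl.
rewrite tstE /ind; case: (leP y x) yx => [yx'|xy] yx /=.
  have yltx : y < x by rewrite lt_neqAle yx.
  rewrite ?mulr1n -logisticN ger0_norm ?(ltW (logistic_gt0 _))//.
  apply: le_trans (logistic_natS j); apply: logistic_le.
  move: dj sn; rewrite ltr0_norm ?subr_lt0// ler_norml expr2.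
  set n := j.+1%:R in n0 * => dj /andP[sn1 sn2]; nra.
rewrite ?mulr0n sub0r normrN ger0_norm ?(ltW (logistic_gt0 _))//.
apply: le_trans (logistic_natS j); apply: logistic_le.
move: dj sn; rewrite gtr0_norm ?subr_gt0// ler_norml expr2.
set n := j.+1%:R in n0 * => dj /andP[sn1 sn2]; nra.
Unshelve. all: by end_near. Qed.

Lemma cdf_squeeze d (T : measurableType d) (P : probability T R) (W : nat -> T -> R)
    d' (T' : measurableType d') (Q : probability T' R) (Y : T' -> R) :
  (forall k, measurable_fun setT (W k)) -> measurable_fun setT Y ->
  (forall m a, 0 < m -> (fun k => \int[P]_w logit_test m a (W k w)) @ \oo -->
     \int[Q]_w logit_test m a (Y w)) ->
  Q (Y @^-1` [set x]) = 0%E ->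
  (fun k => fine (P [set w | W k w <= x])) @ \oo --> fine (Q (Y @^-1` [set` `]-oo, x]])).
Proof.
move=> mW mY WY Qx.
have mind : measurable_fun setT ind.
  have -> : ind = \1_[set` `]-oo, x]].
    apply/funext => y; rewrite indicE /ind; congr (_%:R); congr nat_of_bool.
    by apply/idP/idP => [yx|/set_mem/=]; [apply/mem_set; rewrite /= in_itv/=|rewrite in_itv].
  exact: measurable_indic.
have ind1 y : `|ind y| <= 1 by rewrite /ind; case: (leP y x); rewrite /= ?mulr1n ?mulr0n ?normr1 ?normr0.
have indP dd (TT : measurableType dd) (PP : probability TT R) (Z : TT -> R) :
    measurable_fun setT Z -> fine (PP [set w | Z w <= x]) = \int[PP]_w ind (Z w).
  move=> mZ.
  have mS : measurable [set w | Z w <= x].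
    by rewrite -[X in measurable X]setTI; exact: (measurable_fun_ler (g := cst x)).
  rewrite /Rintegral -[X in fine (PP X)]setIT -integral_indic//; congr fine.
  apply: eq_integral => w _; rewrite indicE /ind; congr EFin; congr (_%:R); congr nat_of_bool.
  by apply/idP/idP => [/set_mem//|?]; exact/mem_set.
have mtst s j : measurable_fun setT (tst s j).
  exact: (bounded_lipschitz_measurable (logit_test_bounded_lipschitz _ _)).
have tst1 s j y : `|tst s j y| <= 1.
  by rewrite tstE ger0_norm; apply: ltW; [exact: logistic_lt1|exact: logistic_gt0].
have cY s : `|s| <= 1 -> (fun j => \int[Q]_w tst s j (Y w)) @ \oo --> \int[Q]_w ind (Y w).
  move=> s1; apply: Rintegral_bounded_cvg => //.
  - by move=> j; exact: measurableT_comp.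
  - exact: measurableT_comp.
  - have mx : measurable (Y @^-1` [set x]) by rewrite -[X in measurable X]setTI; exact: mY.
    exists (Y @^-1` [set x]); split => // w /= h; apply: contrapT => Yx; apply: h.
    by apply: tst_cvg => //; apply/eqP.
have -> : Y @^-1` [set` `]-oo, x]] = [set w | Y w <= x].
  by apply/seteqP; split => w /=; rewrite in_itv.
rewrite indP//; under eq_fun do rewrite indP//.
apply/cvgrPdist_le => e e0.
have e30 : 0 < e / 3 by rewrite divr_gt0.
have n1 : `|1 : R| <= 1 by rewrite normr1.
have nN1 : `|-1 : R| <= 1 by rewrite normrN1.
(* The index [j] is fixed from the limit law alone, before [k] moves. Both tests are close to the
   indicator because [Y] has no atom at [x]. *)
have [j [jp jm je]] : exists j, [/\ `|\int[Q]_w ind (Y w) - \int[Q]_w tst 1 j (Y w)| <= e / 3,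
   `|\int[Q]_w ind (Y w) - \int[Q]_w tst (-1) j (Y w)| <= e / 3 & j.+1%:R^-1 <= e / 3].
  have h1 := cvgn_dist_le (cY _ n1) e30.
  have h2 := cvgn_dist_le (cY _ nN1) e30.
  have h3 := near_infty_natSinv_lt (PosNum e30).
  case: (filterI h1 (filterI h2 h3)) => j _ /(_ j (leqnn _))[? [? ?]].
  by exists j; split; [assumption|assumption|exact: ltW].
have m0 : 0 < j.+1%:R ^+ 2 :> R by rewrite exprn_gt0.
have c_ s : (fun k => \int[P]_w tst s j (W k w)) @ \oo --> \int[Q]_w tst s j (Y w).
  exact: (WY _ (x + s / j.+1%:R) m0).
have cp := c_ 1; have cm := c_ (-1).
have iW k s : P.-integrable setT (EFin \o (fun w => tst s j (W k w))).
  by apply: (@bounded_integrable _ _ _ P 1) => //; exact: measurableT_comp.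
have iI k : P.-integrable setT (EFin \o (fun w => ind (W k w))).
  by apply: (@bounded_integrable _ _ _ P 1) => //; exact: measurableT_comp.
have hp := cvgn_dist_le cp e30.
have hm := cvgn_dist_le cm e30.
apply: filterS (filterI hp hm) => k [kp km].
have up : \int[P]_w ind (W k w) <= \int[P]_w tst 1 j (W k w) + j.+1%:R^-1.
  rewrite -[X in _ + X](Rintegral_prob_cst P) -RintegralD//; last exact: integrable_prob_cst.
  apply: le_Rintegral => //.
  apply: integrable_EFinD => //; exact: integrable_prob_cst.
have lo : \int[P]_w tst (-1) j (W k w) <= \int[P]_w ind (W k w) + j.+1%:R^-1.
  rewrite -[X in _ + X](Rintegral_prob_cst P) -RintegralD//; last exact: integrable_prob_cst.
  apply: le_Rintegral => //.
  apply: integrable_EFinD => //; exact: integrable_prob_cst.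
have eE : e = e / 3 + e / 3 + e / 3 by field.
move: jp jm je kp km up lo; rewrite {}eE.
move: (e / 3) (\int[Q]_w ind (Y w)) (\int[Q]_w tst 1 j (Y w)) (\int[Q]_w tst (-1) j (Y w))
  (\int[P]_w tst 1 j (W k w)) (\int[P]_w tst (-1) j (W k w)) (\int[P]_w ind (W k w))
  (j.+1%:R^-1 : R) => t A B C D E F G; rewrite !ler_norml.
move=> /andP[? ?] /andP[? ?] ? /andP[? ?] /andP[? ?] ? ?.
by apply/andP; split; lra.
Qed.

End test.

Lemma cvg_dist_logit d (T : measurableType d) (P : probability T R) (W : nat -> T -> R)
    d' (T' : measurableType d') (Q : probability T' R) (Y : T' -> R) :
  (forall k, measurable_fun setT (W k)) -> measurable_fun setT Y ->
  (forall m a, 0 < m -> (fun k => \int[P]_w logit_test m a (W k w)) @ \oo -->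
     \int[Q]_w logit_test m a (Y w)) ->
  cvg_dist P W Q Y.
Proof. by move=> mW mY WY x Qx; exact: cdf_squeeze. Qed.

End portmanteau.

(** * Orthogonal diagonalisation of real symmetric matrices *)

Section spectral_real.
Context {R : rcfType}.

Lemma char_poly_orthogonal_conj n (O A : 'M[R]_n) : O *m O^T = 1%:M ->
  char_poly (O *m A *m O^T) = char_poly A.
Proof.
move=> OO; rewrite /char_poly.
have -> : char_poly_mx (O *m A *m O^T) =
    map_mx polyC O *m char_poly_mx A *m map_mx polyC O^T.
  rewrite /char_poly_mx mulmxBr mulmxBl -!map_mxM; congr (_ - _).
  by rewrite scalar_mxC -mulmxA -map_mxM OO map_mx1 mulmx1.
rewrite !det_mulmx mulrC mulrA -det_mulmx -map_mxM.
by rewrite (mulmx1C OO) map_mx1 det1 mul1r.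
Qed.

(** The reflection along [w = e - dl] exchanges the unit vectors [dl] and [e]; if they coincide, the
    identity does. *)
Lemma householder n (e : 'rV[R]_n.+1) : e *m e^T = 1%:M ->
  exists H : 'M[R]_n.+1, [/\ H^T = H, H *m H = 1%:M & delta_mx 0 0 *m H = e].
Proof.
move=> ee; pose dl : 'rV[R]_n.+1 := delta_mx 0 0.
pose w := e - dl.
have [w0|w0] := eqVneq w 0.
  exists 1%:M; split; rewrite ?trmx1 ?mulmx1//.
  by apply/esym/eqP; rewrite -subr_eq0 -/w w0.
pose q := (w *m w^T) 0 0.
have wwE : w *m w^T = q%:M by rewrite [LHS]mx11_scalar.
have q0 : q != 0.
  apply: contra_neq w0 => q0; apply/rowP => j; rewrite [RHS]mxE.
  have : \sum_k w 0 k ^+ 2 = q.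
    by rewrite /q [RHS]mxE; apply: eq_bigr => k _; rewrite [w^T _ _]mxE expr2.
  rewrite q0 => /eqP; rewrite psumr_eq0; last by move=> k _; exact: sqr_ge0.
  by move/allP/(_ j); rewrite mem_index_enum sqrf_eq0 => /(_ isT)/eqP.
pose H := 1%:M - (2 / q) *: (w^T *m w).
have dlM (M : 'cV[R]_n.+1) : dl *m M = (M 0 0)%:M.
  by rewrite -rowE [LHS]mx11_scalar mxE.
have qE : q = 2 - 2 * e 0 0.
  have -> : q = (e *m e^T - e *m dl^T - dl *m e^T + dl *m dl^T) 0 0.
    rewrite /q; congr (fun_of_matrix _ 0 0).
    by rewrite /w linearB/= mulmxBl !mulmxBr opprB addrA addrAC.
  rewrite ee -[e *m dl^T]trmxK trmx_mul trmxK !dlM tr_scalar_mx.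
  by rewrite !mxE !eqxx !mulr1n; ring.
have dw : dl *m w^T = (- (q / 2))%:M.
  by rewrite dlM; congr (_%:M); rewrite qE /w !mxE !eqxx mulr1n; field.
have wE : dl + w = e by rewrite /w addrC subrK.
exists H; split; rewrite /H {H}; clearbody q; clearbody w.
- by rewrite linearB/= linearZ/= trmx1 trmx_mul trmxK.
- rewrite mulmxBl mul1mx mulmxBr mulmx1 -!scalemxAl -!scalemxAr mulmxA -(mulmxA w^T).
  rewrite wwE mul_mx_scalar -scalemxAl !scalerA.
  have -> : 2 / q * (2 / q * q) = 2 / q + 2 / q by field.
  by rewrite scalerDl; move: (_ *: _) => X; rewrite [in X - _]opprD (addrA X) subrr add0r opprK subrK.
- rewrite mulmxBr mulmx1 -scalemxAr mulmxA -/dl dw mul_scalar_mx scalerA.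
  have -> : 2 / q * - (q / 2) = -1 by field.
  by rewrite scaleN1r opprK.
Qed.

(** Deflation: a reflection moves a unit eigenvector for the head of [s] to the first coordinate,
    and symmetry makes the matrix block diagonal. The roots are consumed in the order of [s], so the
    diagonal inherits that order. *)
Lemma real_spectral n (A : 'M[R]_n) (s : seq R) : A^T = A -> size s = n ->
  char_poly A = \prod_(x <- s) ('X - x%:P) ->
  exists O : 'M[R]_n, O *m O^T = 1%:M /\ O *m A *m O^T = diag_mx (\row_j s`_j).
Proof.
elim: n A s => [|n ih] A s As.
  by move=> _ _; exists 1%:M; split; apply/matrixP => -[].
case: s => // x s [ss] chA.
have : root (char_poly A) x by rewrite chA big_cons rootM root_XsubC eqxx.
rewrite -eigenvalue_root_char => /eigenvalueP[v vA v0].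
pose q := \sum_k v 0 k ^+ 2.
have q0 : 0 < q.
  rewrite lt_def sumr_ge0 ?andbT; last by move=> k _; exact: sqr_ge0.
  apply: contra_neq v0; move/eqP; rewrite psumr_eq0; last by move=> k _; exact: sqr_ge0.
  move/allP => h; apply/rowP => j; rewrite mxE.
  by have := h j; rewrite mem_index_enum sqrf_eq0 => /(_ isT)/eqP.
pose e := (Num.sqrt q)^-1 *: v.
have ee : e *m e^T = 1%:M.
  rewrite linearZ/= -scalemxAl -scalemxAr scalerA [v *m _]mx11_scalar.
  have -> : (v *m v^T) 0 0 = q by rewrite mxE; apply: eq_bigr => k _; rewrite mxE expr2.
  by rewrite -expr2 exprVn sqr_sqrtr ?ltW// scale_scalar_mx mulVf ?gt_eqF.
have eA : e *m A = x *: e by rewrite /e -scalemxAl vA scalerA mulrC -scalerA.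
have [H [HT HH dH]] := householder ee.
pose B := H *m A *m H.
have dB : delta_mx 0 0 *m B = x *: (delta_mx 0 0 : 'rV[R]_n.+1).
  by rewrite /B !mulmxA dH eA -scalemxAl -dH -mulmxA HH mulmx1.
have BT : B^T = B by rewrite /B !trmx_mul HT As mulmxA.
have B0 j : B 0 j = x *+ (j == 0).
  have := congr1 (fun M : 'rV[R]_n.+1 => M 0 j) dB.
  by rewrite -rowE !mxE ?eqxx/= => ->; rewrite mulr_natr.
have BA : H *m A *m H = B by [].
clearbody B; pose A' := drsubmx (B : 'M[R]_(1 + n)).
have BE : B = block_mx (x%:M : 'M[R]_1) 0 0 A' :> 'M[R]_(1 + n).
  have l0 : lshift n (0 : 'I_1) = 0 :> 'I_n.+1 by exact: val_inj.
  have r0 (k : 'I_n) : (rshift 1 k == 0 :> 'I_n.+1) = false by exact/eqP.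
  rewrite -[LHS](@submxK _ 1 n 1 n); congr block_mx; apply/matrixP => i j.
  - by rewrite !mxE !ord1 l0 B0 eqxx.
  - by rewrite !mxE !ord1 l0 B0 r0.
  - by rewrite !mxE !ord1 l0 -BT mxE B0 r0.
have A'T : A'^T = A' by rewrite /A' -{2}BT trmx_drsub.
have HTH : H *m H^T = 1%:M by rewrite HT.
have chB : char_poly B = char_poly A by rewrite -(char_poly_orthogonal_conj A HTH) HT BA.
have chBl : char_poly (block_mx (x%:M : 'M[R]_1) 0 0 A') = ('X - x%:P) * char_poly A'.
  rewrite /char_poly char_block_diag_mx det_ublock; congr (_ * _).
  by rewrite det_mx11 !mxE.
(* Cancelling the nonzero factor ['X - x%:P] shows that the smaller block has exactly the remaining
   roots. *)
have chA' : char_poly A' = \prod_(y <- s) ('X - y%:P).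
  have : ('X - x%:P) * char_poly A' = ('X - x%:P) * \prod_(y <- s) ('X - y%:P).
    rewrite -(big_cons _ _ x s xpredT (fun y => 'X - y%:P)) -chA -chB -chBl.
    by congr char_poly; rewrite BE.
  by apply: mulfI; rewrite polyXsubC_eq0.
have [U0 [UU UA]] := ih A' s A'T ss chA'.
pose K : 'M[R]_(1 + n) := block_mx (1%:M : 'M[R]_1) 0 0 U0.
have KT : K^T = block_mx (1%:M : 'M[R]_1) 0 0 U0^T.
  by rewrite /K tr_block_mx !trmx0 trmx1.
have KK : K *m K^T = 1%:M.
  rewrite KT /K mulmx_block !mul0mx !mulmx0 !mulmx1 !addr0 !add0r UU.
  by rewrite -scalar_mx_block.
have KB : K *m block_mx (x%:M : 'M[R]_1) 0 0 A' *m K^T =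
    block_mx (x%:M : 'M[R]_1) 0 0 (diag_mx (\row_(j < n) s`_j)).
  rewrite KT /K !mulmx_block !mul0mx !mulmx0 !mulmx1 !mul1mx.
  by rewrite !addr0 !add0r !mul0mx UA.
exists (K *m H); split.
  by rewrite trmx_mul mulmxA -(mulmxA K H) HTH mulmx1.
have -> : K *m H *m A *m (K *m H)^T = K *m B *m K^T.
  by rewrite trmx_mul HT -BA !mulmxA.
rewrite BE; move: KB => ->.
transitivity (diag_mx (row_mx (x%:M : 'M[R]_1) (\row_(j < n) s`_j))).
  rewrite diag_mx_row (_ : diag_mx (x%:M : 'M[R]_1) = x%:M)//.
  by apply/matrixP => i j; rewrite !mxE !ord1 eqxx.
congr diag_mx; apply/rowP => j; rewrite !mxE; case: splitP => k jk.
  by rewrite jk !ord1 mxE eqxx.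
by rewrite jk mxE.
Qed.

End spectral_real.

(** * Kronecker products, stacked vectors and the block covariance *)

Section kronecker.
Context {R : realType}.

Lemma unidxK a d (p : 'I_(a * d)) : mxvec_index (unidx p).1 (unidx p).2 = p.
Proof.
rewrite /mxvec_index /unidx -surjective_pairing enum_valK.
exact: val_inj.
Qed.

Lemma mxvec_indexK a d (i : 'I_a) (c : 'I_d) : unidx (mxvec_index i c) = (i, c).
Proof. by rewrite /unidx /mxvec_index cast_ordK enum_rankK. Qed.

Lemma sum_unidx a d (F : 'I_a -> 'I_d -> R) :
  \sum_(p < a * d) F (unidx p).1 (unidx p).2 = \sum_i \sum_c F i c.
Proof.
rewrite pair_big/= (reindex (fun ic : 'I_a * 'I_d => mxvec_index ic.1 ic.2))/=.
  by apply: eq_bigr => -[i c] _; rewrite mxvec_indexK.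
exists unidx => [[i c] _|p _]; first exact: mxvec_indexK.
exact: unidxK.
Qed.

Lemma trmx_kron m1 n1 m2 n2 (A : 'M[R]_(m1, n1)) (B : 'M[R]_(m2, n2)) :
  (kron A B)^T = kron A^T B^T.
Proof. by apply/matrixP => p q; rewrite !mxE. Qed.

Lemma mulmx_kron m1 n1 p1 m2 n2 p2 (A : 'M[R]_(m1, n1)) (B : 'M[R]_(m2, n2))
    (C : 'M[R]_(n1, p1)) (D : 'M[R]_(n2, p2)) :
  kron A B *m kron C D = kron (A *m C) (B *m D).
Proof.
apply/matrixP => p q; rewrite !mxE.
under eq_bigr do rewrite !mxE.
rewrite (sum_unidx (fun i c => A (unidx p).1 i * B (unidx p).2 c *
  (C i (unidx q).1 * D c (unidx q).2))).
rewrite mulr_suml; apply: eq_bigr => i _; rewrite mulr_sumr; apply: eq_bigr => c _.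
by ring.
Qed.

Lemma sym_idempotent_kron a d (TW : 'M[R]_a) (TS : 'M[R]_d) :
  sym_idempotent TW -> sym_idempotent TS -> sym_idempotent (kron TW TS).
Proof.
move=> [W1 W2] [S1 S2]; split; first by rewrite trmx_kron W1 S1.
by rewrite mulmx_kron W2 S2.
Qed.

(* The [i]-th block of a stacked vector, with junk value [0] for [i >= a]. *)
Definition unstack a d (y : 'cV[R]_(a * d)) (i : nat) : 'cV[R]_d :=
  \col_c (if insub i is Some i0 then y (mxvec_index i0 c) 0 else 0).

Lemma unstackE a d (y : 'cV[R]_(a * d)) (i : 'I_a) c :
  unstack y i c 0 = y (mxvec_index i c) 0.
Proof. by rewrite mxE insubT// => ia; congr (y (mxvec_index _ _) _); exact: val_inj. Qed.

Lemma dot_stack a d (y : 'cV[R]_(a * d)) (v : nat -> 'cV[R]_d) :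
  (y^T *m stack a d v) 0 0 = \sum_(i < a) ((unstack y i)^T *m v i) 0 0.
Proof.
rewrite mxE.
rewrite (eq_bigr (fun p => y (mxvec_index (unidx p).1 (unidx p).2) 0 *
   v (unidx p).1 (unidx p).2 0)); last by move=> p _; rewrite !mxE unidxK.
rewrite (sum_unidx (fun i c => y (mxvec_index i c) 0 * v i c 0)).
by apply: eq_bigr => i _; rewrite mxE; apply: eq_bigr => c _; rewrite mxE unstackE.
Qed.

Lemma quad_blockdiag a d (M : nat -> 'M[R]_d) (y : 'cV[R]_(a * d)) :
  (y^T *m blockdiag a d M *m y) 0 0 =
  \sum_(i < a) ((unstack y i)^T *m M i *m unstack y i) 0 0.
Proof.
rewrite -mulmxA.
have -> : blockdiag a d M *m y = stack a d (fun i => M i *m unstack y i).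
  apply/colP => p; rewrite !mxE.
  rewrite (eq_bigr (fun q => (if (unidx p).1 == (unidx q).1 then
     M (unidx p).1 (unidx p).2 (unidx q).2 else 0) *
     y (mxvec_index (unidx q).1 (unidx q).2) 0)); last first.
    by move=> q _; rewrite !mxE unidxK.
  rewrite (sum_unidx (fun i c => (if (unidx p).1 == i then M (unidx p).1 (unidx p).2 c else 0) *
     y (mxvec_index i c) 0)).
  rewrite (bigD1 (unidx p).1)//= [X in _ + X]big1 ?addr0; last first.
    by move=> i ip; rewrite big1// => c _; rewrite eq_sym (negbTE ip) mul0r.
  by apply: eq_bigr => c _; rewrite eqxx unstackE.
by rewrite dot_stack; apply: eq_bigr => i _; rewrite mulmxA.
Qed.

Lemma unstack_eq0 a d (y : 'cV[R]_(a * d)) :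
  (forall i : 'I_a, unstack y i = 0) -> y = 0.
Proof.
move=> y0; apply/colP => p; rewrite [RHS]mxE -(unidxK p) -unstackE y0 mxE//.
Qed.

Section posdef.
Variables (a d : nat) (n : nat -> nat) (Sigma : nat -> 'M[R]_d).
Hypothesis n0 : forall i, (i < a)%N -> (0 < n i)%N.
Hypothesis Sp : forall i, (i < a)%N -> sym_posdef (Sigma i).
Local Notation V := (Vmat a d n Sigma).

Lemma weight_gt0 i : (i < a)%N -> 0 < (Ntot a n)%:R / (n i)%:R :> R.
Proof.
move=> ia; rewrite divr_gt0// ltr0n ?n0//.
rewrite /Ntot (bigD1 (Ordinal ia))//= addn_gt0 n0//.
Qed.

Lemma trmx_Vmat : V^T = V.
Proof.
apply/matrixP => p q; rewrite !mxE eq_sym; case: eqP => // e.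
rewrite e; congr (_ * _).
have := congr1 (fun M : 'M[R]_d => M (unidx p).2 (unidx q).2) (Sp (ltn_ord (unidx p).1)).1.
by rewrite mxE -?e => ->.
Qed.

Lemma quad_Vmat (y : 'cV[R]_(a * d)) : (y^T *m V *m y) 0 0 =
  \sum_(i < a) (Ntot a n)%:R / (n i)%:R *
    ((unstack y i)^T *m Sigma i *m unstack y i) 0 0.
Proof.
rewrite quad_blockdiag; apply: eq_bigr => i _.
by rewrite -scalemxAr -scalemxAl mxE.
Qed.

Lemma quad_sigma_ge0 i (u : 'cV[R]_d) : (i < a)%N -> 0 <= (u^T *m Sigma i *m u) 0 0.
Proof.
move=> ia; have [->|u0] := eqVneq u 0; first by rewrite mulmx0 mxE.
by apply: ltW; apply: (Sp ia).2.
Qed.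

Lemma quad_Vmat_ge0 (y : 'cV[R]_(a * d)) : 0 <= (y^T *m V *m y) 0 0.
Proof.
rewrite quad_Vmat; apply: sumr_ge0 => i _.
by rewrite mulr_ge0 ?quad_sigma_ge0// ltW// weight_gt0.
Qed.

Lemma quad_Vmat_eq0 (y : 'cV[R]_(a * d)) : (y^T *m V *m y) 0 0 = 0 -> y = 0.
Proof.
rewrite quad_Vmat => /eqP; rewrite psumr_eq0; last first.
  by move=> i _; rewrite mulr_ge0 ?quad_sigma_ge0// ltW// weight_gt0.
move=> /allP h; apply: unstack_eq0 => i; apply/eqP; apply: contraT => yi0.
have := h i; rewrite mem_index_enum => /(_ isT).
rewrite mulf_eq0 (gt_eqF (weight_gt0 (ltn_ord i)))/= (gt_eqF _)//.
exact: (Sp (ltn_ord i)).2.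
Qed.

End posdef.
End kronecker.

(** * Measurability with respect to generated sigma-algebras *)

Section model_measurability.
Context {R : realType}.

Lemma measurable_fun_of_le d (T : measurableType d) (f : T -> R) :
  (forall t, measurable [set x | f x <= t]) -> measurable_fun setT f.
Proof.
move=> mf; apply: (measurability _ (RGenOInfty.measurableE R)) => _ [B [t ->] <-].
rewrite setTI (_ : _ @^-1` _ = ~` [set x | f x <= t]); first exact: measurableC.
by apply/seteqP; split => x /=; rewrite in_itv/= andbT ltNge => /negP.
Qed.

(** Independence speaks only of events in the generated sigma-algebra, so measurability is checked
    on the type [S] carrying exactly that sigma-algebra. *)
Lemma vec_gen_linear dT (Omega : measurableType dT) d (X : Omega -> 'cV[R]_d)
    (u : 'cV[R]_d) (B : set R) : measurable B ->
  <<s vec_gen X >> ((fun w => (u^T *m X w) 0 0) @^-1` B).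
Proof.
move=> mB.
pose S := g_sigma_algebraType (vec_gen X).
have mX c : measurable_fun setT (fun w : S => X w c 0).
  apply: measurable_fun_of_le => t; apply: sub_sigma_algebra.
  by exists c, t.
have mf : measurable_fun setT (fun w : S => (u^T *m X w) 0 0).
  under eq_fun do rewrite mxE.
  by apply: measurable_sum => c; apply: measurable_funM.
by have := mf measurableT _ mB; rewrite setTI.
Qed.

Lemma rv_gen_preimage dT (Omega : measurableType dT) (C : Omega -> R)
    (B : set R) : measurable B -> <<s rv_gen C >> (C @^-1` B).
Proof.
move=> mB.
pose S := g_sigma_algebraType (rv_gen C).
have mf : measurable_fun setT (C : S -> R).
  apply: measurable_fun_of_le => t; apply: sub_sigma_algebra.
  by exists t.
by have := mf measurableT _ mB; rewrite setTI.
Qed.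

End model_measurability.

Lemma trmxZ (R : pzRingType) m n (c : R) (M : 'M[R]_(m, n)) : (c *: M)^T = c *: M^T.
Proof. by apply/matrixP => i j; rewrite !mxE. Qed.

(** * The law of the statistic for one model *)

Section split_plot_model.
Context {R : realType} {dT : measure_display} {Omega : measurableType dT}.
Variable (P : probability Omega R).
Variables (a d : nat) (n : nat -> nat) (mu : nat -> 'cV[R]_d) (Sigma : nat -> 'M[R]_d).
Variables (TW : 'M[R]_a) (TS : 'M[R]_d) (X : nat -> nat -> Omega -> 'cV[R]_d).
Variable lam : seq R.
Hypothesis n0 : forall i, (i < a)%N -> (0 < n i)%N.
Hypothesis Sp : forall i, (i < a)%N -> sym_posdef (Sigma i).
Hypothesis HTW : sym_idempotent TW.
Hypothesis HTS : sym_idempotent TS.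
Hypothesis HT0 : kron TW TS != 0.
Hypothesis HX : forall i j, (i < a)%N -> (j < n i)%N -> mvnormal P (X i j) (mu i) (Sigma i).
Hypothesis Hindep : mutual_indep P
  [set ij : nat * nat | (ij.1 < a)%N /\ (ij.2 < n ij.1)%N]
  (fun ij => vec_gen (X ij.1 ij.2)).
Hypothesis H0 : kron TW TS *m stack a d mu = 0.
Local Notation T := (kron TW TS).
Local Notation V := (Vmat a d n Sigma).
Local Notation A := (T *m V *m T).
Hypothesis Hlam : eigenvalues_desc A lam.

Let TT : T^T = T. Proof. exact: (sym_idempotent_kron HTW HTS).1. Qed.
Let TK : T *m T = T. Proof. exact: (sym_idempotent_kron HTW HTS).2. Qed.

Let spectral : exists O : 'M[R]_(a * d), O *m O^T = 1%:M /\
  O *m A *m O^T = diag_mx (\row_j lam`_j).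
Proof.
case: Hlam => slam [_ chA]; apply: real_spectral => //.
by rewrite !trmx_mul TT (trmx_Vmat n Sp) mulmxA.
Qed.

Section diagonalized.
Variable O : 'M[R]_(a * d).
Hypothesis OO : O *m O^T = 1%:M.
Hypothesis OA : O *m A *m O^T = diag_mx (\row_j lam`_j).

Lemma quad_eigenvalues (U : 'cV[R]_(a * d)) :
  ((T *m (O^T *m U))^T *m V *m (T *m (O^T *m U))) 0 0 = \sum_(s < a * d) lam`_s * U s 0 ^+ 2.
Proof.
transitivity ((U^T *m diag_mx (\row_j lam`_j) *m U) 0 0).
  by rewrite -OA !trmx_mul TT trmxK !mulmxA.
rewrite mxE; apply: eq_bigr => s _; rewrite mul_mx_diag !mxE; ring.
Qed.

Lemma eigenvalues_ge0 s : 0 <= lam`_s.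
Proof.
have [sl|sl] := ltnP s (a * d); last by rewrite nth_default//; case: Hlam => ->.
have := quad_eigenvalues (delta_mx (Ordinal sl) 0).
have -> : \sum_(t < a * d) lam`_t * (delta_mx (Ordinal sl) 0 : 'cV[R]_(a * d)) t 0 ^+ 2 = lam`_s.
  rewrite (bigD1 (Ordinal sl))//= mxE !eqxx expr1n mulr1 big1 ?addr0//.
  by move=> t /negbTE ts; rewrite mxE ts expr0n/= mulr0.
by move=> <-; exact: quad_Vmat_ge0.
Qed.

(** If every eigenvalue were 0, definiteness of [V] would force [T *m O^T = 0], hence [T = 0]. This
    makes the denominators of [beta] and [Wtilde] positive. *)
Lemma sum_sqr_eigenvalues_gt0 : 0 < \sum_(x <- lam) x ^+ 2.
Proof.
rewrite lt_def sumr_ge0 ?andbT; last by move=> x _; exact: sqr_ge0.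
apply: contra_neq HT0 => /eqP; rewrite psumr_eq0; last by move=> x _; exact: sqr_ge0.
move=> /allP lam0.
have l0 (s : 'I_(a * d)) : lam`_s = 0.
  apply/eqP; rewrite -sqrf_eq0; apply: lam0; apply: mem_nth.
  by case: Hlam => -> _.
have TO0 : T *m O^T = 0.
  apply/matrixP => p q; rewrite [RHS]mxE.
  have := quad_eigenvalues (delta_mx q 0).
  rewrite big1; last by move=> s _; rewrite l0 mul0r.
  move=> /(@quad_Vmat_eq0 _ _ _ n Sigma n0 Sp); rewrite mulmxA => /colP/(_ p).
  by rewrite -colE !mxE.
by rewrite -[LHS]mulmx1 -(mulmx1C OO) mulmxA TO0 mul0mx.
Qed.

Let Ns := Num.sqrt (Ntot a n)%:R : R.

(** Extended by 0 beyond [a * d] so as to be indexed by [nat], the form in which [laplace_of_cos]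
    takes its variables. *)
Definition eigen_score (s : nat) (w : Omega) : R :=
  if insub s is Some s0 then (Ns *: (O *m (T *m Xbar a d n X w))) (s0 : 'I_(a * d)) 0 else 0.

Lemma eigen_scoreE (s : 'I_(a * d)) w :
  eigen_score s w = (Ns *: (O *m (T *m Xbar a d n X w))) s 0.
Proof. by rewrite /eigen_score valK. Qed.

Lemma Qstat_eigen_score w : Qstat a d n T X w = \sum_(s < a * d) eigen_score s w ^+ 2.
Proof.
rewrite /Qstat; set x := Xbar a d n X w.
transitivity (((Ns *: (O *m (T *m x)))^T *m (Ns *: (O *m (T *m x)))) 0 0).
  rewrite trmxZ -scalemxAl -scalemxAr scalerA [RHS]mxE -expr2 sqr_sqrtr ?ler0n//.
  congr (_ * fun_of_matrix _ _ _).
  by rewrite !trmx_mul TT !mulmxA -(mulmxA _ O^T) (mulmx1C OO) mulmx1 -(mulmxA _ T T) TK.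
rewrite mxE; apply: eq_bigr => s _; rewrite eigen_scoreE mxE expr2.
by rewrite -/x.
Qed.

Let weight (y : 'cV[R]_(a * d)) i := (Ns / (n i)%:R) *: unstack y i.

(** Turns a combination of scores, which are dependent as functions of the sample, into a sum over
    the independent observations. *)
Lemma sum_eigen_score (u : nat -> R) w :
  \sum_(s < a * d) u s * eigen_score s w =
  \sum_(i < a) \sum_(j < n i)
    ((weight (T *m (O^T *m \col_s u s)) i)^T *m X i j w) 0 0.
Proof.
set U := \col_s u s; set y := T *m (O^T *m U).
transitivity (Ns * (y^T *m Xbar a d n X w) 0 0).
  transitivity ((U^T *m (Ns *: (O *m (T *m Xbar a d n X w)))) 0 0).
    rewrite mxE; apply: eq_bigr => s _; rewrite eigen_scoreE; congr (_ * _).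
    by rewrite !mxE.
  by rewrite -scalemxAr mxE /y !trmx_mul TT trmxK !mulmxA.
rewrite dot_stack mulr_sumr; apply: eq_bigr => i _.
rewrite /sample_mean -scalemxAr mulmx_sumr mxE summxE mulrA mulr_sumr.
by apply: eq_bigr => j _; rewrite /weight trmxZ -scalemxAl [RHS]mxE.
Qed.

Lemma measurable_dot i j (v : 'cV[R]_d) : (i < a)%N -> (j < n i)%N ->
  measurable_fun setT (fun w => (v^T *m X i j w) 0 0).
Proof.
move=> ia ji; have [->|v0] := eqVneq v 0; last by have [] := HX ia ji v0.
under eq_fun do rewrite trmx0 mul0mx mxE.
exact: measurable_cst.
Qed.

Lemma cos_dot i j (v : 'cV[R]_d) th : (i < a)%N -> (j < n i)%N ->
  \int[P]_w cos ((v^T *m X i j w) 0 0 + th) =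
  cos ((v^T *m mu i) 0 0 + th) * expR (- ((v^T *m Sigma i *m v) 0 0 / 2)).
Proof.
(* [mvnormal] speaks only of nonzero vectors; for [v = 0] the variable is constant. *)
move=> ia ji; have [->|v0] := eqVneq v 0.
  rewrite trmx0 !mul0mx mxE mul0r oppr0 expR0 mulr1.
  by under eq_Rintegral do rewrite mul0mx mxE; rewrite Rintegral_prob_cst.
by apply: normal_rv_cos; [exact: (Sp ia).2|exact: HX].
Qed.

Let pairs := [seq (i, j) | i <- iota 0 a, j <- iota 0 (n i)].

Let pairsP l : l \in pairs -> (l.1 < a)%N /\ (l.2 < n l.1)%N.
Proof. by move=> /allpairsPdep[i [j [+ + ->]]]/=; rewrite !mem_iota !add0n. Qed.

Let uniq_pairs : uniq pairs.
Proof.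
by apply: allpairs_uniq_dep => [||[i j] [i' j'] _ _ [-> ->]]//; [|move=> i _]; exact: iota_uniq.
Qed.

Let sum_pairs (f : nat * nat -> R) :
  \sum_(l <- pairs) f l = \sum_(i < a) \sum_(j < n i) f (i : nat, j : nat).
Proof.
rewrite big_allpairs_dep -{1}(subn0 a) -/(index_iota 0 a) big_mkord.
by apply: eq_bigr => i _; rewrite -{1}(subn0 (n i)) -/(index_iota 0 (n i)) big_mkord.
Qed.

Lemma measurable_eigen_score s : measurable_fun setT (eigen_score s).
Proof.
have [sl|sl] := ltnP s (a * d); last first.
  rewrite /eigen_score; under eq_fun do rewrite insubN -?leqNgt//.
  exact: measurable_cst.
have -> : eigen_score s = (fun w => \sum_(t < a * d) (t == s :> nat)%:R * eigen_score t w).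
  by apply/funext => w; rewrite (sum_delta (fun t => eigen_score t w) sl).
under eq_fun do rewrite (sum_eigen_score (fun t => (t == s)%:R)).
apply: measurable_sum => i; apply: measurable_sum => j; exact: measurable_dot.
Qed.

Lemma eigen_score_cos (u : nat -> R) th :
  \int[P]_w cos (\sum_(s < a * d) u s * eigen_score s w + th) =
  cos th * expR (- (\sum_(s < a * d) lam`_s * u s ^+ 2 / 2)).
Proof.
pose U : 'cV[R]_(a * d) := \col_s u s; pose y := T *m (O^T *m U).
(* The value 0 off the index set makes [Y l] measurable for every [l], as [mutual_indep_cos]
   demands. *)
pose Y (l : nat * nat) w : R :=
  if (l.1 < a)%N && (l.2 < n l.1)%N then ((weight y l.1)^T *m X l.1 l.2 w) 0 0 else 0.
pose m (l : nat * nat) := ((weight y l.1)^T *m mu l.1) 0 0.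
pose v (l : nat * nat) := ((weight y l.1)^T *m Sigma l.1 *m weight y l.1) 0 0.
have YE l : l \in pairs -> Y l = (fun w => ((weight y l.1)^T *m X l.1 l.2 w) 0 0).
  by move=> /pairsP[l1 l2]; apply/funext => w; rewrite /Y l1 l2.
have mY l : measurable_fun setT (Y l).
  have [h|/negbTE h] := boolP ((l.1 < a)%N && (l.2 < n l.1)%N).
    rewrite (_ : Y l = (fun w => ((weight y l.1)^T *m X l.1 l.2 w) 0 0)).
      by case/andP: h => l1 l2; exact: measurable_dot.
    by apply/funext => w; rewrite /Y h.
  rewrite (_ : Y l = cst 0); first exact: measurable_cst.
  by apply/funext => w; rewrite /Y h.
have sumY w : \sum_(s < a * d) u s * eigen_score s w = \sum_(l <- pairs) Y l w.
  rewrite sum_eigen_score sum_pairs; apply: eq_bigr => i _; apply: eq_bigr => j _.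
  by rewrite /Y/= !ltn_ord.
have N0' (i : 'I_a) : (n i)%:R != 0 :> R by rewrite pnatr_eq0 -lt0n n0.
(* The null hypothesis enters here: the total phase is proportional to [y^T mu], and [y] lies in the
   range of the symmetric matrix [T]. *)
have summ : \sum_(l <- pairs) m l = 0.
  rewrite sum_pairs.
  transitivity (Ns * (y^T *m stack a d mu) 0 0); last first.
    by rewrite /y !trmx_mul TT -!mulmxA H0 !mulmx0 mxE mulr0.
  rewrite dot_stack mulr_sumr; apply: eq_bigr => i _.
  rewrite /m/= sumr_const card_ord /weight trmxZ -scalemxAl mxE -mulr_natr.
  by field.
(* The [n i] observations of group [i], each with squared factor [N / (n i)^2], add up to the weight
   [N / n i] of the block in [V]. *)
have sumv : \sum_(l <- pairs) v l = \sum_(s < a * d) lam`_s * u s ^+ 2.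
  rewrite sum_pairs.
  transitivity ((y^T *m V *m y) 0 0); last first.
    rewrite /y quad_eigenvalues; apply: eq_bigr => s _; by rewrite mxE.
  rewrite quad_Vmat; apply: eq_bigr => i _.
  rewrite /v/= sumr_const card_ord /weight trmxZ -!scalemxAl -scalemxAr scalerA mxE -mulr_natr.
  set q := fun_of_matrix _ 0 0.
  have NsE : Ns ^+ 2 = (Ntot a n)%:R by rewrite sqr_sqrtr.
  by rewrite -NsE; field.
under eq_Rintegral do rewrite sumY.
rewrite (mutual_indep_cos Hindep uniq_pairs pairsP mY (m := m) (e := fun l => expR (- (v l / 2)))).
- rewrite summ add0r; congr (_ * _); rewrite -expR_sum; congr expR.
  by rewrite sumrN -!mulr_suml sumv.
- move=> l B lp mB; rewrite YE//; exact: vec_gen_linear.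
- move=> l th' lp; rewrite YE//; have [l1 l2] := pairsP lp; exact: cos_dot.
Qed.

Lemma Qstat_laplace t : 0 <= t ->
  \int[P]_w expR (- (t * Qstat a d n T X w / 2)) =
  \prod_(s < a * d) (Num.sqrt (1 + t * lam`_s))^-1.
Proof.
move=> t0; rewrite -(laplace_of_cos measurable_eigen_score _ eigen_score_cos t0).
  by apply: eq_Rintegral => w _; rewrite Qstat_eigen_score.
by move=> s _; exact: eigenvalues_ge0.
Qed.

Lemma mxtrace_TV : \tr (T *m V) = \sum_(x <- lam) x.
Proof.
transitivity (\tr A); first by rewrite [RHS]mxtrace_mulC mulmxA TK.
transitivity (\tr (O *m A *m O^T)).
  by rewrite [RHS]mxtrace_mulC !mulmxA (mulmx1C OO) mul1mx.
rewrite OA mxtrace_diag; case: Hlam => sl _.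
by rewrite (big_nth 0) big_mkord sl; apply: eq_bigr => s _; rewrite mxE.
Qed.

Lemma mxtrace_TV2 : \tr ((T *m V) *m (T *m V)) = \sum_(x <- lam) x ^+ 2.
Proof.
transitivity (\tr (A *m A)).
  by rewrite !mulmxA -(mulmxA _ T T) TK [RHS]mxtrace_mulC !mulmxA TK.
transitivity (\tr ((O *m A *m O^T) *m (O *m A *m O^T))).
  rewrite !mulmxA -(mulmxA _ O^T O) (mulmx1C OO) mulmx1 [RHS]mxtrace_mulC !mulmxA.
  by rewrite (mulmx1C OO) mul1mx.
rewrite OA mul_mx_diag; case: Hlam => sl _.
rewrite /mxtrace (big_nth 0) big_mkord sl; apply: eq_bigr => s _.
by rewrite !mxE eqxx mulr1n expr2.
Qed.

End diagonalized.

Local Notation S2 := (\sum_(x <- lam) x ^+ 2).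
Local Notation W := (Wtilde a d n Sigma T X).

Lemma beta_ge0 s : 0 <= beta lam s.
Proof.
have [Q [OO OA]] := spectral.
by rewrite divr_ge0 ?sqrtr_ge0//; exact: (eigenvalues_ge0 OA).
Qed.

Lemma sum_sqr_lam_gt0 : 0 < S2.
Proof. by have [Q [OO OA]] := spectral; exact: (sum_sqr_eigenvalues_gt0 OO OA). Qed.

Lemma beta_default s : (size lam <= s)%N -> beta lam s = 0.
Proof. by move=> ls; rewrite /beta nth_default// mul0r. Qed.

Lemma beta_le_first s : beta lam s <= beta lam 0.
Proof.
have [ls|sl] := leqP (size lam) s; first by rewrite beta_default// beta_ge0.
rewrite /beta ler_pM2r ?invr_gt0 ?sqrtr_gt0 ?sum_sqr_lam_gt0//.
case: Hlam => _ [+ _]; move: sl; case: lam => // x l sl xl.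
case: s sl => // s sl; rewrite /=.
have tr : transitive (fun x y : R => y <= x) by move=> ? ? ? h1 h2; exact: le_trans h2 h1.
by move: xl; rewrite /= (path_sortedE tr) => /andP[/allP h _]; apply: h; exact: mem_nth.
Qed.

(** The weights vanish beyond [size lam] and [f 0 = 0], so the list can be padded to any larger
    length; truncation at an index fixed in advance relies on this. *)
Lemma sum_ord_beta (f : R -> R) m : f 0 = 0 -> (size lam <= m)%N ->
  \sum_(s < m) f (beta lam s) = \sum_(x <- lam) f (x / Num.sqrt S2).
Proof.
move=> f0 lm; rewrite (big_nth 0) big_mkord (big_ord_widen m (fun s => f (lam`_s / Num.sqrt S2)) lm).
rewrite [RHS]big_mkcond/=; apply: eq_bigr => s _; case: ltnP => // ls.
by rewrite beta_default.
Qed.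

Lemma sum_beta_sqr m : (size lam <= m)%N -> \sum_(s < m) beta lam s ^+ 2 = 1.
Proof.
move=> lm; rewrite (sum_ord_beta (f := fun x => x ^+ 2))// ?expr0n//.
under eq_bigr do rewrite expr_div_n sqr_sqrtr ?(ltW sum_sqr_lam_gt0)//.
by rewrite -mulr_suml divff// gt_eqF// sum_sqr_lam_gt0.
Qed.

Lemma measurable_Qstat : measurable_fun setT (Qstat a d n T X).
Proof.
have [Q [OO OA]] := spectral.
have -> : Qstat a d n T X = (fun w => \sum_(s < a * d) eigen_score Q s w ^+ 2).
  by apply/funext => w; rewrite (Qstat_eigen_score OO).
by apply: measurable_sum => s; apply: measurable_funX; exact: measurable_eigen_score.
Qed.

Lemma Qstat_ge0 w : 0 <= Qstat a d n T X w.
Proof.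
have [Q [OO OA]] := spectral.
by rewrite (Qstat_eigen_score OO); apply: sumr_ge0 => s _; exact: sqr_ge0.
Qed.

Let Wscale := Num.sqrt 2 * Num.sqrt S2 : R.

Let Wscale_gt0 : 0 < Wscale.
Proof. by rewrite mulr_gt0 ?sqrtr_gt0 ?sum_sqr_lam_gt0. Qed.

Let WtildeE m w : (size lam <= m)%N -> W w = Qstat a d n T X w / Wscale -
  \sum_(b <- mkseq (beta lam) m) b / Num.sqrt 2.
Proof.
move=> lm; have [Q [OO OA]] := spectral.
rewrite /Wtilde (mxtrace_TV OO OA) (mxtrace_TV2 OO OA) sqrtrM// -/Wscale mulrBl.
congr (_ - _); rewrite big_map -{1}(subn0 m) -/(index_iota 0 m) big_mkord.
rewrite (sum_ord_beta (f := fun x => x / Num.sqrt 2)) ?mul0r//.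
rewrite mulr_suml; apply: eq_bigr => x _; rewrite /Wscale; field.
by rewrite !gt_eqF ?sqrtr_gt0 ?sum_sqr_lam_gt0.
Qed.

Lemma measurable_Wtilde : measurable_fun setT W.
Proof.
have -> : W = (fun w => Qstat a d n T X w / Wscale -
    \sum_(b <- mkseq (beta lam) (size lam)) b / Num.sqrt 2).
  by apply/funext => w; exact: WtildeE.
apply: measurable_funB => //; apply: measurable_funM => //; exact: measurable_Qstat.
Qed.

Lemma Wtilde_chi_mix m c r : (size lam <= m)%N -> 0 < c ->
  \int[P]_w logit_test c r (W w) = chi_mix (mkseq (beta lam) m) (logit_test c r) 0.
Proof.
move=> lm c0; have [Q [OO OA]] := spectral.
rewrite -(@chi_mix_of_laplace _ _ _ P (fun w => Qstat a d n T X w / Wscale))//.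
- by apply: eq_Rintegral => w _; rewrite (WtildeE _ lm).
- by apply/allP => _ /mapP[s _ ->]; exact: beta_ge0.
- by apply: measurable_funM => //; exact: measurable_Qstat.
- by move=> w; rewrite divr_ge0 ?Qstat_ge0// ltW.
(* Chosen so that [t * Q / Wscale = t' * Q / 2]; then [t' * lam_s = sqrt 2 * t * beta_s]. *)
move=> t t0; pose t' := Num.sqrt 2 * t / Num.sqrt S2.
have t'0 : 0 <= t' by rewrite divr_ge0 ?sqrtr_ge0// mulr_ge0 ?sqrtr_ge0.
have sS : Num.sqrt S2 != 0 by rewrite gt_eqF// sqrtr_gt0 sum_sqr_lam_gt0.
have s2 : Num.sqrt 2 != 0 :> R by rewrite gt_eqF// sqrtr_gt0.
transitivity (\int[P]_w expR (- (t' * Qstat a d n T X w / 2))).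
  apply: eq_Rintegral => w _; congr expR; congr (- _).
  have -> : t' * Qstat a d n T X w / 2 =
      t' * Qstat a d n T X w / Num.sqrt 2 ^+ 2 by rewrite sqr_sqrtr.
  by rewrite /t' /Wscale; field; rewrite s2 sS.
rewrite (Qstat_laplace OO OA t'0).
have sl : size lam = (a * d)%N by case: Hlam.
rewrite big_map -{1}(subn0 m) -/(index_iota 0 m) big_mkord.
rewrite (big_ord_widen m (fun s => (Num.sqrt (1 + t' * lam`_s))^-1)); last by rewrite -sl.
rewrite big_mkcond/=; apply: eq_bigr => s _; case: ltnP => ls; last first.
  by rewrite beta_default ?sl// !mulr0 addr0 sqrtr1 invr1.
by congr (Num.sqrt (1 + _))^-1; rewrite /t' /beta; ring.
Qed.

End split_plot_model.

(** * Limits of mixtures along arrays of weights with unit sum of squares *)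

Section limits.
Context {R : realType}.
Local Notation nu := (@normal_prob R 0 1).

Lemma chi_mix_zeros (bs : seq R) f x : all (fun b => b == 0) bs -> chi_mix bs f x = f x.
Proof.
elim: bs x => //= b bs ih x /andP[/eqP -> bs0].
by rewrite gstep0 ?ih// => z; rewrite mul0r.
Qed.

Lemma sum_mkseq (F : R -> R) (b : nat -> R) m :
  \sum_(x <- mkseq b m) F x = \sum_(s < m) F (b s).
Proof. by rewrite big_map -{1}(subn0 m) -/(index_iota 0 m) big_mkord. Qed.

Lemma cvg_sum_ord M (F : nat -> nat -> R) (l : nat -> R) :
  (forall s, F s @ \oo --> l s) ->
  (fun k => \sum_(s < M) F s k) @ \oo --> \sum_(s < M) l s.
Proof.
move=> Fl; elim: M => [|M ih].
  by rewrite big_ord0; under eq_fun do rewrite big_ord0; exact: cvg_cst.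
rewrite big_ord_recr/=; under eq_fun do rewrite big_ord_recr/=.
exact: cvgD.
Qed.

Section weights.
Variables (be : nat -> nat -> R) (D : nat -> nat).
Hypothesis be0 : forall k s, 0 <= be k s.
Hypothesis be1 : forall k m, (D k <= m)%N -> \sum_(s < m) be k s ^+ 2 = 1.
Variables (c r : R).
Hypothesis c0 : 0 < c.
Variable I : nat -> R.
Local Notation f := (logit_test c r).
Hypothesis IE : forall k m, (D k <= m)%N -> I k = chi_mix (mkseq (be k) m) f 0.

Let bf : bounded_lipschitz f. Proof. exact: logit_test_bounded_lipschitz. Qed.

(** The replacement error is a sum of cubes, at most the largest weight times the sum of squares,
    which is 1. *)
Lemma cvg_of_max_weight : (forall k s, be k s <= be k 0%N) ->
  (fun k => be k 0%N) @ \oo --> (0 : R) -> I @ \oo --> \int[nu]_z f z.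
Proof.
move=> bemax b00.
have [f1 [f2 [bf1 bf2 tf]]] := logit_test_taylor3 c r.
set K := 3 * `|c| ^+ 3 in tf.
have K0 : 0 <= K by rewrite mulr_ge0// exprn_ge0.
pose C := K * (\int[nu]_z (`|chi_std z| ^+ 3) + \int[nu]_z (`|z| ^+ 3)).
have C0 : 0 <= C.
  by rewrite mulr_ge0// addr_ge0//; apply: Rintegral_ge0 => z _; rewrite exprn_ge0.
have bound k : `|I k - \int[nu]_z f z| <= C * be k 0%N.
  have all0 : all (fun b => 0 <= b) (mkseq (be k) (D k)).
    by apply/allP => _ /mapP[s _ ->].
  have := lindeberg_chi_mix K0 all0 bf bf1 bf2 tf 0 (lexx 0).
  have -> : nstep 0 f = f.
    by apply/funext => x; rewrite /nstep gstep0// => z; rewrite mul0r.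
  rewrite (IE (leqnn _)) !sum_mkseq be1// expr0n addr0 sqrtr1.
  have -> : nstep 1 f 0 = \int[nu]_z f z.
    by apply: eq_Rintegral => z _; rewrite mul1r add0r.
  move=> /le_trans; apply; rewrite -/C ler_wpM2l//.
  rewrite -[leRHS]mulr1 -(be1 (leqnn (D k))) mulr_sumr; apply: ler_sum => s _.
  by rewrite exprS ler_wpM2r// sqr_ge0.
apply/cvgrPdist_le => e e0.
have cC : (fun k => C * be k 0%N) @ \oo --> (0 : R).
  by rewrite -[X in _ --> X](mulr0 C); exact: cvgMr.
apply: filterS (cvgr_le 0 cC e e0) => k ke; rewrite distrC.
exact: le_trans (bound k) ke.
Qed.

(** Truncating at [M] costs [c^2] times the remaining variance, which tends to
    [c^2 (1 - sum_(s < M) b_s^2)] as [k] grows and is small for large [M]. So [M] is fixed first;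
    the finitely many kept weights then converge. *)
Lemma cvg_of_weights (b : nat -> R) (L : R) :
  (fun m => \sum_(s < m) b s ^+ 2) @ \oo --> (1 : R) ->
  (forall s, (fun k => be k s) @ \oo --> b s) ->
  (fun m => chi_mix (mkseq b m) f 0) @ \oo --> L ->
  I @ \oo --> L.
Proof.
move=> b2 beb bL.
have [f1 tf] := logit_test_taylor2 c r.
have fL := logit_test_lipschitz r (ltW c0).
pose C1 := c * \int[nu]_z `|chi_std z|.
pose Err M k := c ^+ 2 * (1 - \sum_(s < M) be k s ^+ 2) + C1 * \sum_(s < M) `|be k s - b s|.
have bound M k : `|I k - chi_mix (mkseq b M) f 0| <= Err M k.
  (* Long enough to contain the first [M] weights and, by padding with zeros, to represent all of
     [I k]. *)
  pose m := maxn M (D k).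
  have Mm : (M <= m)%N by exact: leq_maxl.
  rewrite (IE (leq_maxr M (D k))) -/m.
  have mE : mkseq (be k) m = mkseq (be k) M ++ [seq be k s | s <- iota M (m - M)].
    by rewrite /mkseq -[in LHS](subnKC Mm) iotaD map_cat add0n.
  set t := [seq be k s | s <- iota M (m - M)].
  have sumt : \sum_(x <- t) x ^+ 2 = 1 - \sum_(s < M) be k s ^+ 2.
    rewrite -(be1 (leq_maxr M (D k))) -/m -!(sum_mkseq (fun x => x ^+ 2) (be k)) mE big_cat/=.
    by rewrite addrC addrK.
  rewrite mE chi_mix_cat.
  set x1 := chi_mix _ _ 0; pose x2 := chi_mix (mkseq (be k) M) f 0.
  have -> : x1 - chi_mix (mkseq b M) f 0 = (x1 - x2) + (x2 - chi_mix (mkseq b M) f 0) by ring.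
  apply: (le_trans (ler_normD _ _)); apply: lerD.
    rewrite -sumt; apply: ler_dist_chi_mix => //.
      exact: bounded_lipschitz_chi_mix.
    by move=> y; apply: chi_mix_taylor2 => //; exact: tf.
  have := chi_mix_coef_dist (iota 0 M) (be k) b 0 bf fL.
  move=> /le_trans; apply; rewrite /C1 ler_wpM2l//.
    by rewrite mulr_ge0 ?(ltW c0)// Rintegral_ge0.
  by rewrite -{1}(subn0 M) -/(index_iota 0 M) big_mkord.
have ErrL M : Err M @ \oo --> c ^+ 2 * (1 - \sum_(s < M) b s ^+ 2).
  rewrite -[X in _ --> X]addr0; apply: cvgD.
    apply: cvgMr; apply: cvgB; first exact: cvg_cst.
    have h s : (fun k => be k s ^+ 2) @ \oo --> b s ^+ 2.
      by under eq_fun do rewrite expr2; rewrite expr2; apply: cvgM; exact: beb.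
    exact: (cvg_sum_ord (M := M) h).
  rewrite -[X in _ --> X](mulr0 C1); apply: cvgMr.
  rewrite [X in _ --> X](_ : 0 = \sum_(s < M) `|b s - b s|); last first.
    by rewrite big1// => s _; rewrite subrr normr0.
  have h s : (fun k => `|be k s - b s|) @ \oo --> `|b s - b s|.
    by apply: cvg_norm; apply: cvgB; [exact: beb|exact: cvg_cst].
  exact: (cvg_sum_ord (M := M) h).
have errM : (fun M => c ^+ 2 * (1 - \sum_(s < M) b s ^+ 2)) @ \oo --> (0 : R).
  rewrite -[X in _ --> X](mulr0 (c ^+ 2)); apply: cvgMr.
  by rewrite -[X in _ --> X](subrr 1); apply: cvgB => //; exact: cvg_cst.
apply/cvgrPdist_le => e e0.
have e30 : 0 < e / 3 by rewrite divr_gt0.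
have [M [hM1 hM2]] : exists M, c ^+ 2 * (1 - \sum_(s < M) b s ^+ 2) <= e / 3 /\
    `|L - chi_mix (mkseq b M) f 0| <= e / 3.
  case: (filterI (cvgr_le 0 errM (e / 3) e30) (cvgn_dist_le bL e30)) => M _ /(_ M (leqnn _))[h1 h2].
  by exists M.
apply: filterS (cvgn_dist_le (ErrL M) e30) => k hk.
have hb := bound M k.
have hk' : Err M k <= e / 3 + e / 3.
  by move: hk; rewrite ler_norml => /andP[h _]; lra.
have -> : L - I k = (L - chi_mix (mkseq b M) f 0) - (I k - chi_mix (mkseq b M) f 0) by ring.
apply: (le_trans (ler_normB _ _)).
have -> : e = e / 3 + (e / 3 + e / 3) by field.
by apply: lerD => //; exact: le_trans hb hk'.
Qed.

(** The special case of limit weights [1, 0, 0, ...]: for [s > 0] the unit sum of squares gives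
    [be k s ^+ 2 <= 1 - be k 0 ^+ 2], which tends to 0. *)
Lemma cvg_of_first_weight : (fun k => be k 0%N) @ \oo --> (1 : R) ->
  I @ \oo --> \int[nu]_z f (chi_std z).
Proof.
move=> b01; pose b (s : nat) : R := (s == 0%N)%:R.
apply: (@cvg_of_weights b).
- apply/cvgrPdist_le => e e0; exists 1%N => // -[//|m] _ /=.
  rewrite big_ord_recl /b/= expr1n big1 ?addr0 ?subrr ?normr0 ?ltW// => i _.
  by rewrite expr0n.
- case=> [|s]; first exact: b01.
  rewrite /b/=; apply/cvgrPdist_le => e e0.
  have c2 : (fun k => 1 - be k 0%N ^+ 2) @ \oo --> (0 : R).
    have : (fun k => 1 - be k 0%N * be k 0%N) @ \oo --> (1 - 1 * 1 : R).
      by apply: cvgB; [exact: cvg_cst|exact: cvgM].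
    by rewrite mulr1 subrr; under eq_fun do rewrite -expr2.
  have e20 : 0 < e ^+ 2 by rewrite exprn_gt0.
  apply: filterS (cvgr_le 0 c2 _ e20) => k ke; rewrite sub0r normrN ger0_norm//.
  rewrite -(@ler_pXn2r _ 2) ?nnegrE ?be0 ?(ltW e0)//; apply: le_trans ke.
  rewrite -(be1 (leq_maxr s.+2 (D k))).
  have : (s.+2 <= maxn s.+2 (D k))%N by exact: leq_maxl.
  case: (maxn _ _) => // -[//|m] sm.
  rewrite big_ord_recl/= [leRHS]addrC addKr.
  rewrite (bigD1 (Ordinal (sm : (s < m.+1)%N)))//= lerDl.
  by apply: sumr_ge0 => i _; exact: sqr_ge0.
- apply/cvgrPdist_le => e e0; exists 1%N => // -[//|m] _ /=.
  rewrite (_ : gstep _ _ _ = \int[nu]_z f (chi_std z)) ?subrr ?normr0 ?ltW//.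
  apply: eq_Rintegral => z _; rewrite add0r /b/= mul1r chi_mix_zeros//.
  by apply/allP => x /mapP[[|s]]; rewrite mem_iota// => _ ->.
Qed.

End weights.

Lemma chi2_1_law d (T : measurableType d) (P : probability T R) (C : T -> R)
    (h : R -> R) (M : R) : chi2_1 P C -> measurable_fun setT h -> (forall x, `|h x| <= M) ->
  \int[P]_w h (C w) = \int[nu]_z h (z ^+ 2).
Proof.
move=> [mC lC] mh hM.
exact: (@Rintegral_eq_law _ _ _ _ _ P nu C (fun z => z ^+ 2) M).
Qed.

Lemma chi2_1_ge0 d (T : measurableType d) (P : probability T R) (C : T -> R) :
  chi2_1 P C -> {ae P, forall w, 0 <= C w}.
Proof.
move=> [mC lC]; exists (C @^-1` [set` `]-oo, 0[]); split.
- by rewrite -[X in measurable X]setTI; exact: mC.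
- rewrite lC//; rewrite (_ : _ @^-1` _ = set0) ?measure0//.
  by apply/seteqP; split => z //=; rewrite in_itv/= ltNge sqr_ge0.
- by move=> w /= /negP; rewrite -ltNge in_itv.
Qed.

(** [chi_mix_of_laplace] wants a variable that is nonnegative everywhere, while a chi-square
    variable is so only almost surely. The absolute value repairs this without changing the law. *)
Lemma iid_chi2_1_chi_mix d (T : measurableType d) (P : probability T R)
    (C : nat -> T -> R) (b : nat -> R) m c r : iid_chi2_1 P C ->
  (forall s, 0 <= b s) -> 0 < c ->
  \int[P]_w logit_test c r (\sum_(s < m) b s * (`|C s w| - 1) / Num.sqrt 2) =
  chi_mix (mkseq b m) (logit_test c r) 0.
Proof.
move=> [indC chiC] b0 c0.
have sq20 := @sq2_gt0 R.
have mC s : measurable_fun setT (C s) by case: (chiC s).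
rewrite -(@chi_mix_of_laplace _ _ _ P (fun w => \sum_(s < m) b s * `|C s w| / Num.sqrt 2))//.
- apply: eq_Rintegral => w _; congr logit_test.
  rewrite (sum_mkseq (fun x => x / Num.sqrt 2)) -sumrB; apply: eq_bigr => s _.
  by rewrite mulrBr mulr1 mulrBl.
- by apply/allP => _ /mapP[s _ ->].
- apply: measurable_sum => s; apply: measurable_funM => //; apply: measurable_funM => //.
  exact: measurableT_comp.
- by move=> w; apply: sumr_ge0 => s _; rewrite divr_ge0 ?mulr_ge0// ltW.
move=> t t0.
pose h s (y : R) := expR (- (t * (b s * `|y| / Num.sqrt 2))).
have mh s : measurable_fun setT (h s).
  apply: measurableT_comp => //; apply: measurableT_comp => //; apply: measurable_funM => //.
  by apply: measurable_funM => //; apply: measurable_funM => //; exact: normr_measurable.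
have h1 s y : `|h s y| <= 1.
  rewrite ger0_norm ?expR_ge0// -expR0 ler_expR oppr_le0.
  by rewrite !mulr_ge0// invr_ge0 ltW.
transitivity (\int[P]_w \prod_(s <- iota 0 m) h s (C s w)).
  apply: eq_Rintegral => w _; rewrite -expR_sum; congr expR.
  rewrite sumrN mulr_sumr (_ : iota 0 m = index_iota 0 m) ?big_mkord//.
  by rewrite /index_iota subn0.
rewrite (mutual_indep_prod indC (iota_uniq _ _))//; last first.
  by move=> s B _ mB; exact: rv_gen_preimage.
rewrite big_map; apply: eq_bigr => s _.
rewrite (chi2_1_law (chiC s) (mh s) (h1 s)).
rewrite -Rintegral_normal_expR; last exact: sq2_mul_gtN1 (mulr_ge0 t0 (b0 s)).
apply: eq_Rintegral => z _; rewrite /h (ger0_norm (sqr_ge0 z)); congr expR; congr (- _).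
have s2 : Num.sqrt 2 ^+ 2 = 2 :> R by rewrite sqr_sqrtr.
by rewrite -[X in _ = _ / X]s2; field; rewrite gt_eqF.
Qed.

End limits.

Theorem theorem3p1
  (R : realType) (dT : measure_display) (Omega : measurableType dT)
  (P : probability Omega R)
  (a d : nat -> nat) (n : nat -> nat -> nat)
  (mu : forall k, nat -> 'cV[R]_(d k))
  (Sigma : forall k, nat -> 'M[R]_(d k))
  (TW : forall k, 'M[R]_(a k)) (TS : forall k, 'M[R]_(d k))
  (X : forall k, nat -> nat -> Omega -> 'cV[R]_(d k))
  (rho : nat -> R) (lam : nat -> seq R)
  (Ha : forall k, (0 < a k)%N) (Hd : forall k, (0 < d k)%N)
  (Hn : forall k i, (i < a k)%N -> (0 < n k i)%N)
  (HSigma : forall k i, (i < a k)%N -> sym_posdef (Sigma k i))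
  (HTW : forall k, sym_idempotent (TW k))
  (HTS : forall k, sym_idempotent (TS k))
  (HT0 : forall k, kron (TW k) (TS k) != 0)
  (HX : forall k i j, (i < a k)%N -> (j < n k i)%N ->
          mvnormal P (X k i j) (mu k i) (Sigma k i))
  (Hindep : forall k, mutual_indep P
      [set ij : nat * nat | (ij.1 < a k)%N /\ (ij.2 < n k ij.1)%N]
      (fun ij => vec_gen (X k ij.1 ij.2)))
  (Hframe : framework a d n)
  (Hrho : forall i, 0 < rho i < 1 /\
      ((\forall k \near \oo, (i < a k)%N) ->
       (fun k => (n k i)%:R / (Ntot (a k) (n k))%:R) @ \oo --> rho i))
  (H0 : forall k, kron (TW k) (TS k) *m stack (a k) (d k) (mu k) = 0)
  (Hlam : forall k, eigenvalues_desc
      (kron (TW k) (TS k) *m Vmat (a k) (d k) (n k) (Sigma k)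
         *m kron (TW k) (TS k)) (lam k)) :
  let W := fun k w =>
    Wtilde (a k) (d k) (n k) (Sigma k) (kron (TW k) (TS k)) (X k) w in
  (* (a) *)
  ((fun k => beta (lam k) 0) @ \oo --> (0:R) ->
     cvg_dist_law P W (normal_prob (0:R) (1:R))) /\
  (* (b) *)
  ((fun k => beta (lam k) 0) @ \oo --> (1:R) ->
     forall (dT' : measure_display) (Omega' : measurableType dT')
            (P' : probability Omega' R) (C : Omega' -> R),
       chi2_1 P' C ->
       cvg_dist P W P' (fun w => (C w - 1) / Num.sqrt 2)) /\
  (* (c) *)
  (forall b : nat -> R,
     (forall s, 0 <= b s <= 1) -> (forall s, b s.+1 <= b s) ->
     (fun m => \sum_(s < m) b s ^+ 2) @ \oo --> (1:R) ->
     (forall s, (fun k => beta (lam k) s) @ \oo --> b s) ->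
     forall (dT' : measure_display) (Omega' : measurableType dT')
            (P' : probability Omega' R) (C : nat -> Omega' -> R)
            (Y : Omega' -> R),
       iid_chi2_1 P' C -> measurable_fun setT Y ->
       P'.-negligible [set w | ~ ((fun m => \sum_(s < m)
            b s * (C s w - 1) / Num.sqrt 2) @ \oo --> Y w)] ->
       cvg_dist P W P' Y).
Proof.
move=> W.
have be0 k s : 0 <= beta (lam k) s.
  exact: (beta_ge0 (HSigma k) (HTW k) (HTS k) (Hlam k)).
have be1 k m : (size (lam k) <= m)%N -> \sum_(s < m) beta (lam k) s ^+ 2 = 1.
  exact: (sum_beta_sqr (Hn k) (HSigma k) (HTW k) (HTS k) (HT0 k) (Hlam k)).
have bele k s : beta (lam k) s <= beta (lam k) 0.
  exact: (beta_le_first (Hn k) (HSigma k) (HTW k) (HTS k) (HT0 k) (Hlam k)).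
have mW k : measurable_fun setT (W k).
  exact: (measurable_Wtilde (Hn k) (HSigma k) (HTW k) (HTS k) (HT0 k) (HX k) (Hlam k)).
have IE c r (c0 : 0 < c) k m : (size (lam k) <= m)%N ->
    \int[P]_w logit_test c r (W k w) = chi_mix (mkseq (beta (lam k)) m) (logit_test c r) 0.
  move=> lm.
  exact: (Wtilde_chi_mix (Hn k) (HSigma k) (HTW k) (HTS k) (HT0 k) (HX k) (Hindep k) (H0 k)
    (Hlam k) r lm c0).
split; [|split].
(* The limit law is realised as that of the identity under [normal_prob 0 1]. *)
- move=> b00; apply: (@cvg_dist_logit R _ _ P W _ _ (normal_prob 0 1) id) => //.
  move=> c r c0.
  exact: (cvg_of_max_weight be0 be1 (IE c r c0) bele b00).
- move=> b01 dT' Omega' P' C chiC.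
  have mC : measurable_fun setT (fun w => (C w - 1) / Num.sqrt 2).
    by apply: measurable_funM => //; apply: measurable_funB => //; case: chiC.
  apply: cvg_dist_logit => // c r c0.
  have bf := logit_test_bounded_lipschitz c r.
  have mf := bounded_lipschitz_measurable bf.
  have [M [L [fM _]]] := bf.
  have -> : \int[P']_w logit_test c r ((C w - 1) / Num.sqrt 2) =
      \int[normal_prob 0 1]_z logit_test c r (chi_std z).
    apply: (chi2_1_law (h := fun y => logit_test c r ((y - 1) / Num.sqrt 2)) chiC) => [|x].
      by apply: (measurableT_comp mf); apply: measurable_funM => //; exact: measurable_funB.
    exact: fM.
  exact: (cvg_of_first_weight be0 be1 c0 (IE c r c0) b01).
move=> b b01 bdec b2 beb dT' Omega' P' C Y iidC mY negY.
have b0 s : 0 <= b s by case/andP: (b01 s).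
apply: cvg_dist_logit => // c r c0.
apply: (cvg_of_weights be1 c0 (IE c r c0) b2 beb).
have bf := logit_test_bounded_lipschitz c r.
have mf := bounded_lipschitz_measurable bf.
have [indC chiC] := iidC.
have mC s : measurable_fun setT (C s) by case: (chiC s).
(* The truncated mixtures become expectations of the partial sums, written with [|C s|]. Their
   almost sure convergence to [Y] and bounded convergence then identify the limit. *)
under eq_fun do rewrite -(iid_chi2_1_chi_mix _ r iidC b0 c0).
apply: Rintegral_bounded_cvg.
- move=> m; apply: (measurableT_comp mf); apply: measurable_sum => s.
  apply: measurable_funM => //; apply: measurable_funM => //; apply: measurable_funB => //.
  exact: measurableT_comp.
- exact: measurableT_comp.
- by move=> m w; rewrite ger0_norm; apply: ltW; [exact: logistic_lt1|exact: logistic_gt0].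
have aeY : {ae P', forall w, (fun m => \sum_(s < m) b s * (C s w - 1) / Num.sqrt 2) @ \oo --> Y w}.
  exact: negY.
have aeC : {ae P', forall w s, 0 <= C s w}.
  by apply: ae_foralln => s; exact: chi2_1_ge0.
apply: filterS2 aeY aeC => w cY C0.
apply: continuous_cvg; first exact: bounded_lipschitz_continuous.
by under eq_fun do under eq_bigr do rewrite (ger0_norm (C0 _)).
Qed.
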